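(* Let $N\ge3$ and $1<p<\frac{N}{N-2}$. Then (i) if $\overline M\le M\le0$ there exists no ground state of (E); (ii) if $\overline M\le M<-\mu^*$ there exists a positive singular solution $u$ of (E) on $(0,\infty)$, unique up to the scalings $u\mapsto k^{\frac{2}{p-1}}u(k\,\cdot)$, $k>0$, such that $u(r)\sim U_{2,M}(r)$ as $r\to0$, $u(r)\sim U_{1,M}(r)$ as $r\to\infty$, and $u(r)>U_{1,M}(r)$ for all $r>0$.
   Context: (E) denotes the ODE $-u_{rr}-\frac{N-1}{r}u_r=|u|^{p-1}u+M|u_r|^{\frac{2p}{p+1}}$ for $r>0$. A ground state is a nonnegative $u\in C^2([0,\infty))$ with $u_r(0)=0$ solving (E) on $(0,\infty)$. Let $K=\frac{(N-2)p-N}{p-1}$ (negative here), $\mu^*=(p+1)\left(\frac{N-(N-2)p}{2p}\right)^{\frac{p}{p+1}}$, and $\overline M=\frac{(p+1)((N-2)p-N-2)}{(4p)^{\frac{p}{p+1}}((N-2)(p-1)^2+4)^{\frac{1}{p+1}}}$ (one has $\overline M<-\mu^*$). For $M<-\mu^*$ the equation $X^{p-1}+M\left(\frac{2}{p-1}\right)^{\frac{2p}{p+1}}X^{\frac{p-1}{p+1}}-\frac{2K}{p-1}=0$ has exactly two positive roots $X_{1,M}<X_{2,M}$; set $U_{j,M}(r)=X_{j,M}r^{-\frac{2}{p-1}}$. $f\sim g$ means $f/g\to1$. A singular solution is one that does not extend as a $C^2$ solution with $u_r(0)=0$ at $r=0$.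
   Formalization: In (i) a ground state is additionally required to be not identically zero, since u = 0 is a nonnegative C^2 solution of (E) with u_r(0)=0 for every M and would make the nonexistence claim false. *)

(* Defs.v *)
From Stdlib Require Import Reals.
From Coquelicot Require Import Coquelicot.
Open Scope R_scope.

(* x^a for x >= 0 (real exponent a > 0), with the convention 0^a = 0.
   (Stdlib's Rpower 0 a = 1, which is wrong here.) *)
Definition rpow (x a : R) : R := if Rlt_dec 0 x then Rpower x a else 0.

Definition rhsE (p M u ur : R) : R :=
  rpow (Rabs u) (p - 1) * u + M * rpow (Rabs ur) (2 * p / (p + 1)).

Definition solves_E_on_pos (N : nat) (p M : R) (u : R -> R) : Prop :=
  exists u1 u2 : R -> R,
    forall r, 0 < r ->
      is_derive u r (u1 r) /\ is_derive u1 r (u2 r) /\ continuous u2 r /\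
      - u2 r - (INR N - 1) / r * u1 r = rhsE p M (u r) (u1 r).

(* u in C^2([0,oo)) with u_r(0) = 0 solving (E) on (0,oo):
   u, u_r, u_rr are derivatives on (0,oo), continuous on [0,oo)
   (right-continuous at 0), which is the one-sided C^2 regularity at 0. *)
Definition regular_solution (N : nat) (p M : R) (u : R -> R) : Prop :=
  exists u1 u2 : R -> R,
    (forall r, 0 < r ->
      is_derive u r (u1 r) /\ is_derive u1 r (u2 r) /\ continuous u2 r /\
      - u2 r - (INR N - 1) / r * u1 r = rhsE p M (u r) (u1 r)) /\
    filterlim u (at_right 0) (locally (u 0)) /\
    filterlim u1 (at_right 0) (locally (u1 0)) /\
    filterlim u2 (at_right 0) (locally (u2 0)) /\
    u1 0 = 0.

Definition ground_state (N : nat) (p M : R) (u : R -> R) : Prop :=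
  regular_solution N p M u /\
  (forall r, 0 <= r -> 0 <= u r) /\
  (exists r, 0 <= r /\ u r <> 0).

Definition singular_solution (N : nat) (p M : R) (u : R -> R) : Prop :=
  solves_E_on_pos N p M u /\
  ~ (exists w, regular_solution N p M w /\ forall r, 0 < r -> w r = u r).

Definition Kc (N : nat) (p : R) : R := ((INR N - 2) * p - INR N) / (p - 1).

Definition mu_star (N : nat) (p : R) : R :=
  (p + 1) * rpow ((INR N - (INR N - 2) * p) / (2 * p)) (p / (p + 1)).

Definition Mbar (N : nat) (p : R) : R :=
  (p + 1) * ((INR N - 2) * p - INR N - 2) /
  (rpow (4 * p) (p / (p + 1)) *
   rpow ((INR N - 2) * (p - 1) ^ 2 + 4) (1 / (p + 1))).

Definition Xeq (N : nat) (p M X : R) : Prop :=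
  rpow X (p - 1) + M * rpow (2 / (p - 1)) (2 * p / (p + 1)) * rpow X ((p - 1) / (p + 1))
    - 2 * Kc N p / (p - 1) = 0.

Definition Uprof (p X r : R) : R := X * Rpower r (- (2 / (p - 1))).

Definition equiv_at_0 (f g : R -> R) : Prop :=
  filterlim (fun r => f r / g r) (at_right 0) (locally 1).
Definition equiv_at_infty (f g : R -> R) : Prop :=
  filterlim (fun r => f r / g r) (Rbar_locally p_infty) (locally 1).

Definition good_singular (N : nat) (p M X1 X2 : R) (u : R -> R) : Prop :=
  (forall r, 0 < r -> 0 < u r) /\
  singular_solution N p M u /\
  equiv_at_0 u (Uprof p X2) /\
  equiv_at_infty u (Uprof p X1) /\
  (forall r, 0 < r -> u r > Uprof p X1 r).

(* Main.v *)
Require Import Defs.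
From Stdlib Require Import Reals Lra Lia Classical.
From Coquelicot Require Import Coquelicot.
Open Scope R_scope.

(** With [n = N - 2], [a = 2/(p-1)], [m = - M], [t = ln r], put
    [Z = ln (- r u_r / u)] and [T = ln (u / (- u_r)^(2/(p+1)))].  Equation (E) becomes the
    autonomous system
      [Z' = - n + e^Z (1 + h T)],   [T' = c - e^Z (1 + b h T)],   [h T = e^((p+1) T) - m e^T],
    in which the profiles [U_1, U_2] are the fixed points [(ln a, T1)], [(ln a, T2)], [T1 < T2].
    A suitable product of powers is a Dulac function; the divergence it produces is a function of
    [T] alone, and that function [dulac] is nonnegative, with at most one zero, exactly because
    [Mbar <= M].

    (i) The Pohozaev-type function [pohozaev] then increases along orbits as long as it is positive,
    it is positive near [r = 0] for a regular solution, and positivity forces [T' < - const]; hence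
    [T -> - oo] and [e^(-Z)] reaches zero in finite time.

    (ii) Adding the primitive of [dulac] vanishing at [T2] turns [pohozaev] into the function
    [lyapunov], which is nondecreasing along orbits in [T >= T1].  Followed backwards, the stable
    orbit of the saddle [(ln a, T1)] is confined by a level set of [lyapunov] and by the line [u = U_1],
    and converges to [(ln a, T2)].  Near the saddle the system is cooperative in [(- Z, T)], so two orbits
    tending to it on the same side coincide up to translation, that is, up to the scaling of [u]. *)

(** The Dulac weight is [exp ((nu - 1) (Z + cg T))]. The slope [cg] cancels the constant terms of
    [Z' + cg T'], leaving [exp Z (hh T - hs) / (n + 1)]; hence, for every [nu], the divergence of
    the weighted field is the weight times [exp Z] times a function of [T]. In this one-parameter
    family [C1] is the value for which that function stays nonnegative for the largest range of [m],
    and this optimum is where [Mbar] comes from. [pohozaev] is a stream function of the weighted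
    field, which would be a first integral if the divergence vanished. The logarithmic variables ask
    for [u > 0] and [u_r < 0], proved beforehand from the flux, and give a field that is neither
    bounded nor globally Lipschitz. Orbits are therefore built for a cut-off field on the whole
    line, and then shown to stay where the two fields agree. The saddle is never linearized: its
    stable orbit comes from shooting between the nullclines, and limits come from monotonicity,
    Barbalat and LaSalle arguments. *)

Ltac Rmin_bounds x y := pose proof (Rmin_l x y); pose proof (Rmin_r x y).
Ltac Rmax_bounds x y := pose proof (Rmax_l x y); pose proof (Rmax_r x y).

(** * Real analysis: continuous induction, mean value and intermediate values *)

Lemma exp_le x y : x <= y -> exp x <= exp y.
Proof.
  intros [H | ->]. left. now apply exp_increasing. right. reflexivity.
Qed.

(** The set of [t] such that [P] holds on [[0, t]] has a supremum, which belongs to it by the first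
    premise and can be passed by the second. At [t = 0] the first premise is the base case. Most
    first-exit-time arguments below are instances. *)
Lemma real_induction (P : R -> Prop) :
  (forall t, 0 <= t -> (forall s, 0 <= s < t -> P s) -> P t) ->
  (forall t, 0 <= t -> (forall s, 0 <= s <= t -> P s) ->
     exists e, 0 < e /\ forall s, t < s < t + e -> P s) ->
  forall t, 0 <= t -> P t.
Proof.
  intros Hc Ho t1 Ht1. apply NNPP. intros Hn.
  assert (H0 : P 0) by (apply Hc; [lra | intros; lra]).
  set (E := fun t => 0 <= t /\ forall s, 0 <= s <= t -> P s).
  assert (HE0 : E 0).
  { split. lra. intros s Hs. replace s with 0 by lra. exact H0. }
  assert (HEb : is_upper_bound E t1).
  { intros t [Ht Hs]. apply Rnot_lt_le. intros Hlt. apply Hn, Hs. lra. }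
  destruct (completeness E) as [l [Hl1 Hl2]].
  { exists t1. exact HEb. } { exists 0. exact HE0. }
  assert (Hl : 0 <= l) by (apply Hl1; exact HE0).
  assert (Hlt : forall s, 0 <= s < l -> P s).
  { intros s Hs. apply NNPP. intros Hns.
    assert (l <= s); [|lra]. apply Hl2. intros t [Ht Hts].
    apply Rnot_lt_le. intros Hst. apply Hns, Hts. lra. }
  assert (HPl : P l) by (apply Hc; auto).
  assert (Hle : forall s, 0 <= s <= l -> P s).
  { intros s Hs. destruct (Req_dec s l) as [->|]; auto. apply Hlt. lra. }
  destruct (Ho l Hl Hle) as [e [He Hex]].
  assert (l + e / 2 <= l); [|lra]. apply Hl1. split. lra.
  intros s Hs. destruct (Rle_dec s l). apply Hle; lra. apply Hex. lra.
Qed.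

Lemma Derive_val (f : R -> R) (x l : R) : is_derive f x l -> Derive (fun y : R => f y) x = l.
Proof. exact (is_derive_unique f x l). Qed.

Ltac derive_with H := auto_derive; [eexists; eauto | rewrite (Derive_val _ _ _ H); ring].

Lemma is_derive_continuity_pt (f : R -> R) x l : is_derive f x l -> continuity_pt f x.
Proof.
  intros H. apply continuity_pt_filterlim. apply (ex_derive_continuous f x). now exists l.
Qed.

Lemma deriv_MVT (f df : R -> R) a b : a <= b ->
  (forall t, a <= t <= b -> is_derive f t (df t)) ->
  exists c, a <= c <= b /\ f b - f a = df c * (b - a).
Proof.
  intros Hab Hd.
  destruct (MVT_gen f a b df) as [c [Hc He]].
  - rewrite Rmin_left, Rmax_right by lra. intros x Hx. apply Hd. lra.
  - rewrite Rmin_left, Rmax_right by lra. intros x Hx.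
    apply (is_derive_continuity_pt f x (df x)), Hd. lra.
  - rewrite Rmin_left, Rmax_right in Hc by lra. eauto.
Qed.

Lemma deriv_nonneg_le (f df : R -> R) a b : a <= b ->
  (forall t, a <= t <= b -> is_derive f t (df t)) ->
  (forall t, a <= t <= b -> 0 <= df t) -> f a <= f b.
Proof.
  intros Hab Hd Hp. destruct (deriv_MVT f df a b Hab Hd) as [c [Hc He]].
  specialize (Hp c Hc). nra.
Qed.

Lemma deriv_nonpos_ge (f df : R -> R) a b : a <= b ->
  (forall t, a <= t <= b -> is_derive f t (df t)) ->
  (forall t, a <= t <= b -> df t <= 0) -> f b <= f a.
Proof.
  intros Hab Hd Hp. destruct (deriv_MVT f df a b Hab Hd) as [c [Hc He]].
  specialize (Hp c Hc). nra.
Qed.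

Lemma deriv_pos_lt (f df : R -> R) a b : a < b ->
  (forall t, a <= t <= b -> is_derive f t (df t)) ->
  (forall t, a <= t <= b -> 0 < df t) -> f a < f b.
Proof.
  intros Hab Hd Hp. destruct (deriv_MVT f df a b (Rlt_le _ _ Hab) Hd) as [c [Hc He]].
  specialize (Hp c Hc). nra.
Qed.

Lemma continuous_eps (f : R -> R) x : continuous f x ->
  forall e, 0 < e -> exists d, 0 < d /\ forall y, Rabs (y - x) < d -> Rabs (f y - f x) < e.
Proof.
  intros Hc e He.
  destruct (proj1 (filterlim_locally f (f x)) Hc (mkposreal e He)) as [d Hd].
  exists d. split. apply cond_pos. intros y Hy. exact (Hd y Hy).
Qed.

Lemma is_derive_eps (f : R -> R) x l : is_derive f x l ->
  forall e, 0 < e -> exists d, 0 < d /\ forall y, Rabs (y - x) < d -> Rabs (f y - f x) < e.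
Proof.
  intros H. apply continuous_eps. apply (ex_derive_continuous f x). now exists l.
Qed.

(** With [gt_at_right], this discharges the two premises of [real_induction]: a weak inequality
    survives at a limit from the left, a strict one persists to the right. *)
Lemma ge_at_left (f : R -> R) t c : 0 < t -> ex_derive f t ->
  (forall u, 0 <= u < t -> c <= f u) -> c <= f t.
Proof.
  intros Ht [l Hc] Hle. apply Rnot_lt_le. intros Hgt.
  destruct (is_derive_eps f t l Hc (c - f t)) as [d [Hd Hd']]. lra.
  assert (0 < Rmin (d / 2) (t / 2)) by (apply Rmin_glb_lt; lra). Rmin_bounds (d / 2) (t / 2).
  set (k := Rmin (d / 2) (t / 2)) in *.
  specialize (Hd' (t - k)). rewrite Rabs_left in Hd' by lra. specialize (Hd' ltac:(lra)).
  specialize (Hle (t - k) ltac:(lra)). apply Rabs_def2 in Hd'. lra.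
Qed.

Lemma gt_at_right (f : R -> R) t c : ex_derive f t -> c < f t ->
  exists e, 0 < e /\ forall s, t < s < t + e -> c < f s.
Proof.
  intros [l Hc] Hlt. destruct (is_derive_eps f t l Hc (f t - c)) as [d [Hd Hd']]. lra.
  exists d. split; auto. intros v Hv. specialize (Hd' v).
  rewrite Rabs_right in Hd' by lra. specialize (Hd' ltac:(lra)). apply Rabs_def2 in Hd'. lra.
Qed.

Lemma IVT_val (f : R -> R) a b y : a <= b ->
  (forall t, a <= t <= b -> continuous f t) ->
  Rmin (f a) (f b) <= y <= Rmax (f a) (f b) -> exists x, a <= x <= b /\ f x = y.
Proof.
  intros Hab Hc Hy.
  (* Composing with the projection onto [[a, b]] turns continuity on the interval into continuity
     everywhere, as [IVT_gen] asks. *)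
  set (cl := fun t => Rmax a (Rmin b t)).
  assert (Hcl : forall t, a <= cl t <= b).
  { intros t. unfold cl, Rmax, Rmin. repeat destruct Rle_dec; lra. }
  assert (Hcid : forall t, a <= t <= b -> cl t = t).
  { intros t Ht. unfold cl, Rmax, Rmin. repeat destruct Rle_dec; lra. }
  destruct (IVT_gen (fun t => f (cl t)) a b y) as [x [Hx Hfx]].
  - intros t. apply continuity_pt_filterlim.
    apply (continuous_comp cl f). 2: apply Hc, Hcl.
    apply filterlim_locally. intros e. exists e. intros u Hu.
    change (Rabs (cl u - cl t) < e). change (Rabs (u - t) < e) in Hu.
    eapply Rle_lt_trans. 2: exact Hu. unfold cl, Rmax, Rmin.
    repeat destruct Rle_dec; unfold Rabs; repeat destruct Rcase_abs; lra.
  - rewrite !Hcid by lra. exact Hy.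
  - rewrite Rmin_left, Rmax_right in Hx by lra.
    exists x. split. lra. rewrite Hcid in Hfx by lra. exact Hfx.
Qed.

(** * Lipschitz planar systems: Gronwall estimate *)

Definition lip2 (L : R) (F : R -> R -> R) : Prop :=
  forall z w z' w', Rabs (F z w - F z' w') <= L * (Rabs (z - z') + Rabs (w - w')).

Lemma lip_continuous (f : R -> R) K x :
  (forall x y, Rabs (f x - f y) <= K * Rabs (x - y)) -> continuous f x.
Proof.
  intros H. apply filterlim_locally. intros e.
  assert (HK : 0 < Rabs K + 1) by (pose proof (Rabs_pos K); lra).
  assert (Hd : 0 < e / (Rabs K + 1)) by (apply Rdiv_lt_0_compat; [apply cond_pos | lra]).
  exists (mkposreal _ Hd). intros y Hy. change (Rabs (y - x) < e / (Rabs K + 1)) in Hy.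
  change (Rabs (f y - f x) < e). eapply Rle_lt_trans. apply H.
  apply Rle_lt_trans with ((Rabs K + 1) * Rabs (y - x)).
  - apply Rmult_le_compat_r. apply Rabs_pos. pose proof (Rle_abs K). lra.
  - apply (Rmult_lt_compat_l (Rabs K + 1)) in Hy; auto.
    replace ((Rabs K + 1) * (e / (Rabs K + 1))) with (pos e) in Hy by (field; lra). exact Hy.
Qed.

(** The squared distance satisfies [|d'| <= 4 L d], because [(|p| + |q|)^2 <= 2 (p^2 + q^2)], and an
    integrating factor gives each bound. The second bound is the estimate backwards in time. *)
Lemma gronwall (L : R) (F G : R -> R -> R) (Z1 T1 Z2 T2 : R -> R) s t :
  lip2 L F -> lip2 L G -> 0 <= L -> s <= t ->
  (forall x, s <= x <= t -> is_derive Z1 x (F (Z1 x) (T1 x)) /\ is_derive T1 x (G (Z1 x) (T1 x))) ->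
  (forall x, s <= x <= t -> is_derive Z2 x (F (Z2 x) (T2 x)) /\ is_derive T2 x (G (Z2 x) (T2 x))) ->
  let d x := (Z1 x - Z2 x) ^ 2 + (T1 x - T2 x) ^ 2 in
  d t <= d s * exp (4 * L * (t - s)) /\ d s <= d t * exp (4 * L * (t - s)).
Proof.
  intros HF HG HL Hst H1 H2 d.
  set (d' := fun x => 2 * (Z1 x - Z2 x) * (F (Z1 x) (T1 x) - F (Z2 x) (T2 x))
                    + 2 * (T1 x - T2 x) * (G (Z1 x) (T1 x) - G (Z2 x) (T2 x))).
  assert (Hd : forall x, s <= x <= t -> is_derive d x (d' x)).
  { intros x Hx. destruct (H1 x Hx) as [A1 B1], (H2 x Hx) as [A2 B2].
    unfold d. auto_derive. repeat split; eauto; eexists; eauto.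
    rewrite (Derive_val _ _ _ A1), (Derive_val _ _ _ A2),
      (Derive_val _ _ _ B1), (Derive_val _ _ _ B2).
    unfold d'. ring. }
  assert (Hb : forall x, Rabs (d' x) <= 4 * L * d x).
  { intros x. unfold d', d.
    pose proof (HF (Z1 x) (T1 x) (Z2 x) (T2 x)) as h1.
    pose proof (HG (Z1 x) (T1 x) (Z2 x) (T2 x)) as h2.
    set (fz := F (Z1 x) (T1 x) - F (Z2 x) (T2 x)) in *.
    set (gz := G (Z1 x) (T1 x) - G (Z2 x) (T2 x)) in *.
    set (p := Z1 x - Z2 x) in *. set (q := T1 x - T2 x) in *.
    eapply Rle_trans. apply Rabs_triang. rewrite !Rabs_mult, (Rabs_right 2) by lra.
    rewrite <- (pow2_abs p), <- (pow2_abs q).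
    pose proof (Rabs_pos p). pose proof (Rabs_pos q).
    assert (2 * Rabs p * Rabs fz <= 2 * Rabs p * (L * (Rabs p + Rabs q)))
      by (apply Rmult_le_compat_l; lra).
    assert (2 * Rabs q * Rabs gz <= 2 * Rabs q * (L * (Rabs p + Rabs q)))
      by (apply Rmult_le_compat_l; lra).
    assert (0 <= L * (Rabs p - Rabs q) ^ 2) by (apply Rmult_le_pos; [lra | apply pow2_ge_0]).
    nra. }
  split.
  - assert (He : d t * exp (- 4 * L * (t - s)) <= d s * exp (- 4 * L * (s - s))).
    { apply (deriv_nonpos_ge (fun x => d x * exp (- 4 * L * (x - s)))
        (fun x => (d' x - 4 * L * d x) * exp (- 4 * L * (x - s)))); auto.
      - intros x Hx. auto_derive. eexists; eauto.
        rewrite (Derive_val _ _ _ (Hd x Hx)). unfold Rminus. ring.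
      - intros x Hx. pose proof (Hb x). pose proof (Rle_abs (d' x)).
        pose proof (exp_pos (- 4 * L * (x - s))). nra. }
    replace (- 4 * L * (s - s)) with 0 in He by ring. rewrite exp_0 in He.
    replace (4 * L * (t - s)) with (- (- 4 * L * (t - s))) by ring. rewrite exp_Ropp.
    pose proof (exp_pos (- 4 * L * (t - s))) as hp.
    apply (Rmult_le_reg_r (exp (- 4 * L * (t - s)))); auto.
    rewrite (Rmult_assoc (d s)), Rinv_l by lra. lra.
  - assert (He : d s * exp (4 * L * (s - s)) <= d t * exp (4 * L * (t - s))).
    { apply (deriv_nonneg_le (fun x => d x * exp (4 * L * (x - s)))
        (fun x => (d' x + 4 * L * d x) * exp (4 * L * (x - s)))); auto.
      - intros x Hx. auto_derive. eexists; eauto.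
        rewrite (Derive_val _ _ _ (Hd x Hx)). unfold Rminus. ring.
      - intros x Hx. pose proof (Hb x). pose proof (Rle_abs (- d' x)). rewrite Rabs_Ropp in H0.
        pose proof (exp_pos (4 * L * (x - s))). nra. }
    replace (4 * L * (s - s)) with 0 in He by ring. rewrite exp_0 in He. lra.
Qed.

(** Integration from 0 divides the norm [sup |phi t| exp (- c |t|)] by [c]. For [c = 4 L] the Picard
    map is then a contraction of ratio 1/2 on the whole line, and no continuation of local solutions
    is needed. *)
Lemma exp_weighted_bound (phi If : R -> R) M c : 0 < c -> 0 <= M -> If 0 = 0 ->
  (forall t, is_derive If t (phi t)) -> (forall t, Rabs (phi t) <= M * exp (c * Rabs t)) ->
  forall t, Rabs (If t) <= M / c * exp (c * Rabs t).
Proof.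
  intros Hc HM H0 Hd Hb.
  assert (HMc : 0 <= M / c) by (apply Rmult_le_pos; [lra | apply Rlt_le, Rinv_0_lt_compat; lra]).
  assert (key : forall sg, Rabs sg = 1 -> forall t, sg * If t <= M / c * exp (c * Rabs t)).
  { intros sg Hsg t.
    assert (Hb' : forall s, sg * phi s <= M * exp (c * Rabs s) /\ - (M * exp (c * Rabs s)) <= sg * phi s).
    { intros s. specialize (Hb s). pose proof (Rle_abs (sg * phi s)). pose proof (Rle_abs (- (sg * phi s))).
      rewrite Rabs_Ropp in H1. rewrite Rabs_mult, Hsg in *. lra. }
    destruct (Rle_dec 0 t) as [Ht | Ht].
    - rewrite (Rabs_right t) by lra.
      assert (H : M / c * exp (c * 0) - sg * If 0 <= M / c * exp (c * t) - sg * If t).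
      { apply (deriv_nonneg_le (fun t => M / c * exp (c * t) - sg * If t)
                 (fun t => M * exp (c * t) - sg * phi t)). lra.
        - intros s Hs. auto_derive. eexists; eauto. rewrite (Derive_val _ _ _ (Hd s)). field. lra.
        - intros s Hs. destruct (Hb' s). rewrite (Rabs_right s) in * by lra. lra. }
      rewrite H0, Rmult_0_r, exp_0 in H. lra.
    - rewrite (Rabs_left t) by lra.
      assert (H : M / c * exp (- (c * 0)) - sg * If 0 <= M / c * exp (- (c * t)) - sg * If t).
      { apply (deriv_nonpos_ge (fun t => M / c * exp (- (c * t)) - sg * If t)
                 (fun t => - (M * exp (- (c * t))) - sg * phi t)). lra.
        - intros s Hs. auto_derive. eexists; eauto. rewrite (Derive_val _ _ _ (Hd s)). field. lra.
        - intros s Hs. destruct (Hb' s). rewrite (Rabs_left1 s) in * by lra.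
          replace (c * - s) with (- (c * s)) in * by ring. lra. }
      rewrite H0, Rmult_0_r, Ropp_0, exp_0 in H. replace (c * - t) with (- (c * t)) by ring. lra. }
  intros t. pose proof (key 1 Rabs_R1 t). pose proof (key (-1)). rewrite Rabs_left in H1 by lra.
  specialize (H1 ltac:(lra) t). apply Rabs_le. lra.
Qed.

Lemma is_derive_shift (c : R) (f : R -> R) t l : is_derive f t l -> is_derive (fun t => c + f t) t l.
Proof.
  intros H. auto_derive. now exists l. rewrite (Derive_val _ _ _ H). ring.
Qed.

Lemma RInt_at_0 (f : R -> R) : RInt f 0 0 = 0.
Proof. exact (RInt_point (V := R_CompleteNormedModule) 0 f). Qed.

(** * Global existence for bounded Lipschitz fields by Picard iteration *)

Section Picard.
Variables (F G : R -> R -> R) (L B z0 w0 : R).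
Hypothesis HL : 0 < L.
Hypothesis HF : lip2 L F.
Hypothesis HG : lip2 L G.
Hypothesis HFB : forall z w, Rabs (F z w) <= B.
Hypothesis HGB : forall z w, Rabs (G z w) <= B.

Fixpoint picard (k : nat) : (R -> R) * (R -> R) :=
  match k with
  | O => (fun _ => z0, fun _ => w0)
  | S k => (fun t => z0 + RInt (fun s => F (fst (picard k) s) (snd (picard k) s)) 0 t,
            fun t => w0 + RInt (fun s => G (fst (picard k) s) (snd (picard k) s)) 0 t)
  end.

Lemma lip2_comp_continuous (H : R -> R -> R) (u v : R -> R) K x : lip2 L H ->
  (forall s t, Rabs (u s - u t) <= K * Rabs (s - t)) ->
  (forall s t, Rabs (v s - v t) <= K * Rabs (s - t)) ->
  continuous (fun s => H (u s) (v s)) x.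
Proof.
  intros HH Hu Hv. apply (lip_continuous _ (L * (2 * K))). intros s t.
  eapply Rle_trans. apply HH. specialize (Hu s t). specialize (Hv s t).
  rewrite Rmult_assoc. apply Rmult_le_compat_l; lra.
Qed.

Lemma RInt_C1 (f : R -> R) : (forall x, continuous f x) ->
  forall t, is_derive (fun t => RInt f 0 t) t (f t).
Proof.
  intros Hc t. apply (is_derive_RInt f (fun t => RInt f 0 t) 0 t). 2: apply Hc.
  apply filter_forall. intros b. apply (RInt_correct (V := R_CompleteNormedModule)).
  apply (ex_RInt_continuous (V := R_CompleteNormedModule)). intros; apply Hc.
Qed.

Lemma deriv_bound_lip (f df : R -> R) K : (forall t, is_derive f t (df t)) ->
  (forall t, Rabs (df t) <= K) -> forall s t, Rabs (f s - f t) <= K * Rabs (s - t).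
Proof.
  intros Hd Hb.
  assert (key : forall s t, s <= t -> Rabs (f t - f s) <= K * Rabs (t - s)).
  { intros s t Hst. destruct (deriv_MVT f df s t Hst) as [c [_ Hc]]. auto.
    rewrite Hc, Rabs_mult. apply Rmult_le_compat_r. apply Rabs_pos. apply Hb. }
  intros s t. destruct (Rle_dec s t).
  - rewrite Rabs_minus_sym, (Rabs_minus_sym s). now apply key.
  - apply key. lra.
Qed.

Local Notation pz k := (fst (picard k)).
Local Notation pw k := (snd (picard k)).
Local Notation pfield H k := (fun s => H (fst (picard k) s) (snd (picard k) s)).

Lemma picard_lip k :
  (forall s t, Rabs (pz k s - pz k t) <= B * Rabs (s - t)) /\
  (forall s t, Rabs (pw k s - pw k t) <= B * Rabs (s - t)) .
Proof.
  assert (HB : 0 <= B) by (eapply Rle_trans; [apply Rabs_pos | apply (HFB 0 0)]).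
  induction k as [|k [IH1 IH2]].
  - simpl. split; intros s t; rewrite Rminus_diag, Rabs_R0; apply Rmult_le_pos; auto; apply Rabs_pos.
  - simpl. split.
    + apply (deriv_bound_lip _ (pfield F k)); auto.
      intros t. apply is_derive_shift, (RInt_C1 (pfield F k)). intros x.
      apply (lip2_comp_continuous F _ _ B); auto.
    + apply (deriv_bound_lip _ (pfield G k)); auto.
      intros t. apply is_derive_shift, (RInt_C1 (pfield G k)). intros x.
      apply (lip2_comp_continuous G _ _ B); auto.
Qed.

Lemma picard_step (H : R -> R -> R) k : lip2 L H ->
  forall x, continuous (pfield H k) x.
Proof.
  intros HH x. destruct (picard_lip k). now apply (lip2_comp_continuous H _ _ B).
Qed.

(** The Lipschitz bound costs a factor [2 L] for the two components and the weighted integration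
    gains [4 L], so each iteration halves the difference. *)
Lemma picard_diff k t :
  Rabs (pz (S k) t - pz k t) <= B / (4 * L) * (/ 2) ^ k * exp (4 * L * Rabs t) /\
  Rabs (pw (S k) t - pw k t) <= B / (4 * L) * (/ 2) ^ k * exp (4 * L * Rabs t).
Proof.
  assert (HB : 0 <= B) by (eapply Rle_trans; [apply Rabs_pos | apply (HFB 0 0)]).
  assert (HBL : 0 <= B / (4 * L)) by (apply Rmult_le_pos; [lra | apply Rlt_le, Rinv_0_lt_compat; lra]).
  assert (Hex : forall s, 1 <= exp (4 * L * Rabs s)).
  { intros s. rewrite <- exp_0. apply exp_le. pose proof (Rabs_pos s). nra. }
  revert t. induction k as [|k IH]; intros t.
  - assert (key : forall H : R -> R -> R, lip2 L H -> (forall z w, Rabs (H z w) <= B) -> forall x0,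
      Rabs (x0 + RInt (fun _ => H z0 w0) 0 t - x0) <= B / (4 * L) * 1 * exp (4 * L * Rabs t)).
    { intros H HH HHB x0. assert (E : forall i : R, x0 + i - x0 = i) by (intros; ring). rewrite E.
      rewrite Rmult_1_r.
      apply (exp_weighted_bound (fun _ => H z0 w0) (fun t => RInt (fun _ => H z0 w0) 0 t)); try lra.
      - apply RInt_at_0.
      - apply RInt_C1. intros; apply continuous_const.
      - intros s. specialize (HHB z0 w0). specialize (Hex s). nra. }
    split; apply key; auto.
  - assert (key : forall H : R -> R -> R, lip2 L H -> forall x0,
      Rabs ((x0 + RInt (pfield H (S k)) 0 t)
         - (x0 + RInt (pfield H k) 0 t))
      <= B / (4 * L) * (/ 2) ^ S k * exp (4 * L * Rabs t)).
    { intros H HH x0.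
      replace (B / (4 * L) * (/ 2) ^ S k) with ((2 * L * (B / (4 * L) * (/ 2) ^ k)) / (4 * L))
        by (simpl; field; lra).
      apply Rle_trans with (Rabs (RInt (pfield H (S k)) 0 t
         - RInt (pfield H k) 0 t)).
      { right. f_equal. ring. }
      apply (exp_weighted_bound (fun s => H (pz (S k) s) (pw (S k) s)
               - H (pz k s) (pw k s))
          (fun t => RInt (pfield H (S k)) 0 t
         - RInt (pfield H k) 0 t)); try lra.
      - assert (0 < (/ 2) ^ k) by (apply pow_lt; lra).
        apply Rmult_le_pos; [lra | apply Rmult_le_pos; lra].
      - rewrite !RInt_at_0. apply Rminus_diag.
      - intros s. apply (is_derive_minus (V := R_NormedModule)
          (fun t => RInt (pfield H (S k)) 0 t)
          (fun t => RInt (pfield H k) 0 t));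
        apply (RInt_C1 (pfield H _)), picard_step; auto.
      - intros s. eapply Rle_trans. apply HH. destruct (IH s) as [I1 I2].
        apply Rle_trans with (L * (2 * (B / (4 * L) * (/ 2) ^ k * exp (4 * L * Rabs s)))).
        apply Rmult_le_compat_l; lra. right. ring. }
    split; apply key; auto.
Qed.

Lemma picard_tail k j t :
  Rabs (pz (k + j) t - pz k t) <= 2 * (B / (4 * L)) * (/ 2) ^ k * exp (4 * L * Rabs t) /\
  Rabs (pw (k + j) t - pw k t) <= 2 * (B / (4 * L)) * (/ 2) ^ k * exp (4 * L * Rabs t).
Proof.
  assert (HB : 0 <= B) by (eapply Rle_trans; [apply Rabs_pos | apply (HFB 0 0)]).
  assert (HBL : 0 <= B / (4 * L)) by (apply Rmult_le_pos; [lra | apply Rlt_le, Rinv_0_lt_compat; lra]).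
  pose proof (exp_pos (4 * L * Rabs t)) as Hex.
  revert k. induction j as [|j IH]; intros k.
  - rewrite Nat.add_0_r, !Rminus_diag, Rabs_R0.
    assert (0 < (/ 2) ^ k) by (apply pow_lt; lra).
    assert (0 <= 2 * (B / (4 * L)) * (/ 2) ^ k * exp (4 * L * Rabs t)).
    { apply Rmult_le_pos; [apply Rmult_le_pos|]; lra. }
    split; auto.
  - rewrite Nat.add_succ_r. change (S (k + j)) with (S k + j)%nat.
    destruct (IH (S k)) as [I1 I2], (picard_diff k t) as [D1 D2].
    assert (E : 2 * (B / (4 * L)) * (/ 2) ^ S k * exp (4 * L * Rabs t) + B / (4 * L) * (/ 2) ^ k * exp (4 * L * Rabs t)
       = 2 * (B / (4 * L)) * (/ 2) ^ k * exp (4 * L * Rabs t)) by (simpl; field; lra).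
    split.
    + replace (_ - _) with ((pz (S k + j) t - pz (S k) t) + (pz (S k) t - pz k t)) by ring.
      eapply Rle_trans. apply Rabs_triang. lra.
    + replace (_ - _) with ((pw (S k + j) t - pw (S k) t) + (pw (S k) t - pw k t)) by ring.
      eapply Rle_trans. apply Rabs_triang. lra.
Qed.

Lemma geom_small C e : 0 < e -> 0 <= C -> exists k, C * (/ 2) ^ k < e.
Proof.
  intros He HC. destruct (pow_lt_1_zero (/ 2) ltac:(rewrite Rabs_right; lra) (e / (C + 1))) as [k Hk].
  apply Rdiv_lt_0_compat; lra. exists k. specialize (Hk k (le_n k)).
  assert (0 < (/ 2) ^ k) by (apply pow_lt; lra). rewrite Rabs_right in Hk by lra.
  apply (Rmult_lt_compat_l (C + 1)) in Hk; [|lra].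
  replace ((C + 1) * (e / (C + 1))) with e in Hk by (field; lra). nra.
Qed.

Lemma cauchy_geom_limit (u : nat -> R) C : 0 <= C ->
  (forall k j, Rabs (u (k + j)%nat - u k) <= C * (/ 2) ^ k) ->
  forall k, Rabs (real (Lim_seq u) - u k) <= C * (/ 2) ^ k.
Proof.
  intros HC Hu.
  assert (Hex : ex_finite_lim_seq u).
  { apply ex_lim_seq_cauchy_corr. intros e.
    destruct (geom_small (2 * C) e) as [N HN]; [apply cond_pos | lra | ].
    exists N. intros k j Hk Hj.
    replace k with (N + (k - N))%nat by lia. replace j with (N + (j - N))%nat by lia.
    pose proof (Hu N (k - N)%nat). pose proof (Hu N (j - N)%nat).
    replace (_ - _) with ((u (N + (k - N))%nat - u N) - (u (N + (j - N))%nat - u N)) by ring.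
    eapply Rle_lt_trans. apply Rabs_triang. rewrite Rabs_Ropp. lra. }
  destruct Hex as [l Hl]. rewrite (is_lim_seq_unique _ _ Hl). intros k. simpl.
  assert (H : is_lim_seq (fun j => u (j + k)%nat - u k) (l - u k)).
  { apply is_lim_seq_minus'. now apply -> is_lim_seq_incr_n. apply is_lim_seq_const. }
  apply is_lim_seq_abs in H.
  refine (is_lim_seq_le _ _ _ _ _ H (is_lim_seq_const (C * (/ 2) ^ k))).
  intros j. rewrite Nat.add_comm. apply Hu.
Qed.

(** The iterates converge pointwise at a geometric rate and are all [B]-Lipschitz, so the limit is
    [B]-Lipschitz too. The integrand is thus continuous, and the weighted bound passes the integral
    equation to the limit; differentiating it gives the system. *)
Lemma ode_exists : exists Z W : R -> R, Z 0 = z0 /\ W 0 = w0 /\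
  forall t, is_derive Z t (F (Z t) (W t)) /\ is_derive W t (G (Z t) (W t)).
Proof.
  assert (HB : 0 <= B) by (eapply Rle_trans; [apply Rabs_pos | apply (HFB 0 0)]).
  assert (HBL : 0 <= B / (4 * L)) by (apply Rmult_le_pos; [lra | apply Rlt_le, Rinv_0_lt_compat; lra]).
  set (C := fun t => 2 * (B / (4 * L)) * exp (4 * L * Rabs t)).
  assert (HC : forall t, 0 <= C t).
  { intros t. pose proof (exp_pos (4 * L * Rabs t)). apply Rmult_le_pos; lra. }
  set (Z := fun t => real (Lim_seq (fun k => pz k t))).
  set (W := fun t => real (Lim_seq (fun k => pw k t))).
  assert (HZ : forall t k, Rabs (Z t - pz k t) <= C t * (/ 2) ^ k).
  { intros t. apply (cauchy_geom_limit (fun k => _ (picard k) t)); auto. intros k j. destruct (picard_tail k j t) as [H _]. unfold C. lra. }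
  assert (HW : forall t k, Rabs (W t - pw k t) <= C t * (/ 2) ^ k).
  { intros t. apply (cauchy_geom_limit (fun k => _ (picard k) t)); auto. intros k j. destruct (picard_tail k j t) as [_ H]. unfold C. lra. }
  assert (lipl : forall (v : nat -> R -> R) (u : R -> R),
    (forall t k, Rabs (u t - v k t) <= C t * (/ 2) ^ k) ->
    (forall k s t, Rabs (v k s - v k t) <= B * Rabs (s - t)) ->
    forall s t, Rabs (u s - u t) <= B * Rabs (s - t)).
  { intros v u Huv Hv s t. apply Rnot_lt_le. intros Hlt.
    destruct (geom_small (C s + C t) (Rabs (u s - u t) - B * Rabs (s - t))) as [k Hk].
    lra. specialize (HC s) as HCs. specialize (HC t) as HCt. lra.
    pose proof (Huv s k). pose proof (Huv t k). pose proof (Hv k s t).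
    replace (u s - u t) with ((u s - v k s) + ((v k s - v k t) - (u t - v k t))) in Hk by ring.
    pose proof (Rabs_triang (u s - v k s) ((v k s - v k t) - (u t - v k t))).
    pose proof (Rabs_triang (v k s - v k t) (- (u t - v k t))). rewrite Rabs_Ropp in H3.
    fold (v k s - v k t - (u t - v k t)) in H3. lra. }
  assert (HZl : forall s t, Rabs (Z s - Z t) <= B * Rabs (s - t)).
  { apply (lipl (fun k => pz k)); auto. intros k. apply picard_lip. }
  assert (HWl : forall s t, Rabs (W s - W t) <= B * Rabs (s - t)).
  { apply (lipl (fun k => pw k)); auto. intros k. apply picard_lip. }
  assert (key : forall (H : R -> R -> R) x0 (v : nat -> R -> R) (u : R -> R), lip2 L H ->
    (forall t k, Rabs (u t - v k t) <= C t * (/ 2) ^ k) ->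
    (forall k t, v (S k) t = x0 + RInt (pfield H k) 0 t) ->
    forall t, u t = x0 + RInt (fun s => H (Z s) (W s)) 0 t).
  { intros H x0 v u HH Huv Hv t.
    assert (Hcs : forall x, continuous (fun s => H (Z s) (W s)) x).
    { intros x. now apply (lip2_comp_continuous H _ _ B). }
    destruct (Req_dec (u t) (x0 + RInt (fun s => H (Z s) (W s)) 0 t)) as [|Hne]; auto. exfalso.
    assert (Hpos : 0 < Rabs (u t - (x0 + RInt (fun s => H (Z s) (W s)) 0 t))).
    { apply Rabs_pos_lt. lra. }
    set (D := B / (4 * L) * exp (4 * L * Rabs t)).
    assert (HD : 0 <= D). { pose proof (HC t). unfold C in H0. unfold D. lra. }
    destruct (geom_small (C t + D) (Rabs (u t - (x0 + RInt (fun s => H (Z s) (W s)) 0 t)))) as [k Hk]; auto.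
    pose proof (HC t); lra.
    assert (Hint : Rabs (RInt (fun s => H (Z s) (W s)) 0 t - RInt (pfield H k) 0 t)
       <= D * (/ 2) ^ k).
    { assert (Hpk : 0 < (/ 2) ^ k) by (apply pow_lt; lra).
      replace (D * (/ 2) ^ k) with ((4 * L * (B / (4 * L)) * (/ 2) ^ k) / (4 * L) * exp (4 * L * Rabs t))
        by (unfold D; field; lra).
      apply (exp_weighted_bound (fun s => H (Z s) (W s) - H (pz k s) (pw k s))
          (fun t => RInt (fun s => H (Z s) (W s)) 0 t
         - RInt (pfield H k) 0 t)); try lra.
      - apply Rmult_le_pos; [apply Rmult_le_pos|]; lra.
      - rewrite !RInt_at_0. apply Rminus_diag.
      - intros s. apply (is_derive_minus (V := R_NormedModule)
          (fun t => RInt (fun s => H (Z s) (W s)) 0 t)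
          (fun t => RInt (pfield H k) 0 t)).
        now apply (RInt_C1 (fun s => H (Z s) (W s))).
        apply (RInt_C1 (pfield H _)), picard_step; auto.
      - intros s. eapply Rle_trans. apply HH. pose proof (HZ s k). pose proof (HW s k).
        apply Rle_trans with (L * (2 * (C s * (/ 2) ^ k))).
        apply Rmult_le_compat_l; lra. right. unfold C. field. lra. }
    pose proof (Huv t (S k)) as Ht. rewrite Hv in Ht.
    assert (Hp : C t * (/ 2) ^ S k <= C t * (/ 2) ^ k).
    { apply Rmult_le_compat_l; auto. simpl. assert (0 < (/ 2) ^ k) by (apply pow_lt; lra). lra. }
    replace (u t - (x0 + RInt (fun s => H (Z s) (W s)) 0 t)) with
      ((u t - (x0 + RInt (pfield H k) 0 t)) +
       - (RInt (fun s => H (Z s) (W s)) 0 t - RInt (pfield H k) 0 t)) in Hk by ring.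
    pose proof (Rabs_triang (u t - (x0 + RInt (pfield H k) 0 t))
       (- (RInt (fun s => H (Z s) (W s)) 0 t - RInt (pfield H k) 0 t))).
    rewrite Rabs_Ropp in H0. lra. }
  pose proof (key F z0 _ Z HF HZ (fun k t => eq_refl)) as EZ.
  pose proof (key G w0 _ W HG HW (fun k t => eq_refl)) as EW.
  exists Z, W. split; [|split].
  - rewrite EZ, RInt_at_0. apply Rplus_0_r.
  - rewrite EW, RInt_at_0. apply Rplus_0_r.
  - intros t. split.
    + apply (is_derive_ext (fun t => z0 + RInt (fun s => F (Z s) (W s)) 0 t)). intros; now rewrite EZ.
      apply is_derive_shift. apply (RInt_C1 (fun s => F (Z s) (W s))). intros x. now apply (lip2_comp_continuous F _ _ B).
    + apply (is_derive_ext (fun t => w0 + RInt (fun s => G (Z s) (W s)) 0 t)). intros; now rewrite EW.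
      apply is_derive_shift. apply (RInt_C1 (fun s => G (Z s) (W s))). intros x. now apply (lip2_comp_continuous G _ _ B).
Qed.
End Picard.

(** * Limits at infinity, Barbalat's lemma and a LaSalle principle *)

Definition tends_to (f : R -> R) (l : R) : Prop :=
  forall e, 0 < e -> exists t0, forall t, t0 <= t -> Rabs (f t - l) < e.

Lemma decr_tends (f : R -> R) t0 lo :
  (forall s t, t0 <= s <= t -> f t <= f s) -> (forall t, t0 <= t -> lo <= f t) ->
  exists l, tends_to f l /\ (forall t, t0 <= t -> l <= f t) /\ lo <= l.
Proof.
  intros Hm Hlo.
  set (E := fun x => forall t, t0 <= t -> x <= f t).
  destruct (completeness E) as [l [Hl1 Hl2]].
  { exists (f t0). intros x Hx. apply Hx. lra. }
  { exists lo. exact Hlo. }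
  exists l.
  assert (Hlf : forall t, t0 <= t -> l <= f t).
  { intros t Ht. apply Hl2. intros x Hx. now apply Hx. }
  split; [|split; auto].
  - intros e He. apply NNPP. intros Hn.
    assert (l + e <= l); [|lra]. apply Hl1. intros t Ht.
    apply Rnot_lt_le. intros Hlt. apply Hn. exists t. intros s Hs.
    rewrite Rabs_right. specialize (Hm t s). lra. specialize (Hlf s). lra.
Qed.

Lemma tends_to_opp f l : tends_to f l -> tends_to (fun t => - f t) (- l).
Proof.
  intros H e He. destruct (H e He) as [t0 Ht]. exists t0. intros t Ht'.
  replace (- f t - - l) with (- (f t - l)) by ring. rewrite Rabs_Ropp. auto.
Qed.

Lemma tends_to_ext f g l t0 : (forall t, t0 <= t -> f t = g t) -> tends_to f l -> tends_to g l.
Proof.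
  intros Hfg H e He. destruct (H e He) as [t1 Ht]. exists (Rmax t0 t1). intros t Ht'.
  Rmax_bounds t0 t1. rewrite <- Hfg by lra. apply Ht. lra.
Qed.

Lemma tends_to_comp (g f : R -> R) l : tends_to f l -> ex_derive g l ->
  tends_to (fun t => g (f t)) (g l).
Proof.
  intros H Hg e He. destruct (continuous_eps g l (ex_derive_continuous g l Hg) e He) as [d [Hd Hgd]].
  destruct (H d Hd) as [t0 Ht]. exists t0. auto.
Qed.

Lemma tends_to_plus f g l k : tends_to f l -> tends_to g k -> tends_to (fun t => f t + g t) (l + k).
Proof.
  intros Hf Hg e He. destruct (Hf (e / 2) ltac:(lra)) as [t1 h1].
  destruct (Hg (e / 2) ltac:(lra)) as [t2 h2]. exists (Rmax t1 t2). intros t Ht.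
  Rmax_bounds t1 t2.
  specialize (h1 t ltac:(lra)). specialize (h2 t ltac:(lra)).
  replace (f t + g t - (l + k)) with ((f t - l) + (g t - k)) by ring.
  eapply Rle_lt_trans. apply Rabs_triang. lra.
Qed.

Lemma tends_to_le f l c t0 : tends_to f l -> (forall t, t0 <= t -> f t <= c) -> l <= c.
Proof.
  intros H Hc. apply Rnot_lt_le. intros Hlt. destruct (H (l - c) ltac:(lra)) as [t1 h].
  specialize (h (Rmax t0 t1) (Rmax_r _ _)). specialize (Hc (Rmax t0 t1) (Rmax_l _ _)).
  revert h. unfold Rabs. destruct Rcase_abs; lra.
Qed.

(** Since [f] converges, its mean slope over a step of fixed length [d] becomes small; that slope is
    [df c] for some [c] within [d] of [t], and the Lipschitz bound carries it to [df t]. *)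
Lemma barbalat (f df : R -> R) K l :
  (forall t, 0 <= t -> is_derive f t (df t)) ->
  (forall s t, 0 <= s -> 0 <= t -> Rabs (df s - df t) <= K * Rabs (s - t)) ->
  tends_to f l -> tends_to df 0.
Proof.
  intros Hd HK Hl e He.
  assert (HK0 : 0 < Rabs K + 1) by (pose proof (Rabs_pos K); lra).
  (* Chosen so that [|K| d <= e / 2]. *)
  set (d := e / (2 * (Rabs K + 1))).
  assert (Hdp : 0 < d) by (apply Rdiv_lt_0_compat; lra).
  destruct (Hl (e * d / 4)) as [t0 Ht0]. { assert (0 < e * d) by (apply Rmult_lt_0_compat; lra). lra. }
  exists (Rmax 0 t0). intros t Ht. Rmax_bounds 0 t0.
  destruct (deriv_MVT f df t (t + d)) as [c [Hc He']]. lra. intros; apply Hd; lra.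
  pose proof (Ht0 t ltac:(lra)) as h1. pose proof (Ht0 (t + d) ltac:(lra)) as h2.
  assert (h3 : Rabs (df c) * d < e / 2 * d).
  { replace (Rabs (df c) * d) with (Rabs (f (t + d) - f t)).
    replace (f (t + d) - f t) with ((f (t + d) - l) + - (f t - l)) by ring.
    eapply Rle_lt_trans. apply Rabs_triang. rewrite Rabs_Ropp. lra.
    rewrite He', Rabs_mult. f_equal. replace (t + d - t) with d by ring. apply Rabs_right. lra. }
  apply Rmult_lt_reg_r in h3; auto.
  pose proof (HK t c ltac:(lra) ltac:(lra)) as h4.
  assert (h5 : Rabs K * Rabs (t - c) <= e / 2).
  { apply Rle_trans with ((Rabs K + 1) * d).
    - apply Rmult_le_compat; try apply Rabs_pos. lra. rewrite Rabs_left1; lra.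
    - unfold d. right. field. lra. }
  assert (h6 : K * Rabs (t - c) <= Rabs K * Rabs (t - c)).
  { apply Rmult_le_compat_r. apply Rabs_pos. apply Rle_abs. }
  rewrite Rminus_0_r. replace (df t) with ((df t - df c) + df c) by ring.
  eapply Rle_lt_trans. apply Rabs_triang. lra.
Qed.

Lemma continuous_pos_min (w : R -> R) a b : (forall x, a <= x <= b -> continuous w x) ->
  (forall x, a <= x <= b -> 0 < w x) -> exists m, 0 < m /\ forall x, a <= x <= b -> m <= w x.
Proof.
  intros Hc Hp. destruct (Rle_dec a b) as [Hab|Hab].
  - destruct (continuity_ab_min w a b Hab) as [x [Hx1 Hx2]].
    intros c Hcc. apply continuity_pt_filterlim. now apply Hc.
    exists (w x). auto.
  - exists 1. split. lra. intros; lra.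
Qed.

(** Each time [T] is at distance [h] from both [a] and [b], it stays at distance [h / 2] from them
    for a fixed duration, during which [V] loses a fixed amount. As [V] converges, this stops
    happening. *)
Lemma lasalle (V dV T w : R -> R) a b d B c lo :
  a < b < d -> 0 < B -> 0 < c ->
  (forall t, 0 <= t -> is_derive V t (dV t)) ->
  (forall t, 0 <= t -> dV t <= - (c * w (T t))) ->
  (forall t, 0 <= t -> lo <= V t) ->
  (forall t, 0 <= t -> a <= T t <= d) ->
  (forall s t, 0 <= s -> 0 <= t -> Rabs (T s - T t) <= B * Rabs (s - t)) ->
  (forall x, a <= x <= d -> continuous w x) ->
  (forall x, a <= x <= d -> 0 <= w x) ->
  (forall x, a < x <= d -> x <> b -> 0 < w x) ->
  tends_to T a \/ tends_to T b.
Proof.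
  intros Habd HB Hc HV HdV Hlo HT HTl Hw Hw0 Hwp.
  assert (HVm : forall s t, 0 <= s <= t -> V t <= V s).
  { intros s t Hst. apply (deriv_nonpos_ge V dV). lra. intros; apply HV; lra.
    intros x Hx. specialize (HdV x ltac:(lra)). specialize (Hw0 (T x) (HT x ltac:(lra))). nra. }
  destruct (decr_tends V 0 lo HVm Hlo) as [l [Hl [Hlb _]]].
  assert (key : forall h, 0 < h -> exists t0, 0 <= t0 /\ forall t, t0 <= t ->
     Rabs (T t - a) < h \/ Rabs (T t - b) < h).
  { intros h Hh.
    destruct (continuous_pos_min w (a + h / 2) (b - h / 2)) as [m1 [Hm1 Hm1']].
    intros; apply Hw; lra. intros; apply Hwp; lra.
    destruct (continuous_pos_min w (b + h / 2) d) as [m2 [Hm2 Hm2']].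
    intros; apply Hw; lra. intros; apply Hwp; lra.
    set (m := Rmin m1 m2). assert (Hm : 0 < m) by (apply Rmin_glb_lt; auto).
    Rmin_bounds m1 m2.
    (* The time during which [T], being [B]-Lipschitz, moves by at most [h / 2]. *)
    set (k := h / (2 * B)). assert (Hk : 0 < k) by (apply Rdiv_lt_0_compat; lra).
    assert (HBk : B * k = h / 2) by (unfold k; field; lra).
    destruct (Hl (c * m * k)) as [t0 Ht0].
    { apply Rmult_lt_0_compat; auto. apply Rmult_lt_0_compat; auto. }
    exists (Rmax 0 t0). split. apply Rmax_l. intros t Ht.
    Rmax_bounds 0 t0.
    apply NNPP. intros Hn. apply not_or_and in Hn. destruct Hn as [Hn1 Hn2].
    assert (Hout : forall s, t <= s <= t + k -> m <= w (T s)).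
    { intros s Hs. pose proof (HTl s t ltac:(lra) ltac:(lra)) as H3.
      rewrite (Rabs_right (s - t)) in H3 by lra.
      assert (B * (s - t) <= B * k) by (apply Rmult_le_compat_l; lra).
      pose proof (HT t ltac:(lra)). pose proof (HT s ltac:(lra)).
      assert (a + h / 2 <= T s <= b - h / 2 \/ b + h / 2 <= T s <= d).
      { revert Hn1 Hn2 H3. unfold Rabs. repeat destruct Rcase_abs; lra. }
      destruct H7. eapply Rle_trans. 2: apply Hm1'; auto. auto.
      eapply Rle_trans. 2: apply Hm2'; auto. auto. }
    destruct (deriv_MVT V dV t (t + k)) as [s [Hs Hs']]. lra. intros; apply HV; lra.
    pose proof (HdV s ltac:(lra)) as H3. pose proof (Hout s Hs) as H4.
    assert (H5 : dV s <= - (c * m)) by nra.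
    pose proof (Hlb (t + k) ltac:(lra)). pose proof (Ht0 t ltac:(lra)) as H7.
    rewrite Rabs_right in H7 by (pose proof (Hlb t ltac:(lra)); lra).
    replace (t + k - t) with k in Hs' by ring. nra. }
  (* At this scale the midpoint of [[a, b]] is excluded, so by continuity [T] ends up on one side of
     it, which decides between the two limits. *)
  destruct (key ((b - a) / 2) ltac:(lra)) as [t0 [Ht0 Hdi]].
  assert (Hcont : forall t, t0 < t -> continuous T t).
  { intros t Ht. apply filterlim_locally. intros e.
    assert (He : 0 < Rmin (t - t0) (e / B)).
    { apply Rmin_glb_lt. lra. apply Rdiv_lt_0_compat; auto. apply cond_pos. }
    exists (mkposreal _ He). intros y Hy. change (Rabs (y - t) < Rmin (t - t0) (e / B)) in Hy.
    change (Rabs (T y - T t) < e).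
    Rmin_bounds (t - t0) (e / B).
    assert (0 <= y). { revert Hy. unfold Rabs. destruct Rcase_abs; lra. }
    eapply Rle_lt_trans. apply HTl; lra.
    apply Rlt_le_trans with (B * (e / B)). apply Rmult_lt_compat_l; lra. right. field. lra. }
  assert (Hne : forall t, t0 <= t -> T t <> (a + b) / 2).
  { intros t Ht He. destruct (Hdi t Ht) as [H|H]; rewrite He in H; revert H; unfold Rabs;
    destruct Rcase_abs; lra. }
  destruct (Rlt_dec (T (t0 + 1)) ((a + b) / 2)) as [Hlt|Hge].
  - left.
    assert (Hs : forall t, t0 + 1 <= t -> T t < (a + b) / 2).
    { intros t Ht. apply Rnot_le_lt. intros Hle.
      destruct (IVT_val T (t0 + 1) t ((a + b) / 2)) as [x [Hx Hx']]; auto.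
      intros; apply Hcont; lra. rewrite Rmin_left, Rmax_right; lra. apply (Hne x); lra. }
    intros e He. destruct (key (Rmin e ((b - a) / 2))) as [t1 [Ht1 Hk]].
    apply Rmin_glb_lt; lra. Rmin_bounds e ((b - a) / 2).
    exists (Rmax t1 (t0 + 1)). intros t Ht. Rmax_bounds t1 (t0 + 1).
    specialize (Hs t ltac:(lra)). destruct (Hk t ltac:(lra)) as [H3|H3]. lra.
    revert H3. unfold Rabs. destruct Rcase_abs; lra.
  - right.
    assert (Hs : forall t, t0 + 1 <= t -> (a + b) / 2 < T t).
    { intros t Ht. apply Rnot_le_lt. intros Hle.
      destruct (IVT_val T (t0 + 1) t ((a + b) / 2)) as [x [Hx Hx']]; auto.
      intros; apply Hcont; lra. rewrite Rmin_right, Rmax_left; lra. apply (Hne x); lra. }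
    intros e He. destruct (key (Rmin e ((b - a) / 2))) as [t1 [Ht1 Hk]].
    apply Rmin_glb_lt; lra. Rmin_bounds e ((b - a) / 2).
    exists (Rmax t1 (t0 + 1)). intros t Ht. Rmax_bounds t1 (t0 + 1).
    specialize (Hs t ltac:(lra)). destruct (Hk t ltac:(lra)) as [H3|H3]; [|lra].
    revert H3. unfold Rabs. destruct Rcase_abs; lra.
Qed.

Lemma tends_to_mult f g l k : tends_to f l -> tends_to g k -> tends_to (fun t => f t * g t) (l * k).
Proof.
  intros Hf Hg e He.
  set (C := Rabs l + Rabs k + 1). assert (HC : 0 < C).
  { unfold C. pose proof (Rabs_pos l). pose proof (Rabs_pos k). lra. }
  set (d := Rmin 1 (e / (2 * C))).
  assert (Hd : 0 < d) by (apply Rmin_glb_lt; [lra | apply Rdiv_lt_0_compat; lra]).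
  destruct (Hf d Hd) as [t1 h1]. destruct (Hg d Hd) as [t2 h2]. exists (Rmax t1 t2). intros t Ht.
  Rmax_bounds t1 t2.
  specialize (h1 t ltac:(lra)). specialize (h2 t ltac:(lra)).
  Rmin_bounds 1 (e / (2 * C)). fold d in H1, H2.
  assert (Hdc : d * (2 * C) <= e).
  { apply Rle_trans with (e / (2 * C) * (2 * C)). apply Rmult_le_compat_r; lra. right. field. lra. }
  replace (f t * g t - l * k) with ((f t - l) * (g t - k) + (l * (g t - k) + k * (f t - l))) by ring.
  eapply Rle_lt_trans. apply Rabs_triang.
  eapply Rle_lt_trans. apply Rplus_le_compat_l, Rabs_triang. rewrite !Rabs_mult.
  pose proof (Rabs_pos l). pose proof (Rabs_pos k).
  pose proof (Rabs_pos (f t - l)). pose proof (Rabs_pos (g t - k)).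
  assert (Rabs (f t - l) * Rabs (g t - k) <= 1 * d) by (apply Rmult_le_compat; lra).
  assert (Rabs l * Rabs (g t - k) <= Rabs l * d) by (apply Rmult_le_compat_l; lra).
  assert (Rabs k * Rabs (f t - l) <= Rabs k * d) by (apply Rmult_le_compat_l; lra).
  assert (d * C < e) by nra. unfold C in *. lra.
Qed.

Lemma min_left_deriv (f : R -> R) x0 x l : x0 < x -> (forall y, x0 <= y <= x -> f x <= f y) ->
  is_derive f x l -> l <= 0.
Proof.
  intros Hx Hm Hd. apply is_derive_Reals in Hd. apply Rnot_lt_le. intros Hl.
  destruct (Hd (l / 2)) as [[d Hdp] H]. lra. simpl in H.
  set (k := Rmin (d / 2) (x - x0)). assert (Hk : 0 < k) by (apply Rmin_glb_lt; lra).
  pose proof (Rmin_l (d / 2) (x - x0)) as K1. pose proof (Rmin_r (d / 2) (x - x0)) as K2.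
  fold k in K1, K2.
  specialize (H (- k) ltac:(lra)). rewrite Rabs_Ropp, Rabs_right in H by lra. specialize (H ltac:(lra)).
  specialize (Hm (x + - k) ltac:(lra)).
  assert (E : (f (x + - k) - f x) / - k <= 0).
  { unfold Rdiv. rewrite Rinv_opp. assert (0 < / k) by (apply Rinv_0_lt_compat; lra). nra. }
  apply Rabs_def2 in H. lra.
Qed.

(** * Cut-off by projection onto an interval, first hitting times *)

Definition clamp (r x : R) := Rmax (- r) (Rmin r x).

Lemma clamp_bounds r x : 0 < r -> - r <= clamp r x <= r.
Proof. intros Hr. unfold clamp, Rmax, Rmin. repeat destruct Rle_dec; lra. Qed.

Lemma clamp_id r x : Rabs x <= r -> clamp r x = x.
Proof.
  intros H. apply Rabs_le_between in H. unfold clamp, Rmax, Rmin. repeat destruct Rle_dec; lra.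
Qed.

Lemma clamp_lip r x y : 0 < r -> Rabs (clamp r x - clamp r y) <= Rabs (x - y).
Proof.
  intros Hr. unfold clamp, Rmax, Rmin.
  repeat destruct Rle_dec; unfold Rabs; repeat destruct Rcase_abs; lra.
Qed.

Lemma continuous_bounded (f : R -> R) a b : a <= b -> (forall x, a <= x <= b -> continuous f x) ->
  exists K, 0 < K /\ forall x, a <= x <= b -> Rabs (f x) <= K.
Proof.
  intros Hab Hc.
  assert (Hc' : forall c, a <= c <= b -> continuity_pt (fun x => Rabs (f x)) c).
  { intros c Hcc. apply continuity_pt_filterlim. apply (continuous_comp f Rabs). now apply Hc. apply continuous_Rabs. }
  destruct (continuity_ab_maj _ a b Hab Hc') as [M [HM _]].
  exists (Rabs (f M) + 1). split. pose proof (Rabs_pos (f M)). lra.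
  intros x Hx. specialize (HM x Hx). simpl in HM. lra.
Qed.

Lemma clamp_C1 (f df : R -> R) r : 0 < r -> (forall x, is_derive f x (df x)) ->
  (forall x, continuous df x) -> exists K, 0 < K /\
  (forall x, Rabs (f (clamp r x)) <= K) /\
  (forall x y, Rabs (f (clamp r x) - f (clamp r y)) <= K * Rabs (x - y)).
Proof.
  intros Hr Hd Hc.
  destruct (continuous_bounded f (- r) r) as [K1 [HK1 HK1']]. lra.
  intros x _. apply (ex_derive_continuous f). eexists; apply Hd.
  destruct (continuous_bounded df (- r) r) as [K2 [HK2 HK2']]. lra. intros; apply Hc.
  exists (K1 + K2). split. lra. split.
  - intros x. specialize (HK1' _ (clamp_bounds r x Hr)). lra.
  - assert (key : forall u v, - r <= u <= v -> v <= r -> Rabs (f v - f u) <= K2 * Rabs (v - u)).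
    { intros u v Hu Hv. destruct (deriv_MVT f df u v) as [c [Hcc He]]. lra. auto.
      rewrite He, Rabs_mult. apply Rmult_le_compat_r. apply Rabs_pos. apply HK2'. lra. }
    intros x y. pose proof (clamp_bounds r x Hr). pose proof (clamp_bounds r y Hr).
    apply Rle_trans with (K2 * Rabs (clamp r x - clamp r y)).
    + destruct (Rle_dec (clamp r x) (clamp r y)).
      rewrite Rabs_minus_sym, (Rabs_minus_sym (clamp r x)). apply key; lra. apply key; lra.
    + pose proof (clamp_lip r x y Hr). pose proof (Rabs_pos (clamp r x - clamp r y)).
      apply Rle_trans with (K2 * Rabs (x - y)). apply Rmult_le_compat_l; lra.
      apply Rmult_le_compat_r. apply Rabs_pos. lra.
Qed.

Lemma lip2_affine_mul (u v : R -> R) c K1 K2 : 0 <= K1 -> 0 <= K2 ->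
  (forall x, Rabs (u x) <= K1) -> (forall x y, Rabs (u x - u y) <= K1 * Rabs (x - y)) ->
  (forall x, Rabs (v x) <= K2) -> (forall x y, Rabs (v x - v y) <= K2 * Rabs (x - y)) ->
  lip2 (K1 * K2) (fun z w => c + u z * v w) /\ forall z w, Rabs (c + u z * v w) <= Rabs c + K1 * K2.
Proof.
  intros H1 H2 Hu Hul Hv Hvl. split.
  - intros z w z' w'.
    replace (c + u z * v w - (c + u z' * v w')) with (u z * (v w - v w') + (u z - u z') * v w') by ring.
    eapply Rle_trans. apply Rabs_triang. rewrite !Rabs_mult.
    apply Rle_trans with (K1 * (K2 * Rabs (w - w')) + (K1 * Rabs (z - z')) * K2).
    + apply Rplus_le_compat; apply Rmult_le_compat; auto; apply Rabs_pos.
    + right. ring.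
  - intros z w. eapply Rle_trans. apply Rabs_triang. apply Rplus_le_compat_l.
    rewrite Rabs_mult. apply Rmult_le_compat; auto; apply Rabs_pos.
Qed.

Lemma first_hit (f : R -> R) s c : (forall x, 0 <= x -> ex_derive f x) -> f 0 < c -> 0 <= s -> c < f s ->
  exists u, 0 <= u /\ f u = c /\ forall v, 0 <= v <= u -> f v <= c.
Proof.
  intros Hc H0 Hs Hfs. apply NNPP. intros Hn.
  assert (Ho : forall t, 0 <= t -> ex_derive (fun t => - f t) t).
  { intros t Ht. auto_derive. auto. }
  assert (H : forall t, 0 <= t -> - c < - f t).
  { apply real_induction.
    - intros t Ht Hlt. destruct (Req_dec t 0) as [->|Hne]. lra.
      destruct (Rtotal_order (f t) c) as [|[E|Hgt]]. lra.
      + exfalso. apply Hn. exists t. split; auto. split; auto. intros v Hv.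
        destruct (Rle_lt_or_eq_dec v t ltac:(lra)) as [Hvt| ->]; [|lra]. specialize (Hlt v ltac:(lra)). lra.
      + assert (- c <= - f t); [|lra]. apply (ge_at_left (fun t => - f t)); auto. lra.
        intros u Hu. left. now apply Hlt.
    - intros t Ht Hlt. apply (gt_at_right (fun t => - f t)); auto. apply Hlt. lra. }
  specialize (H s Hs). lra.
Qed.

Lemma deriv_pos_right (f : R -> R) t l : is_derive f t l -> 0 < l ->
  exists e, 0 < e /\ forall s, t < s < t + e -> f t < f s.
Proof.
  intros Hd Hl. apply is_derive_Reals in Hd. destruct (Hd (l / 2)) as [[d Hdp] H]. lra. simpl in H.
  exists d. split; auto. intros s Hs. specialize (H (s - t) ltac:(lra)).
  rewrite Rabs_right in H by lra. specialize (H ltac:(lra)). replace (t + (s - t)) with s in H by ring.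
  apply Rabs_def2 in H. apply Rnot_le_lt. intros Hle.
  assert ((f s - f t) / (s - t) <= 0).
  { unfold Rdiv. assert (0 < / (s - t)) by (apply Rinv_0_lt_compat; lra). nra. }
  lra.
Qed.

(** * The autonomous system, its Dulac function and the nonexistence argument *)

Section System.
Variables n a m : R.
Hypothesis Hn : 0 < n.
Hypothesis Hna : n < a.

(** For [a = 2 / (p - 1)] one has [cb = 2 / (p + 1)] and [ce = p + 1]. *)
Definition cb := a / (1 + a).
Definition ce := 2 * (1 + a) / a.
Definition cc := cb * (n + 1).
Definition cg := n / cc.
(** At a fixed point [drift] forces [hh T = hs], and then [VZ = 0] gives [exp z = a]. *)
Definition hs := n / a - 1.
Definition C1 := a * (2 * a - n) / (n * (1 + a)).
Definition nu := n + 2 + (n + 1) * C1.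
Definition C0 := C1 * (1 + n / a ^ 2).
Definition C2 := C1 + 2 - cb.

Definition hh T := exp (ce * T) - m * exp T.
Definition dh T := ce * exp (ce * T) - m * exp T.
Definition VZ z T := - n + exp z * (1 + hh T).
Definition VT z T := cc - exp z * (1 + cb * hh T).
(** The expanded form of [(1 + C1) (hh T - hs) + 1 + hh T - cb dh T], where
    [1 + C1 = (nu - 1) / (n + 1)]: the divergence of the weighted field over the weight times
    [exp z]. *)
Definition dulac T := C0 + C1 * exp (ce * T) - m * C2 * exp T.
Definition pohozaev z T :=
  exp (nu * (z + cg * T)) * exp (- (cg * T)) * ((1 + cb * hh T) / nu - cc * exp (- z) / (nu - 1)).

Lemma cb_bounds : 0 < cb < 1.
Proof.
  unfold cb. split. apply Rdiv_lt_0_compat; lra.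
  apply (Rmult_lt_reg_r (1 + a)). lra. field_simplify; lra.
Qed.

Lemma ce_cb : ce * cb = 2.
Proof. unfold ce, cb. field. lra. Qed.

Lemma ce_gt : 2 < ce.
Proof. pose proof cb_bounds. pose proof ce_cb. nra. Qed.

Lemma cc_gt : n < cc.
Proof.
  unfold cc, cb. apply (Rmult_lt_reg_r (1 + a)). lra.
  replace (a / (1 + a) * (n + 1) * (1 + a)) with (a * (n + 1)) by (field; lra). nra.
Qed.

Lemma cg_cc : cg * cc = n.
Proof. pose proof cc_gt. unfold cg. field. lra. Qed.

Lemma cg_bounds : 0 < cg < 1.
Proof. pose proof cc_gt. pose proof cg_cc. split; nra. Qed.

Lemma C1_pos : 0 < C1.
Proof. unfold C1. apply Rdiv_lt_0_compat; apply Rmult_lt_0_compat; lra. Qed.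

Lemma nu_gt : n + 2 < nu.
Proof. pose proof C1_pos. unfold nu. nra. Qed.

Lemma hs_eq : cc = a * (1 + cb * hs).
Proof. unfold hs, cc, cb. field. lra. Qed.

Lemma cg_cb : 1 - cg * cb = / (n + 1).
Proof. unfold cg, cc, cb. field. lra. Qed.

Lemma cg_hs : 1 - cg = - hs / (n + 1).
Proof. unfold cg, hs, cc, cb. field. lra. Qed.

Lemma is_derive_hh T : is_derive hh T (dh T).
Proof. unfold hh, dh. auto_derive; auto. ring. Qed.

Definition orbit (Z T : R -> R) t : Prop :=
  is_derive Z t (VZ (Z t) (T t)) /\ is_derive T t (VT (Z t) (T t)).

Lemma drift z T : VZ z T + cg * VT z T = exp z * (hh T - hs) / (n + 1).
Proof.
  unfold VZ, VT. pose proof cg_cc as h1. pose proof cg_cb as h2. pose proof cg_hs as h3.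
  replace (- n + exp z * (1 + hh T) + cg * (cc - exp z * (1 + cb * hh T)))
    with (- n + cg * cc + exp z * ((1 - cg) + (1 - cg * cb) * hh T)) by ring.
  rewrite h1, h2, h3. field. lra.
Qed.

(** Write [phi] for the weight and [P] for [pohozaev]. The [z]-derivative of [P] is [- phi VT].
    Hence [dP/dT - phi VZ] has [z]-derivative minus the divergence [phi exp z dulac]; both being
    multiples of [exp (nu z)], it equals [- phi exp z dulac / nu]. The [VZ VT] terms then cancel
    along an orbit. *)
Lemma pohozaev_derive Z T t : orbit Z T t ->
  is_derive (fun t => pohozaev (Z t) (T t)) t
   (- (exp (nu * (Z t + cg * T t)) * exp (- (cg * T t)) * VT (Z t) (T t) / nu * dulac (T t))).
Proof.
  intros [HZ HT]. pose proof nu_gt as Hnu. unfold pohozaev, hh. auto_derive.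
  repeat split; eexists; eauto.
  rewrite (Derive_val _ _ _ HZ), (Derive_val _ _ _ HT).
  assert (Hd := drift (Z t) (T t)).
  assert (EZ : VZ (Z t) (T t) = exp (Z t) * (hh (T t) - hs) / (n + 1) - cg * VT (Z t) (T t)) by lra.
  set (P := exp (nu * (Z t + cg * T t))) in *.
  set (Q := exp (- (cg * T t))) in *.
  rewrite exp_Ropp.
  transitivity (P * Q * ((nu * (VZ (Z t) (T t) + cg * VT (Z t) (T t)) - cg * VT (Z t) (T t))
     * ((1 + cb * hh (T t)) / nu - cc / exp (Z t) / (nu - 1))
     + cb * dh (T t) * VT (Z t) (T t) / nu + cc / exp (Z t) * VZ (Z t) (T t) / (nu - 1))).
  { unfold dh, hh, Rdiv. ring. }
  rewrite Hd. rewrite EZ. unfold VT, dulac, dh, hh.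
  pose proof (exp_pos (Z t)) as HX. set (X := exp (Z t)) in *.
  set (A := exp (ce * T t)). set (B := exp (T t)).
  clearbody P Q X A B.
  assert (Hnu' : nu = (n + 2) + (n + 1) * (a * (2 * a - n) / (n * (1 + a)))) by reflexivity.
  unfold C0, C2, C1, hs, cc, ce, cg, cc, cb.
  clear - Hn Hna Hnu HX Hnu'.
  assert (N1 : nu <> 0) by lra. assert (N2 : nu - 1 <> 0) by lra.
  rewrite Hnu' in N1, N2 |- *.
  assert (0 < n * (1 + a)) by nra. assert (0 < a * (2 * a - n)) by nra.
  field. repeat split; nra.
Qed.

(** Multiplied by [exp z nu], the bracket in [pohozaev] becomes [- VT - cc / (nu - 1)], so the two
    inequalities are equivalent; the next lemma is the converse. *)
Lemma VT_neg_of_pohozaev z T : 0 < pohozaev z T -> VT z T < - (cc / (nu - 1)).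
Proof.
  pose proof nu_gt. pose proof cc_gt. intros HP. unfold pohozaev in HP.
  assert (H1 : 0 < (1 + cb * hh T) / nu - cc * exp (- z) / (nu - 1)).
  { apply Rnot_le_lt. intros Hle.
    pose proof (Rmult_lt_0_compat _ _ (exp_pos (nu * (z + cg * T))) (exp_pos (- (cg * T)))). nra. }
  pose proof (exp_pos z) as Hz. rewrite exp_Ropp in H1. unfold VT.
  apply (Rmult_lt_compat_l (exp z * nu)) in H1. 2: apply Rmult_lt_0_compat; lra.
  replace (exp z * nu * ((1 + cb * hh T) / nu - cc * / exp z / (nu - 1)))
    with (exp z * (1 + cb * hh T) - cc - cc / (nu - 1)) in H1 by (field; lra).
  lra.
Qed.

Lemma pohozaev_pos_of_VT z T : VT z T < - (cc / (nu - 1)) -> 0 < pohozaev z T.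
Proof.
  pose proof nu_gt. pose proof cc_gt. intros HV. unfold VT in HV. unfold pohozaev.
  pose proof (exp_pos z) as Hz. rewrite (exp_Ropp z).
  apply Rmult_lt_0_compat. apply Rmult_lt_0_compat; apply exp_pos.
  apply (Rmult_lt_reg_l (exp z * nu)). apply Rmult_lt_0_compat; lra.
  replace (exp z * nu * ((1 + cb * hh T) / nu - cc * / exp z / (nu - 1)))
    with (exp z * (1 + cb * hh T) - cc - cc / (nu - 1)) by (field; lra).
  lra.
Qed.

Lemma no_descending_orbit (Z T : R -> R) : 0 <= m ->
  (forall s, 0 <= dulac s) -> (forall t, 0 <= t -> orbit Z T t) -> ~ 0 < pohozaev (Z 0) (T 0).
Proof.
  intros Hm Hq Ho HP0. pose proof nu_gt as Hnu. pose proof cc_gt as Hcc. pose proof cb_bounds as Hcb.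
  set (df := fun t => - (exp (nu * (Z t + cg * T t)) * exp (- (cg * T t)) * VT (Z t) (T t) / nu * dulac (T t))).
  assert (Hdf : forall t, 0 < pohozaev (Z t) (T t) -> 0 <= df t).
  { intros t Ht. apply VT_neg_of_pohozaev in Ht. unfold df.
    assert (0 < cc / (nu - 1)) by (apply Rdiv_lt_0_compat; lra).
    pose proof (Rmult_lt_0_compat _ _ (exp_pos (nu * (Z t + cg * T t))) (exp_pos (- (cg * T t)))).
    assert (0 <= (exp (nu * (Z t + cg * T t)) * exp (- (cg * T t))) * (- VT (Z t) (T t)) / nu * dulac (T t)).
    { apply Rmult_le_pos; auto. apply Rmult_le_pos. apply Rmult_le_pos; lra.
      apply Rlt_le, Rinv_0_lt_compat. lra. }
    unfold Rdiv in *. lra. }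
  assert (HP : forall t, 0 <= t -> 0 < pohozaev (Z t) (T t)).
  { apply real_induction.
    - intros t Ht Hs. destruct (Req_dec t 0) as [->|Ht0]; auto.
      assert (Hle : forall s, 0 <= s < t -> pohozaev (Z 0) (T 0) <= pohozaev (Z s) (T s)).
      { intros s Hs'. apply (deriv_nonneg_le (fun t => pohozaev (Z t) (T t)) df). lra.
        intros x Hx. apply pohozaev_derive, Ho. lra. intros x Hx. apply Hdf, Hs. lra. }
      apply Rlt_le_trans with (pohozaev (Z 0) (T 0)); auto.
      apply (ge_at_left (fun t => pohozaev (Z t) (T t))); auto. lra. eexists. now apply pohozaev_derive, Ho.
    - intros t Ht Hs. apply (gt_at_right (fun t => pohozaev (Z t) (T t))); [|apply Hs; lra].
      eexists. now apply pohozaev_derive, Ho. }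
  set (dl := cc / (nu - 1)). assert (Hdl : 0 < dl) by (apply Rdiv_lt_0_compat; lra).
  assert (HVT : forall t, 0 <= t -> VT (Z t) (T t) <= - dl).
  { intros t Ht. left. apply VT_neg_of_pohozaev. auto. }
  assert (HT : forall t, 0 <= t -> T t <= T 0 - dl * t).
  { intros t Ht. assert (T t + dl * t <= T 0 + dl * 0); [|lra].
    apply (deriv_nonpos_ge (fun t => T t + dl * t) (fun t => VT (Z t) (T t) + dl)). lra.
    - intros x Hx. destruct (Ho x ltac:(lra)) as [_ HTx]. derive_with HTx.
    - intros x Hx. specialize (HVT x ltac:(lra)). lra. }
  (* [ep] makes [n (1 + ep) / cc - (1 - ep) = - k < 0], possible because [n < cc] *)
  set (ep := (cc - n) / (2 * (cc + n))).
  assert (Hep : 0 < ep) by (apply Rdiv_lt_0_compat; lra).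
  assert (Hepk : n * (1 + ep) / cc - (1 - ep) = - ((cc - n) / (2 * cc))).
  { unfold ep. field. lra. }
  set (k := (cc - n) / (2 * cc)) in *. assert (Hk : 0 < k) by (apply Rdiv_lt_0_compat; lra).
  (* Below [y] one has [(m + 1) exp T <= min (ep, 1)], which forces [|hh T| <= ep]. *)
  set (y := ln (Rmin ep 1 / (m + 1))).
  assert (Hy : 0 < Rmin ep 1 / (m + 1)).
  { apply Rdiv_lt_0_compat; [apply Rmin_glb_lt|]; lra. }
  set (t0 := Rmax 0 ((T 0 - y) / dl)).
  assert (Hsmall : forall t, t0 <= t -> - ep <= hh (T t) <= ep).
  { intros t Ht. unfold t0 in Ht. Rmax_bounds 0 ((T 0 - y) / dl).
    specialize (HT t ltac:(lra)).
    assert (HTy : T t <= y).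
    { assert (dl * ((T 0 - y) / dl) <= dl * t) by (apply Rmult_le_compat_l; lra).
      replace (dl * ((T 0 - y) / dl)) with (T 0 - y) in H1 by (field; lra). lra. }
    apply exp_le in HTy. unfold y in HTy. rewrite exp_ln in HTy by auto.
    assert (Hmm : (m + 1) * exp (T t) <= Rmin ep 1).
    { apply Rle_trans with ((m + 1) * (Rmin ep 1 / (m + 1))). apply Rmult_le_compat_l; lra. right. field. lra. }
    Rmin_bounds ep 1. pose proof (exp_pos (T t)).
    assert (HT0 : T t <= 0).
    { apply Rnot_lt_le. intros Hlt. apply exp_increasing in Hlt. rewrite exp_0 in Hlt. nra. }
    assert (He : exp (ce * T t) <= exp (T t)).
    { apply exp_le. pose proof ce_gt. nra. }
    pose proof (exp_pos (ce * T t)). unfold hh. split; nra. }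
  assert (Hdec : forall t, t0 <= t -> exp (- Z t) <= exp (- Z t0) - k * (t - t0)).
  { intros t Ht. assert (exp (- Z t) + k * (t - t0) <= exp (- Z t0) + k * (t0 - t0)); [|lra].
    assert (Ht0 : 0 <= t0) by apply Rmax_l.
    apply (deriv_nonpos_ge (fun t => exp (- Z t) + k * (t - t0))
       (fun t => n * exp (- Z t) - (1 + hh (T t)) + k)); auto.
    - intros x Hx. destruct (Ho x ltac:(lra)) as [HZx _]. auto_derive. eexists; eauto.
      rewrite (Derive_val _ _ _ HZx). unfold VZ. rewrite exp_Ropp.
      pose proof (exp_pos (Z x)). field. lra.
    - intros x Hx. specialize (HVT x ltac:(lra)). destruct (Hsmall x ltac:(lra)) as [Hs1 Hs2].
      (* [VT < 0] reads [cc exp (- Z) < 1 + cb hh T]: this upper bound on [exp (- Z)] makes its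
         derivative [n exp (- Z) - (1 + hh T)] at most [- k]. *)
      assert (HE : cc * exp (- Z x) <= 1 + ep).
      { unfold VT in HVT. rewrite exp_Ropp. pose proof (exp_pos (Z x)).
        apply (Rmult_le_reg_r (exp (Z x))); auto. rewrite Rmult_assoc, Rinv_l by lra.
        assert (exp (Z x) * (1 + cb * hh (T x)) <= exp (Z x) * (1 + ep)).
        { apply Rmult_le_compat_l. lra. nra. }
        lra. }
      assert (n * exp (- Z x) <= n * (1 + ep) / cc).
      { apply (Rmult_le_reg_r (/ n * cc)). apply Rmult_lt_0_compat; [apply Rinv_0_lt_compat|]; lra.
        replace (n * exp (- Z x) * (/ n * cc)) with (cc * exp (- Z x)) by (field; lra).
        replace (n * (1 + ep) / cc * (/ n * cc)) with (1 + ep) by (field; lra). exact HE. }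
      lra. }
  (* The time at which the affine upper bound for [exp (- Z)] vanishes. *)
  set (t1 := t0 + exp (- Z t0) / k).
  assert (Ht1 : t0 <= t1).
  { unfold t1. pose proof (Rdiv_lt_0_compat _ _ (exp_pos (- Z t0)) Hk). lra. }
  specialize (Hdec t1 Ht1). pose proof (exp_pos (- Z t1)).
  replace (k * (t1 - t0)) with (exp (- Z t0)) in Hdec by (unfold t1; field; lra). lra.
Qed.

(** * The Lyapunov function attached to the fixed points at [T1] and [T2] *)

Section Saddle.
Variables T1 T2 T0 : R.
Hypothesis HT12 : T1 < T2.
Hypothesis Hh1 : hh T1 = hs.
Hypothesis Hh2 : hh T2 = hs.
Hypothesis Hq0 : forall T, 0 <= dulac T.
Hypothesis Hq : forall T, T <> T0 -> 0 < dulac T.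

Lemma hs_neg : -1 < hs < 0.
Proof.
  unfold hs. assert (0 < n / a) by (apply Rdiv_lt_0_compat; lra).
  assert (n / a < 1). { apply (Rmult_lt_reg_r a). lra. field_simplify; lra. } lra.
Qed.

(* [(hh - hs) exp (- T)] is strictly decreasing, then strictly increasing. *)
Lemma hh_shape : exists Tc, T1 < Tc < T2 /\ (forall T, T1 <= T < Tc -> dh T < 0) /\
  (forall T, T1 < T < T2 -> hh T < hs) /\ (forall T, T < T1 \/ T2 < T -> hs < hh T).
Proof.
  pose proof ce_gt as Hce. pose proof hs_neg as Hhs.
  set (k := fun T => (hh T - hs) * exp (- T)).
  set (j := fun T => (ce - 1) * exp (ce * T) + hs).
  assert (Hk : forall T, is_derive k T (j T * exp (- T))).
  { intros T. unfold k, hh. auto_derive; auto. unfold j. rewrite exp_Ropp.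
    pose proof (exp_pos T). field. lra. }
  assert (Hj : forall s t, s < t -> j s < j t).
  { intros s t Hst. unfold j. assert (exp (ce * s) < exp (ce * t)) by (apply exp_increasing; nra). nra. }
  assert (Hk1 : k T1 = 0) by (unfold k; rewrite Hh1; ring).
  assert (Hk2 : k T2 = 0) by (unfold k; rewrite Hh2; ring).
  destruct (deriv_MVT k (fun T => j T * exp (- T)) T1 T2) as [Tc [HTc He]]. lra. auto.
  rewrite Hk1, Hk2 in He. assert (Hjc : j Tc = 0).
  { assert (Hp : 0 < exp (- Tc) * (T2 - T1)) by (apply Rmult_lt_0_compat; [apply exp_pos | lra]).
    apply (Rmult_eq_reg_r (exp (- Tc) * (T2 - T1))); lra. }
  assert (Hdec : forall s t, s < t <= Tc -> k t < k s).
  { intros s t Hst.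
    assert (Hjs : j ((s + t) / 2) < 0) by (rewrite <- Hjc; apply Hj; lra).
    assert (k ((s + t) / 2) < k s).
    { destruct (deriv_MVT k (fun T => j T * exp (- T)) s ((s + t) / 2)) as [x [Hx Hx']]. lra. auto.
      assert (j x < 0) by (destruct (Rle_lt_or_eq_dec x ((s + t) / 2) ltac:(lra)) as [Hl| ->]; [ apply Hj in Hl; lra | exact Hjs]).
      pose proof (exp_pos (- x)). assert (j x * exp (- x) < 0) by nra. nra. }
    assert (k t <= k ((s + t) / 2)); [|lra].
    apply (deriv_nonpos_ge k (fun T => j T * exp (- T))). lra. auto.
    intros x Hx. assert (j x <= 0) by (rewrite <- Hjc; destruct (Rle_lt_or_eq_dec x Tc ltac:(lra)) as [Hl| ->]; [ left; now apply Hj | lra]).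
    pose proof (exp_pos (- x)). nra. }
  assert (Hinc : forall s t, Tc <= s < t -> k s < k t).
  { intros s t Hst.
    assert (Hjs : 0 < j ((s + t) / 2)) by (rewrite <- Hjc; apply Hj; lra).
    assert (k ((s + t) / 2) < k t).
    { destruct (deriv_MVT k (fun T => j T * exp (- T)) ((s + t) / 2) t) as [x [Hx Hx']]. lra. auto.
      assert (0 < j x) by (destruct (Rle_lt_or_eq_dec ((s + t) / 2) x ltac:(lra)) as [Hl| <-]; [ apply Hj in Hl; lra | exact Hjs]).
      pose proof (exp_pos (- x)). assert (0 < j x * exp (- x)) by nra. nra. }
    assert (k s <= k ((s + t) / 2)); [|lra].
    apply (deriv_nonneg_le k (fun T => j T * exp (- T))). lra. auto.
    intros x Hx. assert (0 <= j x) by (rewrite <- Hjc; destruct (Rle_lt_or_eq_dec Tc x ltac:(lra)) as [Hl| <-]; [ left; now apply Hj | lra]).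
    pose proof (exp_pos (- x)). nra. }
  assert (Hc1 : T1 < Tc).
  { destruct (Rle_lt_dec Tc T1); auto. assert (k T1 < k T2) by (apply Hinc; lra). lra. }
  assert (Hc2 : Tc < T2).
  { destruct (Rle_lt_dec T2 Tc); auto. assert (k T2 < k T1) by (apply Hdec; lra). lra. }
  assert (Hkh : forall T, hh T - hs = k T * exp T).
  { intros T. unfold k. rewrite exp_Ropp. pose proof (exp_pos T). field. lra. }
  assert (Hneg : forall T, T1 < T < T2 -> k T < 0).
  { intros T HT. destruct (Rle_dec T Tc). rewrite <- Hk1. apply Hdec; lra. rewrite <- Hk2. apply Hinc; lra. }
  exists Tc. split. lra. split; [|split].
  - intros T HT.
    assert (E : dh T = j T + (hh T - hs)) by (unfold dh, hh, j; ring). rewrite E.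
    assert (j T < 0) by (rewrite <- Hjc; apply Hj; lra).
    assert (k T <= 0).
    { destruct (Rle_lt_or_eq_dec T1 T ltac:(lra)) as [Hl| <-]; [ left; apply Hneg; lra | lra]. }
    rewrite Hkh. pose proof (exp_pos T). nra.
  - intros T HT. specialize (Hneg T HT). pose proof (Hkh T). pose proof (exp_pos T). nra.
  - intros T HT. assert (0 < k T).
    { destruct HT. rewrite <- Hk1. apply Hdec; lra. rewrite <- Hk2. apply Hinc; lra. }
    pose proof (Hkh T). pose proof (exp_pos T). nra.
Qed.

Definition FF T := (1 + cb * hh T) * exp (- (cg * T)).
Definition GG T :=
  exp ((ce - cg) * T) / (ce - cg) - m * exp ((1 - cg) * T) / (1 - cg) + hs * exp (- (cg * T)) / cg.
(** [FF / nu] is the coefficient of [exp (nu (z + cg T))] coming from the first term of [pohozaev].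
    [F0] has the same value at [T2], but its derivative carries the factor [hh T - hs]; the
    difference [F0 - FF] is the primitive of [dulac exp (- cg T)] that vanishes at [T2]. *)
Definition F0 T := FF T2 + nu / (n + 1) * (GG T - GG T2).
Definition dulac_int T := F0 T - FF T.
Definition lyapunov z T :=
  exp (nu * (z + cg * T)) * (F0 T / nu - cc * exp (- z) * exp (- (cg * T)) / (nu - 1)).

Lemma GG_derive T : is_derive GG T ((hh T - hs) * exp (- (cg * T))).
Proof.
  pose proof ce_gt. pose proof cg_bounds.
  unfold GG, hh. auto_derive; auto.
  replace ((ce - cg) * T) with (ce * T + - (cg * T)) by ring.
  replace ((1 - cg) * T) with (T + - (cg * T)) by ring.
  rewrite !exp_plus. unfold Rminus. field. lra.
Qed.

Lemma F0_derive T : is_derive F0 T (nu / (n + 1) * ((hh T - hs) * exp (- (cg * T)))).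
Proof.
  unfold F0. pose proof (GG_derive T) as H. derive_with H.
Qed.

Lemma FF_derive T : is_derive FF T ((cb * dh T - cg * (1 + cb * hh T)) * exp (- (cg * T))).
Proof. unfold FF, hh. auto_derive; auto. unfold dh, hh. ring. Qed.

Lemma dulac_int_derive T : is_derive dulac_int T (dulac T * exp (- (cg * T))).
Proof.
  unfold dulac_int. pose proof (F0_derive T) as H. pose proof (FF_derive T) as H'.
  auto_derive. repeat split; eexists; eauto.
  rewrite (Derive_val _ _ _ H), (Derive_val _ _ _ H').
  unfold dulac, dh, hh, C0, C2, nu, C1, hs, cc, ce, cg, cc, cb.
  set (A := exp (2 * (1 + a) / a * T)). set (B := exp T). set (Q := exp _).
  clearbody A B Q. field. lra.
Qed.

Lemma dulac_int_increasing s t : s < t -> dulac_int s < dulac_int t.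
Proof.
  intros Hst.
  assert (Hle : forall s t, s <= t -> dulac_int s <= dulac_int t).
  { intros s' t' Hst'. apply (deriv_nonneg_le dulac_int (fun T => dulac T * exp (- (cg * T)))); auto.
    - intros; apply dulac_int_derive.
    - intros x Hx. pose proof (exp_pos (- (cg * x))). specialize (Hq0 x). nra. }
  assert (Hlt : forall s t, s < t -> (T0 < s \/ t < T0) -> dulac_int s < dulac_int t).
  { intros s' t' Hst' H0. apply (deriv_pos_lt dulac_int (fun T => dulac T * exp (- (cg * T)))); auto.
    - intros; apply dulac_int_derive.
    - intros x Hx. apply Rmult_lt_0_compat. apply Hq. lra. apply exp_pos. }
  (* The possible zero [T0] misses the last or the first quarter of [[s, t]], where the increase is
     strict. *)
  destruct (Rle_dec T0 ((s + t) / 2)).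
  - assert (dulac_int ((s + 3 * t) / 4) < dulac_int t) by (apply Hlt; lra).
    assert (dulac_int s <= dulac_int ((s + 3 * t) / 4)) by (apply Hle; lra). lra.
  - assert (dulac_int s < dulac_int ((3 * s + t) / 4)) by (apply Hlt; lra).
    assert (dulac_int ((3 * s + t) / 4) <= dulac_int t) by (apply Hle; lra). lra.
Qed.

Lemma dulac_int_T2 : dulac_int T2 = 0.
Proof. unfold dulac_int, F0. ring. Qed.

(** Both [drift] and the derivative of [F0] carry the factor [hh T - hs]. Once it is taken out, the
    [cc] terms cancel and [F0 - FF] remains. *)
Lemma lyapunov_derive Z T t : orbit Z T t ->
  is_derive (fun t => lyapunov (Z t) (T t)) t
   (exp (nu * (Z t + cg * T t)) * exp (Z t) / (n + 1) * ((hh (T t) - hs) * dulac_int (T t))).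
Proof.
  intros [HZ HT]. pose proof nu_gt as Hnu. pose proof (F0_derive (T t)) as HF.
  unfold lyapunov. auto_derive. repeat split; eexists; eauto.
  rewrite (Derive_val _ _ _ HZ), (Derive_val _ _ _ HT), (Derive_val _ _ _ HF).
  unfold dulac_int, FF.
  pose proof (drift (Z t) (T t)) as Hd.
  set (P := exp (nu * (Z t + cg * T t))). set (Q := exp (- (cg * T t))).
  rewrite exp_Ropp. pose proof (exp_pos (Z t)).
  transitivity (P * (nu * (VZ (Z t) (T t) + cg * VT (Z t) (T t)) * (F0 (T t) / nu - cc / exp (Z t) * Q / (nu - 1))
    + / (n + 1) * ((hh (T t) - hs) * Q) * VT (Z t) (T t)
    + cc / exp (Z t) * Q * (VZ (Z t) (T t) + cg * VT (Z t) (T t)) / (nu - 1))).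
  { field. lra. }
  rewrite Hd. unfold VT. field. lra.
Qed.

Lemma FF_fixed T : hh T = hs -> FF T = cc / a * exp (- (cg * T)).
Proof.
  intros H. unfold FF. rewrite H. pose proof hs_eq as E. f_equal.
  rewrite E. field. lra.
Qed.

Lemma F0_min T : T1 <= T -> FF T2 <= F0 T.
Proof.
  intros HT. destruct hh_shape as [Tc [_ [_ [Hneg Hpos]]]].
  assert (Hg : FF T2 <= F0 T); auto.
  replace (FF T2) with (F0 T2) by (unfold F0; ring).
  pose proof nu_gt as Hnu.
  assert (Hc : 0 < nu / (n + 1)) by (apply Rdiv_lt_0_compat; lra).
  destruct (Rle_dec T T2).
  - apply (deriv_nonpos_ge F0 (fun T => nu / (n + 1) * ((hh T - hs) * exp (- (cg * T))))); auto.
    intros; apply F0_derive. intros x Hx.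
    assert (hh x <= hs).
    { destruct (Rle_lt_or_eq_dec T1 x ltac:(lra)) as [h1| <-]; [|lra].
      destruct (Rle_lt_or_eq_dec x T2 ltac:(lra)) as [h2| ->]; [|lra]. left. apply Hneg. lra. }
    pose proof (exp_pos (- (cg * x))).
    assert (0 <= nu / (n + 1) * ((hs - hh x) * exp (- (cg * x)))); [|lra].
    apply Rmult_le_pos. lra. apply Rmult_le_pos; lra.
  - apply (deriv_nonneg_le F0 (fun T => nu / (n + 1) * ((hh T - hs) * exp (- (cg * T))))). lra.
    intros; apply F0_derive. intros x Hx.
    assert (hs <= hh x).
    { destruct (Rle_lt_or_eq_dec T2 x ltac:(lra)) as [h1| <-]; [|lra]. left. apply Hpos. lra. }
    pose proof (exp_pos (- (cg * x))).
    apply Rmult_le_pos. lra. apply Rmult_le_pos; lra.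
Qed.

Lemma cc_pos : 0 < cc.
Proof. pose proof cc_gt. lra. Qed.

Lemma FF2_pos : 0 < FF T2.
Proof.
  rewrite FF_fixed by auto. apply Rmult_lt_0_compat. 2: apply exp_pos.
  apply Rdiv_lt_0_compat. apply cc_pos. lra.
Qed.

Lemma F0_T1 : F0 T1 < cc / a * exp (- (cg * T1)).
Proof.
  rewrite <- FF_fixed by auto. pose proof (dulac_int_increasing T1 T2 HT12) as H.
  rewrite dulac_int_T2 in H. unfold dulac_int in H. lra.
Qed.

Lemma exp_neg_ln : exp (- ln a) = / a.
Proof. rewrite exp_Ropp, exp_ln; lra. Qed.

(** Follows from [F0 T1 < FF T1], that is, from [dulac_int] being negative at [T1]. The size of the
    bound, and not only its sign, is needed in [lyapunov_line]. *)
Lemma lyapunov_P1_lt : lyapunov (ln a) T1 <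
  - (exp (nu * (ln a + cg * T1)) * (cc / a * exp (- (cg * T1))) / (nu * (nu - 1))).
Proof.
  pose proof F0_T1 as H. pose proof nu_gt as Hnu. pose proof cc_pos as Hc.
  unfold lyapunov. rewrite exp_neg_ln. set (P := exp (nu * _)). assert (HP : 0 < P) by apply exp_pos.
  set (Q := exp (- (cg * T1))) in *.
  apply Rlt_le_trans with (P * ((cc / a * Q) / nu - cc * / a * Q / (nu - 1))).
  - apply Rmult_lt_compat_l; auto. apply Rplus_lt_compat_r. apply Rmult_lt_compat_r; auto.
    apply Rinv_0_lt_compat. lra.
  - right. field. lra.
Qed.

Lemma lyapunov_P1_neg : lyapunov (ln a) T1 < 0.
Proof.
  eapply Rlt_trans. apply lyapunov_P1_lt. pose proof nu_gt as Hnu. pose proof cc_pos as Hc.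
  apply Ropp_lt_gt_0_contravar. apply Rdiv_lt_0_compat.
  - apply Rmult_lt_0_compat. apply exp_pos. apply Rmult_lt_0_compat. apply Rdiv_lt_0_compat; lra. apply exp_pos.
  - apply Rmult_lt_0_compat; lra.
Qed.

(** As [ln u = a (Z + T / cb - t)], this line through the saddle is the condition [u = U_1]. Were
    the value somewhere below the one at the saddle, the restriction to a segment would have a
    minimum at some [S > T1] with nonpositive derivative. That forces [S > T2] and
    [cc exp (- z - cg S) < F0 S], hence a value of [lyapunov] above the bound of
    [lyapunov_P1_lt]. *)
Lemma lyapunov_line T : T1 <= T -> lyapunov (ln a) T1 <= lyapunov (ln a - (T - T1) / cb) T.
Proof.
  intros HT. pose proof nu_gt as Hnu. pose proof cc_pos as Hc.
  pose proof cb_bounds as Hb.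
  set (l := fun T => lyapunov (ln a - (T - T1) / cb) T).
  assert (El : l T1 = lyapunov (ln a) T1).
  { unfold l. f_equal. unfold Rdiv. ring. }
  rewrite <- El. change (l T1 <= l T). apply Rnot_lt_le. intros Hlt.
  set (dl := fun T => exp (nu * ((ln a - (T - T1) / cb) + cg * T)) *
     (cb * (hh T - hs) * exp (- (cg * T)) + cc * exp (- (ln a - (T - T1) / cb)) * exp (- (cg * T)) - F0 T) / cc).
  (* Along the line [z + cg T] decreases at the rate [1 / cb - cg = 1 / cc]. *)
  assert (E1 : / cb - cg = / cc).
  { unfold cc. pose proof cg_cb as E. apply (Rmult_eq_reg_l cb); [|lra].
    rewrite Rinv_mult. replace (cb * (/ cb - cg)) with (1 - cg * cb) by (field; lra). rewrite E. field. lra. }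
  assert (E2 : / (n + 1) = cb / cc) by (unfold cc; field; lra).
  assert (Hd : forall T, is_derive l T (dl T)).
  { intros S. unfold l, lyapunov. pose proof (F0_derive S) as HF. auto_derive. eexists; eauto.
    rewrite (Derive_val _ _ _ HF). unfold dl.
    set (P := exp (nu * _)). set (Q := exp (- (cg * S))). set (Y := exp (- _)).
    replace (exp (nu * (ln a + - ((S + - T1) * / cb) + cg * S))) with P by (unfold P; f_equal).
    replace (exp (- (ln a + - ((S + - T1) * / cb)))) with Y by (unfold Y; f_equal).
    transitivity (P * (- nu * (/ cb - cg) * (F0 S / nu - cc * Y * Q / (nu - 1)) + / (n + 1) * ((hh S - hs) * Q)
        - cc * Y * Q * (/ cb - cg) / (nu - 1))).
    { field. lra. }
    rewrite E1, E2. field. lra. }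
  assert (HT' : T1 < T). { destruct HT as [|<-]; lra. }
  destruct (continuity_ab_min l T1 T HT) as [S [HS1 HS2]].
  { intros c _. apply (is_derive_continuity_pt l c (dl c)), Hd. }
  pose proof (HS1 T ltac:(lra)) as HST.
  assert (HS : T1 < S) by (destruct (Rle_lt_or_eq_dec T1 S ltac:(lra)) as [|<-]; lra).
  assert (Hdl : dl S <= 0).
  { apply (min_left_deriv l T1 S (dl S)); auto. intros y Hy. apply HS1. lra. }
  set (z := ln a - (S - T1) / cb) in *.
  assert (Hq' : cb * (hh S - hs) * exp (- (cg * S)) + cc * exp (- z) * exp (- (cg * S)) <= F0 S).
  { apply Rnot_lt_le. intros Hlt'. unfold dl in Hdl. fold z in Hdl.
    assert (0 < exp (nu * (z + cg * S)) *
     (cb * (hh S - hs) * exp (- (cg * S)) + cc * exp (- z) * exp (- (cg * S)) - F0 S) / cc); [|lra].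
    apply Rdiv_lt_0_compat; auto. apply Rmult_lt_0_compat. apply exp_pos. lra. }
  assert (HzS : z < ln a).
  { unfold z. assert (0 < (S - T1) / cb) by (apply Rdiv_lt_0_compat; lra). lra. }
  assert (Hz1 : / a < exp (- z)).
  { rewrite <- exp_neg_ln. apply exp_increasing. lra. }
  pose proof (exp_pos (- (cg * S))) as HQ.
  (* Since [z < ln a], one has [cc exp (- z) > 1 + cb hs]; inserted in the inequality at the minimum
     this gives [FF S < F0 S]. *)
  assert (HKS : 0 < dulac_int S).
  { unfold dulac_int, FF. pose proof hs_eq as E.
    assert (E' : 1 + cb * hs = cc * / a) by (rewrite E; field; lra).
    assert (cc * / a * exp (- (cg * S)) < cc * exp (- z) * exp (- (cg * S))).
    { apply Rmult_lt_compat_r; auto. apply Rmult_lt_compat_l; auto. }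
    rewrite <- E' in H. lra. }
  assert (HS2' : T2 < S).
  { apply Rnot_le_lt. intros Hle. destruct Hle as [Hl|Hl].
    - apply dulac_int_increasing in Hl. rewrite dulac_int_T2 in Hl. lra.
    - rewrite Hl, dulac_int_T2 in HKS. lra. }
  assert (HhS : hs < hh S).
  { destruct hh_shape as [Tc [_ [_ [_ Hpos]]]]. apply Hpos. auto. }
  assert (HF0 : cc * exp (- z) * exp (- (cg * S)) < F0 S).
  { assert (0 < cb * (hh S - hs) * exp (- (cg * S))); [|lra].
    apply Rmult_lt_0_compat; auto. apply Rmult_lt_0_compat; lra. }
  assert (Hlow : - (exp (nu * (z + cg * S)) * (cc * exp (- z) * exp (- (cg * S))) / (nu * (nu - 1))) < l S).
  { unfold l. fold z. unfold lyapunov.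
    set (P := exp (nu * _)). assert (HP : 0 < P) by apply exp_pos.
    set (W := cc * exp (- z) * exp (- (cg * S))) in *.
    apply Rle_lt_trans with (P * (W / nu - W / (nu - 1))).
    - right. field. lra.
    - apply Rmult_lt_compat_l; auto. apply Rplus_lt_compat_r. apply Rmult_lt_compat_r; auto.
      apply Rinv_0_lt_compat. lra. }
  pose proof lyapunov_P1_lt as Hup. rewrite <- El in Hup.
  (* Both sides are [cc exp ((nu - 1) (z + cg T))], taken at two points of the line, along which
     [z + cg T] decreases. *)
  assert (Hcmp : exp (nu * (z + cg * S)) * (cc * exp (- z) * exp (- (cg * S)))
     <= exp (nu * (ln a + cg * T1)) * (cc / a * exp (- (cg * T1)))).
  { unfold Rdiv. rewrite <- exp_neg_ln.
    assert (E : forall u v, exp (nu * (u + cg * v)) * (cc * exp (- u) * exp (- (cg * v)))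
       = cc * exp ((nu - 1) * (u + cg * v))).
    { intros u v. replace ((nu - 1) * (u + cg * v)) with (nu * (u + cg * v) + (- u + - (cg * v))) by ring.
      rewrite !exp_plus. ring. }
    rewrite !E. apply Rmult_le_compat_l. lra. apply exp_le. apply Rmult_le_compat_l. lra.
    assert (z + cg * S = ln a + cg * T1 - (S - T1) * (/ cb - cg)) by (unfold z; field; lra).
    rewrite H, E1. assert (0 < (S - T1) * / cc); [|lra].
    apply Rmult_lt_0_compat. lra. now apply Rinv_0_lt_compat. }
  assert (Hcmp' : exp (nu * (z + cg * S)) * (cc * exp (- z) * exp (- (cg * S))) / (nu * (nu - 1))
     <= exp (nu * (ln a + cg * T1)) * (cc / a * exp (- (cg * T1))) / (nu * (nu - 1))).
  { apply Rmult_le_compat_r; auto. apply Rlt_le, Rinv_0_lt_compat, Rmult_lt_0_compat; lra. }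
  lra.
Qed.

(** With [s = z + cg T], negativity of [lyapunov] gives [F0 T < nu cc exp (- s) / (nu - 1)]. As
    [F0 >= FF T2 > 0], this bounds [s] above; the level [l < 0] bounds it below. Then [F0 T] is
    bounded, while for [T > T2] it exceeds [FF T], which grows like [exp ((ce - cg) T)]; so [T] is
    bounded, and hence [z]. *)
Lemma lyapunov_sublevel_bounded l : l < 0 -> exists r, T1 < r /\
  forall z T, T1 <= T -> lyapunov z T <= l -> T <= r /\ Rabs z <= r.
Proof.
  intros Hl. pose proof nu_gt as Hnu. pose proof cc_pos as Hc.
  pose proof cb_bounds as Hb. pose proof cg_bounds as Hg.
  pose proof ce_gt as He. pose proof FF2_pos as HF2.
  set (smax := - ln (FF T2 * (nu - 1) / (nu * cc))).
  set (smin := ln (- l * (nu - 1) / cc) / (nu - 1)).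
  set (Fmax := nu * cc * exp (- smin) / (nu - 1)).
  set (tm := Rmax (Rmax T2 0) (ln (Rmax 1 (m + Fmax / cb)))).
  assert (key : forall z T, T1 <= T -> lyapunov z T <= l -> smin <= z + cg * T <= smax /\ T <= tm).
  { intros z T HT HL. pose proof (F0_min T HT) as HF.
    unfold lyapunov in HL. set (s := z + cg * T) in *.
    assert (Es : exp (- z) * exp (- (cg * T)) = exp (- s)).
    { rewrite <- exp_plus. f_equal. unfold s. ring. }
    rewrite (Rmult_assoc cc), Es in HL. pose proof (exp_pos (nu * s)) as HP. pose proof (exp_pos (- s)) as HE.
    assert (H1 : F0 T / nu < cc * exp (- s) / (nu - 1)).
    { apply Rnot_le_lt. intros Hle. nra. }
    assert (H1' : F0 T < nu * cc * exp (- s) / (nu - 1)).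
    { apply (Rmult_lt_compat_l nu) in H1; [|lra]. unfold Rdiv in *.
      replace (nu * (F0 T * / nu)) with (F0 T) in H1 by (field; lra). lra. }
    assert (Hmax : s <= smax).
    { assert (FF T2 * (nu - 1) / (nu * cc) < exp (- s)).
      { apply (Rmult_lt_reg_r (nu * cc / (nu - 1))).
        apply Rdiv_lt_0_compat; [apply Rmult_lt_0_compat|]; lra.
        replace (FF T2 * (nu - 1) / (nu * cc) * (nu * cc / (nu - 1))) with (FF T2) by (field; lra).
        replace (exp (- s) * (nu * cc / (nu - 1))) with (nu * cc * exp (- s) / (nu - 1)) by (field; lra). lra. }
      apply ln_increasing in H. rewrite ln_exp in H. unfold smax. lra.
      apply Rdiv_lt_0_compat; apply Rmult_lt_0_compat; lra. }
    assert (Hmin : smin <= s).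
    { assert (H2 : - l <= exp (nu * s) * (cc * exp (- s) / (nu - 1))).
      { assert (0 < exp (nu * s) * (F0 T / nu)). apply Rmult_lt_0_compat; auto. apply Rdiv_lt_0_compat; lra. lra. }
      assert (H3 : - l * (nu - 1) / cc <= exp ((nu - 1) * s)).
      { replace ((nu - 1) * s) with (nu * s + - s) by ring. rewrite exp_plus.
        apply (Rmult_le_reg_r (cc / (nu - 1))). apply Rdiv_lt_0_compat; lra.
        replace (- l * (nu - 1) / cc * (cc / (nu - 1))) with (- l) by (field; lra).
        eapply Rle_trans. apply H2. right. field. lra. }
      apply ln_le in H3. rewrite ln_exp in H3. unfold smin.
      apply (Rmult_le_reg_l (nu - 1)). lra. replace ((nu - 1) * (ln (- l * (nu - 1) / cc) / (nu - 1))) with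
        (ln (- l * (nu - 1) / cc)) by (field; lra). exact H3.
      apply Rdiv_lt_0_compat; auto. apply Rmult_lt_0_compat; lra. }
    split. lra.
    assert (H4 : F0 T <= Fmax).
    { left. eapply Rlt_le_trans. apply H1'. unfold Fmax. apply Rmult_le_compat_r.
      apply Rlt_le, Rinv_0_lt_compat. lra. apply Rmult_le_compat_l. apply Rmult_le_pos; lra. apply exp_le. lra. }
    apply Rnot_lt_le. intros Hlt. unfold tm in Hlt.
    Rmax_bounds (Rmax T2 0) (ln (Rmax 1 (m + Fmax / cb))).
    Rmax_bounds T2 0.
    assert (HB : Rmax 1 (m + Fmax / cb) < exp T).
    { rewrite <- (exp_ln (Rmax 1 _)). apply exp_increasing. lra.
      pose proof (Rmax_l 1 (m + Fmax / cb)). lra. }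
    Rmax_bounds 1 (m + Fmax / cb).
    assert (HK : FF T <= F0 T).
    { assert (Q5 : T2 < T) by lra. apply dulac_int_increasing in Q5. rewrite dulac_int_T2 in Q5. unfold dulac_int in Q5. lra. }
    unfold FF in HK.
    assert (Q6 : 1 + cb * hh T <= Fmax * exp T).
    { assert (E : exp (- (cg * T)) * exp (cg * T) = 1). { rewrite <- exp_plus, <- exp_0. f_equal. ring. }
      assert (Q7 : 1 + cb * hh T <= Fmax * exp (cg * T)).
      { replace (1 + cb * hh T) with ((1 + cb * hh T) * exp (- (cg * T)) * exp (cg * T)) by (rewrite Rmult_assoc, E; ring).
        apply Rmult_le_compat_r. left; apply exp_pos. lra. }
      eapply Rle_trans. apply Q7. apply Rmult_le_compat_l. lra. apply exp_le. nra. }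
    assert (Q8 : exp T * exp T <= exp (ce * T)). { rewrite <- exp_plus. apply exp_le. nra. }
    assert (Q9 : cb * m + Fmax < cb * exp T).
    { replace (cb * m + Fmax) with (cb * (m + Fmax / cb)) by (field; lra). apply Rmult_lt_compat_l; lra. }
    unfold hh in Q6. pose proof (exp_pos T). nra. }
  exists (Rmax (Rmax (T1 + 1) tm) (Rabs smin + Rabs smax + cg * (Rabs T1 + Rabs tm))).
  set (X := Rabs smin + Rabs smax + cg * (Rabs T1 + Rabs tm)).
  Rmax_bounds (Rmax (T1 + 1) tm) X.
  Rmax_bounds (T1 + 1) tm.
  split. lra. intros z T HT HL. destruct (key z T HT HL) as [K1 K2]. split. lra.
  apply Rle_trans with X; auto. unfold X.
  assert (Hg1 : cg * (- Rabs T1) <= cg * T).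
  { apply Rmult_le_compat_l. lra. pose proof (Rle_abs (- T1)) as Q. rewrite Rabs_Ropp in Q. lra. }
  assert (Hg2 : cg * T <= cg * Rabs tm).
  { apply Rmult_le_compat_l. lra. pose proof (Rle_abs tm). lra. }
  pose proof (Rle_abs smax). pose proof (Rle_abs (- smin)) as Q. rewrite Rabs_Ropp in Q.
  pose proof (Rabs_pos T1). pose proof (Rabs_pos tm). pose proof (Rabs_pos smin). pose proof (Rabs_pos smax).
  assert (0 <= cg * Rabs T1) by (apply Rmult_le_pos; lra).
  assert (0 <= cg * Rabs tm) by (apply Rmult_le_pos; lra).
  apply Rabs_le. lra.
Qed.
End Saddle.

(** * Cut-off fields and uniqueness of orbits *)

Lemma clamped_fields r : 0 < r -> exists L B F G,
  0 < L /\ 0 < B /\ lip2 L F /\ lip2 L G /\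
  (forall z w, Rabs (F z w) <= B) /\ (forall z w, Rabs (G z w) <= B) /\
  (forall z w, Rabs z <= r -> Rabs w <= r -> F z w = VZ z w /\ G z w = VT z w).
Proof.
  intros Hr.
  destruct (clamp_C1 exp exp r Hr) as [K1 [HK1 [He Hel]]].
  { intros; apply is_derive_exp. } { intros x. apply (ex_derive_continuous exp). eexists; apply is_derive_exp. }
  (* Both components have the form constant plus [± exp z (1 + b hh T)], with [b = 1] for [VZ] and
     [b = cb] for [VT]. *)
  assert (Hv : forall b, exists K, 0 < K /\ (forall x, Rabs (1 + b * hh (clamp r x)) <= K) /\
    (forall x y, Rabs ((1 + b * hh (clamp r x)) - (1 + b * hh (clamp r y))) <= K * Rabs (x - y))).
  { intros b. apply (clamp_C1 (fun x => 1 + b * hh x) (fun x => b * dh x)); auto.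
    - intros x. unfold hh, dh. auto_derive; auto. ring.
    - intros x. apply (ex_derive_continuous (fun x => b * dh x)). unfold dh. auto_derive. auto. }
  destruct (Hv 1) as [K2 [HK2 [H2 H2l]]]. destruct (Hv cb) as [K3 [HK3 [H3 H3l]]].
  destruct (lip2_affine_mul (fun z => exp (clamp r z)) (fun w => 1 + 1 * hh (clamp r w)) (- n) K1 K2) as [F1 F2]; auto; try lra.
  destruct (lip2_affine_mul (fun z => - exp (clamp r z)) (fun w => 1 + cb * hh (clamp r w)) cc K1 K3) as [G1 G2]; auto; try lra.
  { intros x. rewrite Rabs_Ropp. auto. }
  { intros x y. replace (- exp (clamp r x) - - exp (clamp r y)) with (- (exp (clamp r x) - exp (clamp r y))) by ring.
    rewrite Rabs_Ropp. auto. }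
  assert (P2 : 0 < K1 * K2) by (apply Rmult_lt_0_compat; auto).
  assert (P3 : 0 < K1 * K3) by (apply Rmult_lt_0_compat; auto).
  pose proof (Rabs_pos (- n)). pose proof (Rabs_pos cc).
  assert (weak : forall L L' F, L <= L' -> lip2 L F -> lip2 L' F).
  { intros L L' F HL HF z w z' w'. eapply Rle_trans. apply HF. apply Rmult_le_compat_r; auto.
    pose proof (Rabs_pos (z - z')). pose proof (Rabs_pos (w - w')). lra. }
  do 2 eexists. exists (fun z w => - n + exp (clamp r z) * (1 + 1 * hh (clamp r w))),
    (fun z w => cc + - exp (clamp r z) * (1 + cb * hh (clamp r w))).
  split; [|split; [|split; [|split; [|split; [|split]]]]].
  3: apply (weak (K1 * K2) (K1 * K2 + K1 * K3)); auto; lra.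
  3: apply (weak (K1 * K3) (K1 * K2 + K1 * K3)); auto; lra.
  lra.
  2: intros z w; eapply Rle_trans; [apply F2|].
  3: intros z w; eapply Rle_trans; [apply G2|].
  2: apply Rle_trans with (Rabs (- n) + K1 * K2 + (Rabs cc + K1 * K3)); [lra | apply Rle_refl].
  lra. lra.
  intros z w Hz Hw. rewrite !clamp_id by auto. unfold VZ, VT. split; ring.
Qed.

Lemma orbit_determined Z1 T1 Z2 T2 s t :
  (forall x, orbit Z1 T1 x) -> (forall x, orbit Z2 T2 x) ->
  Z1 s = Z2 s -> T1 s = T2 s -> Z1 t = Z2 t /\ T1 t = T2 t.
Proof.
  intros H1 H2 HZ HT.
  set (lo := Rmin s t). set (hi := Rmax s t).
  assert (Hlh : lo <= hi). { unfold lo, hi, Rmin, Rmax. repeat destruct Rle_dec; lra. }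
  assert (bd : forall f, (forall x, ex_derive f x) -> exists K, 0 < K /\ forall x, lo <= x <= hi -> Rabs (f x) <= K).
  { intros f Hf. apply continuous_bounded; auto. intros x _. now apply (ex_derive_continuous f). }
  destruct (bd Z1) as [k1 [K1 B1]]. intros x; eexists; apply H1.
  destruct (bd T1) as [k2 [K2 B2]]. intros x; eexists; apply H1.
  destruct (bd Z2) as [k3 [K3 B3]]. intros x; eexists; apply H2.
  destruct (bd T2) as [k4 [K4 B4]]. intros x; eexists; apply H2.
  destruct (clamped_fields (k1 + k2 + k3 + k4)) as [L [B [F [G [HL [_ [HF [HG [_ [_ E]]]]]]]]]]. lra.
  destruct (gronwall L F G Z1 T1 Z2 T2 lo hi) as [g1 g2]; auto; try lra.
  { intros x Hx. specialize (B1 x Hx). specialize (B2 x Hx). destruct (E (Z1 x) (T1 x)) as [-> ->]; try lra. apply H1. }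
  { intros x Hx. specialize (B3 x Hx). specialize (B4 x Hx). destruct (E (Z2 x) (T2 x)) as [-> ->]; try lra. apply H2. }
  assert (Hd : (Z1 t - Z2 t) ^ 2 + (T1 t - T2 t) ^ 2 <= 0).
  { unfold lo, hi, Rmin, Rmax in g1, g2. destruct (Rle_dec s t).
    - rewrite HZ, HT in g1. lra.
    - rewrite HZ, HT in g2. lra. }
  pose proof (pow2_ge_0 (Z1 t - Z2 t)). pose proof (pow2_ge_0 (T1 t - T2 t)). split; nra.
Qed.

(** At the saddle [1 + hs = n / a > 0], which persists slightly to the right. Positivity of
    [1 + hh Ts] bounds [z] from above in the wedge used below. *)
Lemma near_saddle T1 Tc : hh T1 = hs -> T1 < Tc ->
  exists Ts, T1 < Ts < Tc /\ 0 < 1 + hh Ts.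
Proof.
  intros Hh1 HTc. assert (Hna0 : 0 < n / a) by (apply Rdiv_lt_0_compat; lra).
  destruct (gt_at_right hh T1 (-1)) as [e [He H]].
  { eexists. apply is_derive_hh. } { rewrite Hh1. unfold hs. lra. }
  assert (0 < Rmin (e / 2) ((Tc - T1) / 2)) by (apply Rmin_glb_lt; lra).
  Rmin_bounds (e / 2) ((Tc - T1) / 2).
  exists (T1 + Rmin (e / 2) ((Tc - T1) / 2)). split. lra.
  specialize (H (T1 + Rmin (e / 2) ((Tc - T1) / 2)) ltac:(lra)). lra.
Qed.

(** * The stable orbit of the saddle, by shooting between the nullclines *)

Section StableOrbit.
Variables T1 Ts : R.
Hypothesis Hs : T1 < Ts.
Hypothesis Hh1 : hh T1 = hs.
Hypothesis Hdh : forall T, T1 <= T <= Ts -> dh T < 0.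
Hypothesis Hsp : 0 < 1 + hh Ts.

Definition nullA z T := 1 + hh T - n * exp (- z).
Definition nullB z T := 1 + cb * hh T - cc * exp (- z).
(** Since [VZ = exp z nullA] and [VT = - exp z nullB], this is the closed region between the two
    nullclines to the right of the saddle, where neither coordinate increases along an orbit. *)
Definition wedge z T := T1 <= T <= Ts /\ nullA z T <= 0 /\ 0 <= nullB z T.

Lemma VZ_null z T : VZ z T = exp z * nullA z T.
Proof. unfold nullA, VZ. rewrite exp_Ropp. pose proof (exp_pos z). field. lra. Qed.

Lemma VT_null z T : VT z T = - exp z * nullB z T.
Proof. unfold nullB, VT. rewrite exp_Ropp. pose proof (exp_pos z). field. lra. Qed.

(** The right-hand side does not depend on [z] and is positive for [T] in [(T1, Ts]]. So the
    nullclines are apart there, and [nullA] and [nullB] cannot be small together, which is what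
    makes orbits move at a definite rate. *)
Lemma null_combination z T : n * nullB z T - cc * nullA z T = cb * (hs - hh T).
Proof. unfold nullA, nullB, cc, hs, cb. field. lra. Qed.

Lemma hh_decr s t : T1 <= s <= t -> t <= Ts -> hh t <= hh s.
Proof.
  intros Hst Ht. apply (deriv_nonpos_ge hh dh). lra. intros; apply is_derive_hh.
  intros x Hx. left. apply Hdh. lra.
Qed.

Lemma hh_decr_strict s t : T1 <= s < t -> t <= Ts -> hh t < hh s.
Proof.
  intros Hst Ht. destruct (deriv_MVT hh dh s t) as [c [Hc He]]. lra. intros; apply is_derive_hh.
  specialize (Hdh c ltac:(lra)). nra.
Qed.

Lemma wedge_exp z T : wedge z T -> (1 + hh Ts) / n <= exp (- z) <= / a.
Proof.
  intros [HT [HA HB]]. pose proof cc_gt. pose proof cb_bounds.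
  pose proof (hh_decr T Ts ltac:(lra) ltac:(lra)) as h1. pose proof (hh_decr T1 T ltac:(lra) ltac:(lra)) as h2.
  rewrite Hh1 in h2. unfold nullA in HA. unfold nullB in HB. split.
  - apply (Rmult_le_reg_l n); auto. replace (n * ((1 + hh Ts) / n)) with (1 + hh Ts) by (field; lra). lra.
  - pose proof hs_eq as E. apply (Rmult_le_reg_l cc). lra.
    assert (cc * / a = 1 + cb * hs) by (rewrite E; field; lra). nra.
Qed.

Lemma wedge_z z T : wedge z T -> ln a <= z <= - ln ((1 + hh Ts) / n).
Proof.
  intros Hw. destruct (wedge_exp z T Hw) as [h1 h2].
  apply ln_le in h1. 2: apply Rdiv_lt_0_compat; lra.
  apply ln_le in h2. 2: apply exp_pos. rewrite ln_exp in h1, h2. rewrite ln_Rinv in h2 by lra. lra.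
Qed.

Variables (L B r : R) (F G : R -> R -> R).
Hypothesis HL : 0 < L.
Hypothesis HF : lip2 L F.
Hypothesis HG : lip2 L G.
Hypothesis HFB : forall z w, Rabs (F z w) <= B.
Hypothesis HGB : forall z w, Rabs (G z w) <= B.
Hypothesis HFG : forall z w, Rabs z <= r -> Rabs w <= r -> F z w = VZ z w /\ G z w = VT z w.
Hypothesis Hr : forall z w, wedge z w -> Rabs z <= r /\ Rabs w <= r.

Definition flow (Z W : R -> R) t := is_derive Z t (F (Z t) (W t)) /\ is_derive W t (G (Z t) (W t)).

Lemma opp_lip2 H : lip2 L H -> lip2 L (fun z w => - H z w).
Proof.
  intros HH z w z' w'. replace (- H z w - - H z' w') with (- (H z w - H z' w')) by ring.
  rewrite Rabs_Ropp. apply HH.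
Qed.

Lemma flow_exists z0 w0 : exists Z W, Z 0 = z0 /\ W 0 = w0 /\ forall t, flow Z W t.
Proof. exact (ode_exists F G L B z0 w0 HL HF HG HFB HGB). Qed.

Section Backward.
Variables (Z W : R -> R).
Hypothesis HZ : forall t, is_derive Z t (- F (Z t) (W t)).
Hypothesis HW : forall t, is_derive W t (- G (Z t) (W t)).
Hypothesis HW0 : T1 < W 0 < Ts.
Hypothesis HA0 : nullA (Z 0) (W 0) < 0.
Hypothesis HB0 : 0 < nullB (Z 0) (W 0).

Let A t := nullA (Z t) (W t).
Let Bt t := nullB (Z t) (W t).

Lemma backward_derive t : wedge (Z t) (W t) ->
  is_derive W t (exp (Z t) * Bt t) /\
  is_derive A t (dh (W t) * (exp (Z t) * Bt t) - n * A t) /\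
  is_derive Bt t (cb * dh (W t) * (exp (Z t) * Bt t) - cc * A t) /\
  is_derive (fun t => exp (- Z t)) t (A t).
Proof.
  intros Hw. destruct (Hr _ _ Hw) as [r1 r2]. destruct (HFG _ _ r1 r2) as [e1 e2].
  specialize (HZ t). specialize (HW t). rewrite e1, VZ_null in HZ. rewrite e2, VT_null in HW.
  pose proof (exp_pos (Z t)) as Hp.
  assert (HW' : is_derive W t (exp (Z t) * Bt t)).
  { unfold Bt. replace (exp (Z t) * nullB (Z t) (W t)) with (- (- exp (Z t) * nullB (Z t) (W t))) by ring. exact HW. }
  assert (Hez : is_derive (fun t => exp (- Z t)) t (A t)).
  { auto_derive. eexists; eauto. rewrite (Derive_val _ _ _ HZ). fold (A t). rewrite exp_Ropp. field. lra. }
  pose proof (is_derive_hh (W t)) as Hhd.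
  split; [|split; [|split]]; auto.
  - apply (is_derive_ext (fun t => 1 + hh (W t) - n * exp (- Z t))). reflexivity.
    auto_derive. repeat split; eexists; eauto.
    rewrite (Derive_val _ _ _ HZ), (Derive_val _ _ _ HW'), (Derive_val _ _ _ Hhd). fold (A t).
    rewrite exp_Ropp. field. lra.
  - apply (is_derive_ext (fun t => 1 + cb * hh (W t) - cc * exp (- Z t))). reflexivity.
    auto_derive. repeat split; eexists; eauto.
    rewrite (Derive_val _ _ _ HZ), (Derive_val _ _ _ HW'), (Derive_val _ _ _ Hhd). fold (A t).
    rewrite exp_Ropp. field. lra.
Qed.

Lemma nulls_ex_derive t : ex_derive A t /\ ex_derive (fun t => - A t) t /\ ex_derive Bt t /\ ex_derive W t.
Proof.
  specialize (HZ t). specialize (HW t). pose proof (is_derive_hh (W t)) as Hhd.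
  assert (dA : ex_derive A t) by (unfold A, nullA; auto_derive; repeat split; eexists; eauto).
  repeat split; auto.
  - auto_derive. auto.
  - unfold Bt, nullB. auto_derive. repeat split; eexists; eauto.
  - eexists; eauto.
Qed.

(** Backwards in time the nullclines are not crossed from inside: [A exp (n t)] is nonincreasing
    because [dh < 0 <= Bt], and [Bt exp (K t)] is nondecreasing because [A <= 0] and [K] dominates
    [|cb dh exp Z|]. Only the side [T = Ts] is left as an exit. *)
Lemma backward_wedge t : 0 <= t -> (forall u, 0 <= u <= t -> W u <= Ts) ->
  A t < 0 /\ 0 < Bt t /\ T1 < W t.
Proof.
  pose proof cc_gt as Hcc. pose proof cb_bounds as Hcb.
  (* The premise on [W] is kept inside the induction predicate, so that the claim is vacuous once
     [W] has exceeded [Ts]. *)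
  revert t. apply (real_induction (fun t => (forall u, 0 <= u <= t -> W u <= Ts) ->
     A t < 0 /\ 0 < Bt t /\ T1 < W t)).
  - intros t Ht IH HWt. destruct (Req_dec t 0) as [->|Hne].
    { unfold A, Bt. repeat split; auto. lra. }
    assert (Hin : forall u, 0 <= u < t -> A u < 0 /\ 0 < Bt u /\ T1 < W u).
    { intros u Hu. apply IH; auto. intros v Hv. apply HWt. lra. }
    destruct (nulls_ex_derive t) as [_ [cA [cB cW]]].
    assert (Hwd : forall u, 0 <= u <= t -> wedge (Z u) (W u)).
    { intros u Hu. destruct (Rle_lt_or_eq_dec u t ltac:(lra)) as [Hut| ->].
      - destruct (Hin u ltac:(lra)) as [h1 [h2 h3]]. specialize (HWt u Hu). unfold A in h1. unfold Bt in h2.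
        split; [|split]; lra.
      - assert (0 <= - A t) by (apply (ge_at_left (fun t => - A t)); auto; [lra | intros v Hv; destruct (Hin v Hv); lra]).
        assert (0 <= Bt t) by (apply (ge_at_left Bt); auto; [lra | intros v Hv; left; now apply Hin]).
        assert (T1 <= W t) by (apply (ge_at_left W); auto; [lra | intros v Hv; left; now apply Hin]).
        specialize (HWt t ltac:(lra)). unfold A in H. unfold Bt in H0. split; [|split]; lra. }
    assert (HB0' : forall u, 0 <= u <= t -> 0 <= Bt u).
    { intros u Hu. apply (Hwd u Hu). }
    assert (HA0' : forall u, 0 <= u <= t -> A u <= 0).
    { intros u Hu. apply (Hwd u Hu). }
    assert (HWm : W 0 <= W t).
    { apply (deriv_nonneg_le W (fun u => exp (Z u) * Bt u)). lra.
      intros u Hu. apply backward_derive. auto.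
      intros u Hu. apply Rmult_le_pos. left; apply exp_pos. auto. }
    split; [|split]. 3: lra.
    + assert (He : A t * exp (n * t) <= A 0 * exp (n * 0)).
      { apply (deriv_nonpos_ge (fun u => A u * exp (n * u))
          (fun u => dh (W u) * (exp (Z u) * Bt u) * exp (n * u))). lra.
        - intros u Hu. destruct (backward_derive u (Hwd u Hu)) as [_ [d _]].
          derive_with d.
        - intros u Hu. specialize (Hdh (W u) (proj1 (Hwd u Hu))). specialize (HB0' u Hu).
          pose proof (exp_pos (Z u)). pose proof (exp_pos (n * u)).
          assert (0 <= exp (Z u) * Bt u * exp (n * u)) by (repeat apply Rmult_le_pos; lra). nra. }
      rewrite Rmult_0_r, exp_0 in He. unfold A in He at 2. pose proof (exp_pos (n * t)). nra.
    + destruct (continuous_bounded (fun u => cb * dh (W u) * exp (Z u)) 0 t) as [K [HK HK']]; auto.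
      { intros x _. apply (ex_derive_continuous (fun u => cb * dh (W u) * exp (Z u))).
        specialize (HZ x). specialize (HW x). unfold dh. auto_derive. repeat split; eexists; eauto. }
      assert (He : Bt 0 * exp (K * 0) <= Bt t * exp (K * t)).
      { apply (deriv_nonneg_le (fun u => Bt u * exp (K * u))
          (fun u => ((cb * dh (W u) * exp (Z u) + K) * Bt u - cc * A u) * exp (K * u))). lra.
        - intros u Hu. destruct (backward_derive u (Hwd u Hu)) as [_ [_ [d _]]].
          derive_with d.
        - intros u Hu. specialize (HB0' u Hu). specialize (HA0' u Hu). specialize (HK' u Hu).
          apply Rabs_le_between in HK'. apply Rmult_le_pos; [|left; apply exp_pos].
          assert (0 <= (cb * dh (W u) * exp (Z u) + K) * Bt u) by (apply Rmult_le_pos; lra). nra. }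
      rewrite Rmult_0_r, exp_0 in He. unfold Bt in He at 1. pose proof (exp_pos (K * t)). nra.
  - intros t Ht IH. destruct (nulls_ex_derive t) as [_ [cA [cB cW]]].
    assert (HX : (forall u, 0 <= u <= t -> W u <= Ts) \/ exists u, 0 <= u <= t /\ Ts < W u).
    { apply NNPP. intros Hn'. apply not_or_and in Hn'. destruct Hn' as [N1 N2]. apply N1.
      intros u Hu. apply Rnot_lt_le. intros Hlt. apply N2. eauto. }
    destruct HX as [HX|[u [Hu Hlt]]].
    2: { exists 1. split. lra. intros s Hs' HWs. specialize (HWs u ltac:(lra)). lra. }
    destruct (IH t ltac:(lra) HX) as [h1 [h2 h3]].
    destruct (gt_at_right (fun t => - A t) t 0 cA ltac:(lra)) as [e1 [He1 He1']].
    destruct (gt_at_right Bt t 0 cB h2) as [e2 [He2 He2']].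
    destruct (gt_at_right W t T1 cW h3) as [e3 [He3 He3']].
    exists (Rmin e1 (Rmin e2 e3)). split. repeat apply Rmin_glb_lt; auto. intros s Hs' _.
    Rmin_bounds e1 (Rmin e2 e3).
    Rmin_bounds e2 e3.
    specialize (He1' s ltac:(lra)). specialize (He2' s ltac:(lra)). specialize (He3' s ltac:(lra)). lra.
Qed.

Lemma backward_in_wedge t : (forall u, 0 <= u <= t -> W u <= Ts) ->
  forall u, 0 <= u <= t -> wedge (Z u) (W u) /\ W 0 <= W u.
Proof.
  intros HWt.
  assert (H : forall u, 0 <= u <= t -> wedge (Z u) (W u)).
  { intros u Hu. destruct (backward_wedge u) as [h1 [h2 h3]]. lra. intros; apply HWt; lra.
    specialize (HWt u Hu). unfold A in h1. unfold Bt in h2. split; [|split]; lra. }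
  intros u Hu. split; auto.
  apply (deriv_nonneg_le W (fun u => exp (Z u) * Bt u)). lra.
  - intros v Hv. apply backward_derive. apply H. lra.
  - intros v Hv. apply Rmult_le_pos. left; apply exp_pos. apply (H v). lra.
Qed.

(* [n / (a cc) W - exp (- Z)] grows at least linearly as long as the orbit stays in the wedge. *)
Lemma backward_exit : exists s, 0 <= s /\ W s = Ts /\ forall u, 0 <= u <= s -> wedge (Z u) (W u).
Proof.
  pose proof cc_gt as Hcc. pose proof cb_bounds as Hcb.
  assert (Hex : exists s, 0 <= s /\ Ts < W s).
  { apply NNPP. intros Hnex.
    assert (Hall : forall u, 0 <= u -> W u <= Ts).
    { intros u Hu. apply Rnot_lt_le. intros Hlt. apply Hnex. eauto. }
    assert (Hw : forall u, 0 <= u -> wedge (Z u) (W u) /\ W 0 <= W u).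
    { intros u Hu. apply (backward_in_wedge u). intros; apply Hall; lra. lra. }
    set (k := n / (a * cc)). assert (Hk : 0 < k) by (apply Rdiv_lt_0_compat; auto; apply Rmult_lt_0_compat; lra).
    set (dl := cb * (hs - hh (W 0)) / cc).
    assert (Hdl : 0 < dl).
    { apply Rdiv_lt_0_compat; [|lra]. apply Rmult_lt_0_compat. lra.
      rewrite <- Hh1. pose proof (hh_decr_strict T1 (W 0) ltac:(lra) ltac:(lra)). lra. }
    assert (Hgrow : forall t, 0 <= t -> k * W 0 - exp (- Z 0) - dl * 0 <= k * W t - exp (- Z t) - dl * t).
    { intros t Ht. apply (deriv_nonneg_le (fun t => k * W t - exp (- Z t) - dl * t)
        (fun t => k * (exp (Z t) * Bt t) - A t - dl)); auto.
      - intros u Hu. destruct (backward_derive u) as [d1 [_ [_ d2]]]. apply Hw; lra.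
        auto_derive. repeat split; [eexists; eauto | eexists; apply HZ].
        rewrite (Derive_val _ _ _ d1).
        assert (E : Derive (fun t => exp (- Z t)) u = A u) by (apply Derive_val; auto).
        rewrite (Derive_val _ _ _ (HZ u)).
        assert (E' : Derive (fun t => exp (- Z t)) u = - - F (Z u) (W u) * exp (- Z u)).
        { apply Derive_val. derive_with (HZ u). }
        rewrite E in E'. rewrite E'. ring.
      - intros u Hu. destruct (Hw u) as [Hwu HWu]. lra.
        destruct (wedge_exp _ _ Hwu) as [_ he]. pose proof (null_combination (Z u) (W u)) as E.
        destruct Hwu as [hT [hA hB]]. fold (A u) in *. fold (Bt u) in *.
        assert (a <= exp (Z u)).
        { rewrite exp_Ropp in he. apply Rinv_le_contravar in he. rewrite !Rinv_inv in he. exact he.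
          apply Rinv_0_lt_compat, exp_pos. }
        assert (h1 : n * Bt u <= k * cc * (exp (Z u) * Bt u)).
        { replace (k * cc) with (n / a) by (unfold k; field; lra).
          replace (n * Bt u) with (n / a * (a * Bt u)) by (field; lra).
          apply Rmult_le_compat_l. left. apply Rdiv_lt_0_compat; lra. apply Rmult_le_compat_r; auto. }
        assert (h2 : cb * (hs - hh (W 0)) <= cb * (hs - hh (W u))).
        { apply Rmult_le_compat_l. lra. pose proof (hh_decr (W 0) (W u) ltac:(lra) ltac:(lra)). lra. }
        unfold dl. apply (Rmult_le_reg_l cc). lra.
        replace (cc * (k * (exp (Z u) * Bt u) - A u - cb * (hs - hh (W 0)) / cc))
          with (k * cc * (exp (Z u) * Bt u) - cc * A u - cb * (hs - hh (W 0))) by (field; lra). lra. }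
    set (t := (k * Ts - k * W 0 + exp (- Z 0)) / dl).
    assert (Hnum : 0 < k * Ts - k * W 0 + exp (- Z 0)).
    { pose proof (exp_pos (- Z 0)). assert (k * W 0 < k * Ts) by (apply Rmult_lt_compat_l; lra). lra. }
    assert (Ht : 0 <= t) by (left; apply Rdiv_lt_0_compat; auto).
    specialize (Hgrow t Ht). replace (dl * t) with (k * Ts - k * W 0 + exp (- Z 0)) in Hgrow by (unfold t; field; lra).
    specialize (Hall t Ht). assert (k * W t <= k * Ts) by (apply Rmult_le_compat_l; lra).
    pose proof (exp_pos (- Z t)). lra. }
  destruct Hex as [s [Hs0 Hs1]].
  destruct (first_hit W s Ts) as [u [Hu [Hu1 Hu2]]]; try lra.
  { intros x _. apply nulls_ex_derive. }
  exists u. split; auto. split; auto. intros v Hv. apply (backward_in_wedge u); auto.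
Qed.
End Backward.

Lemma wedge_P1 : wedge (ln a) T1.
Proof.
  pose proof hs_eq as E. pose proof cc_gt.
  unfold wedge, nullA, nullB. rewrite exp_Ropp, exp_ln, Hh1 by lra. split; [|split]. lra.
  - right. unfold hs. field. lra.
  - right. assert (cc * / a = 1 + cb * hs) by (rewrite E; field; lra). lra.
Qed.

Lemma flow_P1 : F (ln a) T1 = 0 /\ G (ln a) T1 = 0.
Proof.
  destruct (Hr _ _ wedge_P1) as [r1 r2]. destruct (HFG _ _ r1 r2) as [-> ->].
  pose proof hs_eq as E.
  unfold VZ, VT. rewrite exp_ln, Hh1 by lra. rewrite E. unfold hs. split; field; lra.
Qed.

(** An orbit started inside the wedge close to the saddle and run backwards leaves through [T = Ts],
    and by Gronwall this takes long if the start is close enough. Reversing time gives an orbit from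
    [T = Ts] that remains in the wedge for the time [S]. *)
Lemma wedge_finite_time S : 0 <= S -> exists Z W, W 0 = Ts /\
  forall u, 0 <= u <= S -> flow Z W u /\ wedge (Z u) (W u).
Proof.
  intros HS. pose proof cc_gt as Hcc. pose proof cb_bounds as Hcb.
  (* Midpoint of the two nullclines in the variable [exp (- z)]; [phi] is the squared distance from
     the resulting point to the saddle. *)
  set (mid := fun T => ((1 + hh T) / n + (1 + cb * hh T) / cc) / 2).
  set (ze := fun T => - ln (mid T)).
  assert (Hmid1 : mid T1 = / a).
  { unfold mid. pose proof hs_eq as E. rewrite Hh1.
    replace (1 + cb * hs) with (cc / a) by (rewrite E; field; lra). unfold hs. field. lra. }
  set (phi := fun T => (ze T - ln a) ^ 2 + (T - T1) ^ 2).
  assert (Hphi : phi T1 = 0).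
  { unfold phi, ze. rewrite Hmid1, ln_Rinv by lra. ring. }
  assert (Hc : continuous phi T1).
  { apply (ex_derive_continuous phi). unfold phi, ze, mid. pose proof (is_derive_hh T1).
    auto_derive. repeat split; try (eexists; eauto).
    change (0 < mid T1). rewrite Hmid1. apply Rinv_0_lt_compat. lra. }
  assert (Heps : 0 < (Ts - T1) ^ 2 * exp (- (4 * L * S))).
  { apply Rmult_lt_0_compat. apply pow_lt. lra. apply exp_pos. }
  destruct (continuous_eps phi T1 Hc _ Heps) as [d [Hd Hd']].
  set (Te := T1 + Rmin (d / 2) ((Ts - T1) / 2)).
  assert (HTe : T1 < Te < Ts /\ Te < T1 + d).
  { unfold Te. assert (0 < Rmin (d / 2) ((Ts - T1) / 2)) by (apply Rmin_glb_lt; lra).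
    Rmin_bounds (d / 2) ((Ts - T1) / 2). lra. }
  specialize (Hd' Te). rewrite Rabs_right in Hd' by lra. specialize (Hd' ltac:(lra)).
  rewrite Hphi, Rminus_0_r in Hd'. pose proof (Rle_abs (phi Te)) as Habs.
  destruct (ode_exists (fun z w => - F z w) (fun z w => - G z w) L B (ze Te) Te HL (opp_lip2 F HF) (opp_lip2 G HG))
    as [Z [W [HZ0 [HW0 Hode]]]].
  { intros. rewrite Rabs_Ropp. apply HFB. } { intros. rewrite Rabs_Ropp. apply HGB. }
  pose proof (hh_decr_strict T1 Te ltac:(lra) ltac:(lra)) as Hlt1. rewrite Hh1 in Hlt1.
  pose proof (hh_decr Te Ts ltac:(lra) ltac:(lra)) as Hlt2.
  assert (Hgap : 0 < cb * (hs - hh Te)) by (apply Rmult_lt_0_compat; lra).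
  pose proof (null_combination 0 Te) as En. unfold nullA, nullB in En.
  assert (Hm1 : 0 < (1 + hh Te) / n) by (apply Rdiv_lt_0_compat; lra).
  assert (Hdiff : (1 + cb * hh Te) / cc = (1 + hh Te) / n + cb * (hs - hh Te) / (n * cc)).
  { rewrite <- En. field. lra. }
  assert (Hgap' : 0 < cb * (hs - hh Te) / (n * cc)).
  { apply Rdiv_lt_0_compat; auto. apply Rmult_lt_0_compat; lra. }
  assert (Eze : exp (- ze Te) = mid Te).
  { unfold ze. rewrite Ropp_involutive, exp_ln; auto. unfold mid. lra. }
  destruct (backward_exit Z W) as [s [Hs0 [Hs1 Hs2]]]; try (intros t; apply (Hode t)).
  { rewrite HW0. lra. }
  { rewrite HZ0, HW0. unfold nullA. rewrite Eze. unfold mid.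
    apply (Rmult_lt_reg_r (/ n)). now apply Rinv_0_lt_compat.
    replace ((1 + hh Te - n * (((1 + hh Te) / n + (1 + cb * hh Te) / cc) / 2)) * / n)
      with (((1 + hh Te) / n - (1 + cb * hh Te) / cc) / 2) by (field; lra). lra. }
  { rewrite HZ0, HW0. unfold nullB. rewrite Eze. unfold mid.
    apply (Rmult_lt_reg_r (/ cc)). apply Rinv_0_lt_compat; lra.
    replace ((1 + cb * hh Te - cc * (((1 + hh Te) / n + (1 + cb * hh Te) / cc) / 2)) * / cc)
      with (((1 + cb * hh Te) / cc - (1 + hh Te) / n) / 2) by (field; lra). lra. }
  (* Comparison with the constant orbit at the saddle: the squared distance has to grow from
     [phi Te] to at least [(Ts - T1)^2]. *)
  assert (HsS : S < s).
  { destruct (gronwall L (fun z w => - F z w) (fun z w => - G z w) Z W (fun _ => ln a) (fun _ => T1) 0 s)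
      as [g _]; try lra; auto using opp_lip2.
    { intros x _. destruct flow_P1 as [-> ->]. rewrite Ropp_0.
      split; apply (is_derive_const (V := R_NormedModule)). }
    rewrite HZ0, HW0, Hs1 in g. fold (phi Te) in g. rewrite Rminus_0_r in g.
    apply Rnot_le_lt. intros Hle.
    assert (He : exp (4 * L * s) <= exp (4 * L * S)) by (apply exp_le; nra).
    pose proof (pow2_ge_0 (Z s - ln a)).
    assert (Hlt : phi Te * exp (4 * L * s) < (Ts - T1) ^ 2 * exp (- (4 * L * S)) * exp (4 * L * S)).
    { apply Rle_lt_trans with (phi Te * exp (4 * L * S)).
      - apply Rmult_le_compat_l; auto. unfold phi. pose proof (pow2_ge_0 (ze Te - ln a)).
        pose proof (pow2_ge_0 (Te - T1)). lra.
      - apply Rmult_lt_compat_r. apply exp_pos. lra. }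
    assert (E1 : exp (- (4 * L * S)) * exp (4 * L * S) = 1).
    { rewrite <- exp_plus, <- exp_0. f_equal. ring. }
    rewrite (Rmult_assoc ((Ts - T1) ^ 2)), E1 in Hlt. lra. }
  exists (fun u => Z (s - u)), (fun u => W (s - u)). rewrite Rminus_0_r. split; auto.
  intros u Hu. split; [|apply Hs2; lra].
  destruct (Hode (s - u)) as [d1 d2]. split.
  - auto_derive. eexists; eauto. change (s + - u) with (s - u). rewrite (Derive_val _ _ _ d1). ring.
  - auto_derive. eexists; eauto. change (s + - u) with (s - u). rewrite (Derive_val _ _ _ d2). ring.
Qed.

(** A compactness argument on the initial height: the sets [CS S] of heights on [T = Ts] whose orbit
    stays in the wedge up to time [S] are nonempty, bounded and decreasing in [S]. A common limit
    point starts an orbit that stays for all time, by Gronwall and closedness of the wedge. *)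
Lemma stable_orbit_exists : exists Z W, W 0 = Ts /\ (forall t, flow Z W t) /\
  forall t, 0 <= t -> wedge (Z t) (W t).
Proof.
  set (CS := fun S z => exists Z W, Z 0 = z /\ W 0 = Ts /\
     forall u, 0 <= u <= S -> flow Z W u /\ wedge (Z u) (W u)).
  (* The supremum [zs] of this set is the limit of the infima of [CS S] as [S] grows, hence a limit
     of points of every [CS S]. *)
  set (E := fun x => exists S, 0 <= S /\ forall z, CS S z -> x <= z).
  set (zm := - ln ((1 + hh Ts) / n)).
  assert (HCb : forall S z, 0 <= S -> CS S z -> ln a <= z <= zm).
  { intros S z HS [Z [W [HZ [HW H]]]]. rewrite <- HZ. apply (wedge_z _ (W 0)). apply H. lra. }
  assert (HCne : forall S, 0 <= S -> exists z, CS S z).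
  { intros S HS. destruct (wedge_finite_time S HS) as [Z [W [HW H]]]. exists (Z 0), Z, W. auto. }
  assert (HCm : forall S S' z, S <= S' -> CS S' z -> CS S z).
  { intros S S' z HSS [Z [W [HZ [HW H]]]]. exists Z, W. repeat split; auto; apply H; lra. }
  destruct (completeness E) as [zs [Hz1 Hz2]].
  { exists zm. intros x [S [HS Hx]]. destruct (HCne S HS) as [z Hz].
    specialize (Hx z Hz). destruct (HCb S z HS Hz). lra. }
  { exists (ln a), 0. split. lra. intros z Hz. apply (HCb 0); auto. lra. }
  assert (Hnear : forall S e, 0 <= S -> 0 < e -> exists z, CS S z /\ Rabs (zs - z) < e).
  { intros S e HS He.
    assert (H1 : exists S1, 0 <= S1 /\ forall z, CS S1 z -> zs - e < z).
    { apply NNPP. intros Hn1. assert (zs <= zs - e); [|lra]. apply Hz2. intros x [S1 [HS1 Hx]].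
      apply Rnot_lt_le. intros Hlt. apply Hn1. exists S1. split; auto. intros z Hz. specialize (Hx z Hz). lra. }
    destruct H1 as [S1 [HS1 H1]]. set (S2 := Rmax S S1). Rmax_bounds S S1.
    assert (H2 : exists z, CS S2 z /\ z < zs + e).
    { apply NNPP. intros Hn2. assert (zs + e <= zs); [|lra]. apply Hz1. exists S2. split. unfold S2; lra.
      intros z Hz. apply Rnot_lt_le. intros Hlt. apply Hn2. eauto. }
    destruct H2 as [z [Hz Hze]]. exists z. split. apply (HCm S S2); auto.
    specialize (H1 z (HCm S1 S2 z ltac:(auto) Hz)). apply Rabs_def1; lra. }
  destruct (flow_exists zs Ts) as [Z [W [HZ [HW Hf]]]].
  exists Z, W. split; auto. split; auto. intros t Ht.
  assert (Hcl : forall e, 0 < e -> exists z w, wedge z w /\ Rabs (z - Z t) < e /\ Rabs (w - W t) < e).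
  { intros e He.
    destruct (Hnear t (e * exp (- (2 * L * t))) Ht) as [z [[Z' [W' [HZ' [HW' H']]]] Hz]].
    { apply Rmult_lt_0_compat; auto. apply exp_pos. }
    exists (Z' t), (W' t). split. apply H'; lra.
    destruct (gronwall L F G Z' W' Z W 0 t) as [g _]; auto; try lra.
    { intros x Hx. now apply H'. } { intros x _. apply Hf. }
    rewrite HZ', HW', HZ, HW, Rminus_0_r, Rminus_diag in g.
    assert (Hsq : (z - zs) ^ 2 < (e * exp (- (2 * L * t))) ^ 2).
    { rewrite <- (pow2_abs (z - zs)), Rabs_minus_sym.
      pose proof (Rabs_pos (zs - z)). nra. }
    assert (Hg : (Z' t - Z t) ^ 2 + (W' t - W t) ^ 2 < e ^ 2).
    { eapply Rle_lt_trans. apply g.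
      replace (e ^ 2) with ((e * exp (- (2 * L * t))) ^ 2 * exp (4 * L * t)).
      - apply Rmult_lt_compat_r. apply exp_pos. lra.
      - replace (4 * L * t) with (2 * L * t + 2 * L * t) by ring. rewrite exp_plus, exp_Ropp.
        pose proof (exp_pos (2 * L * t)). field. lra. }
    pose proof (pow2_ge_0 (Z' t - Z t)). pose proof (pow2_ge_0 (W' t - W t)).
    split; apply Rabs_def1; nra. }
  (* Every inequality defining the wedge has the separated form [f z + g w <= c] with [f] and [g]
     continuous, so it passes to the limit. *)
  assert (Hclose : forall f g c, continuous f (Z t) -> continuous g (W t) ->
    (forall z w, wedge z w -> f z + g w <= c) -> f (Z t) + g (W t) <= c).
  { intros f g c Cf Cg Hfg. apply Rnot_lt_le. intros Hlt.
    set (e := (f (Z t) + g (W t) - c) / 2). assert (He : 0 < e) by (unfold e; lra).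
    destruct (continuous_eps f _ Cf e He) as [d1 [Hd1 D1]].
    destruct (continuous_eps g _ Cg e He) as [d2 [Hd2 D2]].
    destruct (Hcl (Rmin d1 d2)) as [z [w [Hw [Hz1' Hw1]]]]. apply Rmin_glb_lt; auto.
    Rmin_bounds d1 d2.
    specialize (D1 z ltac:(lra)). specialize (D2 w ltac:(lra)). specialize (Hfg z w Hw).
    revert D1 D2. unfold Rabs. repeat destruct Rcase_abs; unfold e; lra. }
  assert (Ch : forall x, continuous hh x).
  { intros x. apply (ex_derive_continuous hh). eexists. apply is_derive_hh. }
  assert (Cl : forall (k c x : R), continuous (fun y => c + k * y) x).
  { intros k c x. apply (ex_derive_continuous (fun y => c + k * y)). auto_derive. auto. }
  assert (Ce : forall k x, continuous (fun z => k * exp (- z)) x).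
  { intros k x. apply (ex_derive_continuous (fun z => k * exp (- z))). auto_derive. auto. }
  assert (Chk : forall k c x, continuous (fun y => c + k * hh y) x).
  { intros k c x. apply (continuous_comp hh (fun y => c + k * y)); auto. }
  pose proof (Hclose (fun _ => 0) (fun w => 0 + (-1) * w) (- T1) (continuous_const _ _) (Cl _ _ _)
    ltac:(intros z w [h _]; lra)) as c1.
  pose proof (Hclose (fun _ => 0) (fun w => 0 + 1 * w) Ts (continuous_const _ _) (Cl _ _ _)
    ltac:(intros z w [h _]; lra)) as c2.
  pose proof (Hclose (fun z => - n * exp (- z)) (fun w => 1 + 1 * hh w) 0 (Ce _ _) (Chk _ _ _)
    ltac:(intros z w [_ [h _]]; unfold nullA in h; lra)) as c3.
  pose proof (Hclose (fun z => cc * exp (- z)) (fun w => - 1 + - cb * hh w) 0 (Ce _ _) (Chk _ _ _)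
    ltac:(intros z w [_ [_ h]]; unfold nullB in h; lra)) as c4.
  simpl in *. unfold wedge, nullA, nullB. split; [|split]; lra.
Qed.

(** [W] decreases to some [l]. If [l > T1], then by [null_combination] the bounded quantity
    [k W - exp (- Z)] decreases at least at the rate [dl > 0], which is impossible. With [l = T1],
    [exp (- Z)] is squeezed between [(1 + hh W) / n] and [/ a]. *)
Lemma wedge_converges Z W : (forall t, 0 <= t -> orbit Z W t) ->
  (forall t, 0 <= t -> wedge (Z t) (W t)) -> tends_to Z (ln a) /\ tends_to W T1.
Proof.
  intros Ho Hw. pose proof cc_gt as Hcc. pose proof cb_bounds as Hcb.
  assert (Hez : forall t, 0 <= t -> exp (- Z t) <= / a).
  { intros t Ht. apply (wedge_exp _ _ (Hw t Ht)). }
  assert (Hae : forall t, 0 <= t -> a <= exp (Z t)).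
  { intros t Ht. specialize (Hez t Ht). rewrite exp_Ropp in Hez.
    apply Rinv_le_contravar in Hez. rewrite !Rinv_inv in Hez. exact Hez. apply Rinv_0_lt_compat, exp_pos. }
  assert (HWm : forall s t, 0 <= s <= t -> W t <= W s).
  { intros s t Hst. apply (deriv_nonpos_ge W (fun t => VT (Z t) (W t))). lra. intros; apply Ho; lra.
    intros x Hx. rewrite VT_null. destruct (Hw x ltac:(lra)) as [_ [_ h]]. pose proof (exp_pos (Z x)).
    assert (0 <= exp (Z x) * nullB (Z x) (W x)) by (apply Rmult_le_pos; lra). lra. }
  destruct (decr_tends W 0 T1 HWm) as [l [Hl [Hlb Hl1]]].
  { intros t Ht. apply (Hw t Ht). }
  assert (HWl : tends_to W T1).
  { destruct (Rle_lt_or_eq_dec T1 l Hl1) as [Hlt| ->]; auto. exfalso.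
    assert (HlTs : l <= Ts). { pose proof (Hlb 0 ltac:(lra)). destruct (Hw 0 ltac:(lra)) as [h _]. lra. }
    set (k := n / (a * cc)). assert (Hk : 0 < k) by (apply Rdiv_lt_0_compat; auto; apply Rmult_lt_0_compat; lra).
    set (dl := cb * (hs - hh l) / cc).
    assert (Hdl : 0 < dl).
    { apply Rdiv_lt_0_compat; [|lra]. apply Rmult_lt_0_compat. lra.
      rewrite <- Hh1. pose proof (hh_decr_strict T1 l ltac:(lra) ltac:(lra)). lra. }
    assert (Hdec : forall t, 0 <= t -> k * W t - exp (- Z t) + dl * t <= k * W 0 - exp (- Z 0) + dl * 0).
    { intros t Ht. apply (deriv_nonpos_ge (fun t => k * W t - exp (- Z t) + dl * t)
        (fun t => - (k * (exp (Z t) * nullB (Z t) (W t)) - nullA (Z t) (W t) - dl))); auto.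
      - intros u Hu. destruct (Ho u ltac:(lra)) as [d1 d2]. rewrite VZ_null in d1. rewrite VT_null in d2.
        auto_derive. repeat split; eexists; eauto. rewrite (Derive_val _ _ _ d1), (Derive_val _ _ _ d2).
        rewrite exp_Ropp. pose proof (exp_pos (Z u)). field. lra.
      - intros u Hu. specialize (Hw u ltac:(lra)). specialize (Hae u ltac:(lra)). specialize (Hlb u ltac:(lra)).
        pose proof (null_combination (Z u) (W u)) as E. destruct Hw as [hT [hA hB]].
        set (A := nullA (Z u) (W u)) in *. set (Bt := nullB (Z u) (W u)) in *.
        assert (h1 : n * Bt <= k * cc * (exp (Z u) * Bt)).
        { replace (k * cc) with (n / a) by (unfold k; field; lra).
          replace (n * Bt) with (n / a * (a * Bt)) by (field; lra).
          apply Rmult_le_compat_l. left. apply Rdiv_lt_0_compat; lra. apply Rmult_le_compat_r; auto. }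
        assert (h2 : cb * (hs - hh l) <= cb * (hs - hh (W u))).
        { apply Rmult_le_compat_l. lra. pose proof (hh_decr l (W u) ltac:(lra) ltac:(lra)). lra. }
        assert (0 <= k * (exp (Z u) * Bt) - A - dl); [|lra].
        unfold dl. apply (Rmult_le_reg_l cc). lra.
        replace (cc * (k * (exp (Z u) * Bt) - A - cb * (hs - hh l) / cc))
          with (k * cc * (exp (Z u) * Bt) - cc * A - cb * (hs - hh l)) by (field; lra). lra. }
    set (t := (k * W 0 - k * T1 + / a) / dl).
    assert (Hnum : 0 < k * W 0 - k * T1 + / a).
    { assert (0 < / a) by (apply Rinv_0_lt_compat; lra). pose proof (Hlb 0 ltac:(lra)).
      assert (k * T1 < k * W 0) by (apply Rmult_lt_compat_l; lra). lra. }
    assert (Ht : 0 <= t) by (left; apply Rdiv_lt_0_compat; auto).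
    specialize (Hdec t Ht). replace (dl * t) with (k * W 0 - k * T1 + / a) in Hdec by (unfold t; field; lra).
    pose proof (exp_pos (- Z 0)). specialize (Hez t Ht). specialize (Hlb t Ht).
    assert (k * T1 < k * W t) by (apply Rmult_lt_compat_l; lra). lra. }
  split; auto.
  assert (Hlow : tends_to (fun t => (1 + hh (W t)) / n) (/ a)).
  { replace (/ a) with ((1 + hh T1) / n) by (rewrite Hh1; unfold hs; field; lra).
    apply (tends_to_comp (fun T => (1 + hh T) / n)); auto.
    pose proof (is_derive_hh T1).
    auto_derive. eexists; eauto. }
  assert (Hlim : tends_to (fun t => exp (- Z t)) (/ a)).
  { intros e He. destruct (Hlow e He) as [t0 H]. exists (Rmax 0 t0). intros t Ht.
    Rmax_bounds 0 t0. specialize (H t ltac:(lra)).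
    specialize (Hez t ltac:(lra)). destruct (Hw t ltac:(lra)) as [_ [hA _]]. unfold nullA in hA.
    assert ((1 + hh (W t)) / n <= exp (- Z t)).
    { apply (Rmult_le_reg_l n); auto. replace (n * ((1 + hh (W t)) / n)) with (1 + hh (W t)) by (field; lra). lra. }
    rewrite Rabs_left1 by lra. revert H. unfold Rabs. destruct Rcase_abs; lra. }
  apply (tends_to_ext (fun t => - ln (exp (- Z t))) _ _ 0).
  { intros t _. rewrite ln_exp. ring. }
  replace (ln a) with (- ln (/ a)) by (rewrite ln_Rinv by lra; ring).
  apply (tends_to_comp (fun x => - ln x)); auto.
  auto_derive. apply Rinv_0_lt_compat. lra.
Qed.
End StableOrbit.

(** * The heteroclinic orbit from the fixed point at [T2] to the saddle *)

Section Heteroclinic.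
Variables T1 T2 T0 : R.
Hypothesis HT12 : T1 < T2.
Hypothesis Hh1 : hh T1 = hs.
Hypothesis Hh2 : hh T2 = hs.
Hypothesis Hq0 : forall T, 0 <= dulac T.
Hypothesis Hq : forall T, T <> T0 -> 0 < dulac T.

Local Notation dulac_int := (dulac_int T2).
Local Notation lyapunov := (lyapunov T2).

(** Both factors are negative on [(T1, T2)] and positive beyond [T2]. This is why the primitive of
    [dulac] is normalized at [T2]. *)
Lemma dulac_int_hh_nonneg T : T1 <= T -> 0 <= (hh T - hs) * dulac_int T /\ (T1 < T -> T <> T2 -> 0 < (hh T - hs) * dulac_int T).
Proof.
  intros HT. destruct (hh_shape T1 T2 HT12 Hh1 Hh2) as [Tc [_ [_ [Hneg Hpos]]]].
  assert (Hinc := dulac_int_increasing T2 T0 Hq0 Hq).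
  assert (HK2 : dulac_int T2 = 0) by apply dulac_int_T2.
  destruct (Rtotal_order T T2) as [Hlt|[->|Hgt]].
  - pose proof (Hinc _ _ Hlt) as HK. destruct HT as [HT|HT].
    + specialize (Hneg T ltac:(lra)). assert (0 < (hs - hh T) * (- dulac_int T)) by (apply Rmult_lt_0_compat; lra).
      split; intros; lra.
    + subst T. rewrite Hh1. split; intros; lra.
  - rewrite HK2. split; intros; lra.
  - pose proof (Hinc _ _ Hgt) as HK. specialize (Hpos T ltac:(lra)).
    assert (0 < (hh T - hs) * dulac_int T) by (apply Rmult_lt_0_compat; lra). split; intros; lra.
Qed.

Lemma lyapunov_ex_derive Z T t : ex_derive Z t -> ex_derive T t -> ex_derive (fun t => lyapunov (Z t) (T t)) t.
Proof.
  intros HZ HT. pose proof (F0_derive T2 (T t)) as HF.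
  unfold lyapunov. auto_derive. repeat split; auto. eexists; eauto.
Qed.

Lemma lyapunov_tends Z T z w : tends_to Z z -> tends_to T w -> tends_to (fun t => lyapunov (Z t) (T t)) (lyapunov z w).
Proof.
  intros HZ HT. pose proof nu_gt as Hnu. unfold lyapunov.
  assert (HE : tends_to (fun t => cc * exp (- Z t) * exp (- (cg * T t)) / (nu - 1))
     (cc * exp (- z) * exp (- (cg * w)) / (nu - 1))).
  { apply (tends_to_ext (fun t => (cc * exp (- Z t)) * (exp (- (cg * T t)) / (nu - 1))) _ _ 0).
    intros; field; lra.
    replace (cc * exp (- z) * exp (- (cg * w)) / (nu - 1)) with ((cc * exp (- z)) * (exp (- (cg * w)) / (nu - 1))) by (field; lra).
    apply tends_to_mult.
    - apply (tends_to_comp (fun z => cc * exp (- z))); auto.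
      auto_derive. auto.
    - apply (tends_to_comp (fun w => exp (- (cg * w)) / (nu - 1))); auto.
      auto_derive. auto. }
  apply tends_to_mult.
  - apply (tends_to_comp exp (fun t => nu * (Z t + cg * T t))).
    + apply (tends_to_comp (fun x => nu * x) (fun t => Z t + cg * T t)).
      apply tends_to_plus; auto. apply (tends_to_comp (fun x => cg * x)); auto.
      auto_derive. auto.
      auto_derive. auto.
    + auto_derive. auto.
  - apply tends_to_plus.
    + apply (tends_to_comp (fun x => F0 T2 x / nu)); auto.
      pose proof (F0_derive T2 w) as HF. auto_derive. eexists; eauto.
    + apply tends_to_opp. exact HE.
Qed.

(** Crude bounds on a box, supplying the dissipation rate and the lower bound that [lasalle]
    requires. *)
Lemma exp_box x y r : Rabs x <= r -> Rabs y <= r ->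
  exp (- ((nu * (1 + cg) + 1) * r)) <= exp (nu * (x + cg * y)) * exp x /\
  exp (nu * (x + cg * y)) * exp (- x) * exp (- (cg * y)) <= exp ((nu * (1 + cg) + 2) * r).
Proof.
  intros Hx Hy. pose proof nu_gt as Hnu. pose proof cg_bounds as Hg.
  apply Rabs_le_between in Hx. apply Rabs_le_between in Hy.
  assert (- (cg * r) <= cg * y <= cg * r).
  { split. replace (- (cg * r)) with (cg * (- r)) by ring. apply Rmult_le_compat_l; lra.
    apply Rmult_le_compat_l; lra. }
  assert (cg * r <= r). { rewrite <- (Rmult_1_l r) at 2. apply Rmult_le_compat_r; lra. }
  assert (- (nu * (r + cg * r)) <= nu * (x + cg * y) <= nu * (r + cg * r)).
  { split. replace (- (nu * (r + cg * r))) with (nu * (- (r + cg * r))) by ring. apply Rmult_le_compat_l; lra.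
    apply Rmult_le_compat_l; lra. }
  rewrite <- !exp_plus. split; apply exp_le; lra.
Qed.

Theorem heteroclinic_exists : exists Z T,
  (forall t, orbit Z T t) /\ tends_to Z (ln a) /\ tends_to T T1 /\
  tends_to (fun t => Z (- t)) (ln a) /\ tends_to (fun t => T (- t)) T2 /\
  forall t, ln a - (T t - T1) / cb < Z t.
Proof.
  pose proof cc_gt as Hcc. pose proof cb_bounds as Hcb.
  pose proof nu_gt as Hnu.
  destruct (hh_shape T1 T2 HT12 Hh1 Hh2) as [Tc [HTc [Hdh [Hneg Hpos]]]].
  destruct (near_saddle T1 Tc Hh1 (proj1 HTc)) as [Ts [HTs Hsp]].
  assert (Hdh' : forall T, T1 <= T <= Ts -> dh T < 0) by (intros; apply Hdh; lra).
  set (lyP := lyapunov (ln a) T1).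
  assert (HlP : lyP < 0) by (apply (lyapunov_P1_neg T1 T2 T0); auto).
  destruct (lyapunov_sublevel_bounded T1 T2 T0 HT12 Hh1 Hh2 Hq0 Hq lyP HlP) as [r0 [Hr0 Hsub]].
  set (zm := - ln ((1 + hh Ts) / n)).
  (* A box containing the wedge and the sublevel set of [lyapunov] at the saddle value, so that the
     cut-off field is the true one in both. *)
  set (r := Rabs r0 + Rabs T1 + Rabs T2 + Rabs Ts + Rabs (ln a) + Rabs zm + 1).
  pose proof (Rabs_pos r0) as q1. pose proof (Rabs_pos T1) as q2. pose proof (Rabs_pos T2) as q3.
  pose proof (Rabs_pos Ts) as q4. pose proof (Rabs_pos (ln a)) as q5. pose proof (Rabs_pos zm) as q6.
  assert (Hr : 0 < r) by (unfold r; lra).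
  destruct (clamped_fields r Hr) as [L [B [F [G [HL [HB [HF [HG [HFB [HGB HFG]]]]]]]]]].
  assert (Hwr : forall z w, wedge T1 Ts z w -> Rabs z <= r /\ Rabs w <= r).
  { intros z w Hw. pose proof (wedge_z T1 Ts Hh1 Hdh' Hsp z w Hw) as h.
    fold zm in h. destruct Hw as [hT _].
    pose proof (Rle_abs zm). pose proof (Rle_abs (- ln a)) as h'. rewrite Rabs_Ropp in h'.
    pose proof (Rle_abs Ts). pose proof (Rle_abs (- T1)) as h''. rewrite Rabs_Ropp in h''.
    split; apply Rabs_le; unfold r; lra. }
  destruct (stable_orbit_exists T1 Ts (proj1 HTs) Hh1 Hdh' Hsp L B r F G HL HF HG HFB HGB HFG Hwr)
    as [Z [W [HW0 [Hflow Hwedge]]]].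
  assert (Hof : forall t, Rabs (Z t) <= r -> Rabs (W t) <= r -> orbit Z W t).
  { intros t h1 h2. destruct (Hflow t) as [f1 f2]. destruct (HFG _ _ h1 h2) as [e1 e2].
    rewrite e1 in f1. rewrite e2 in f2. split; auto. }
  assert (Hfwd : forall t, 0 <= t -> orbit Z W t).
  { intros t Ht. destruct (Hwr _ _ (Hwedge t Ht)). auto. }
  destruct (wedge_converges T1 Ts (proj1 HTs) Hh1 Hdh' Z W Hfwd Hwedge) as [HZlim HWlim].
  set (V := fun t => lyapunov (Z t) (W t)).
  set (dV := fun t => exp (nu * (Z t + cg * W t)) * exp (Z t) / (n + 1) * ((hh (W t) - hs) * dulac_int (W t))).
  assert (HVd : forall t, orbit Z W t -> is_derive V t (dV t)).
  { intros t Ho. apply lyapunov_derive; auto. }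
  assert (Hcoef : forall t, 0 < exp (nu * (Z t + cg * W t)) * exp (Z t) / (n + 1)).
  { intros t. apply Rdiv_lt_0_compat; [|lra]. apply Rmult_lt_0_compat; apply exp_pos. }
  assert (HdV : forall t, T1 <= W t -> 0 <= dV t).
  { intros t Ht. apply Rmult_le_pos. left; apply Hcoef. now apply dulac_int_hh_nonneg. }
  assert (HVlim : tends_to V lyP) by (apply lyapunov_tends; auto).
  assert (HVm : forall s t, 0 <= s <= t -> V s <= V t).
  { intros s t Hst. apply (deriv_nonneg_le V dV). lra. intros; apply HVd, Hfwd; lra.
    intros x Hx. apply HdV. apply (Hwedge x). lra. }
  assert (HVle : forall t, 0 <= t -> V t <= lyP).
  { intros t Ht. apply Rnot_lt_le. intros Hlt. destruct (HVlim (V t - lyP)) as [t0 h]. lra.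
    specialize (h (Rmax t0 t) (Rmax_l _ _)). specialize (HVm t (Rmax t0 t)).
    pose proof (Rmax_r t0 t). specialize (HVm ltac:(lra)). revert h. unfold Rabs. destruct Rcase_abs; lra. }
  (* On [t >= 0] the function [V] is at most its limit [lyP]. Equality at 0 would give [dV 0 <= 0],
     whereas [W 0 = Ts] lies strictly between [T1] and [T2], where [dV > 0]. *)
  assert (HV0 : V 0 < lyP).
  { apply Rnot_le_lt. intros Hle.
    assert (Hd0 : dV 0 <= 0).
    { apply (min_left_deriv (fun y => - V (- y)) (-1) 0). lra.
      - intros y Hy. rewrite Ropp_0. specialize (HVle (- y) ltac:(lra)). lra.
      - assert (HV : is_derive V (- 0) (dV 0)) by (rewrite Ropp_0; apply HVd, Hfwd; lra).
        derive_with HV. }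
    assert (0 < dV 0); [|lra]. apply Rmult_lt_0_compat. apply Hcoef. rewrite HW0. apply dulac_int_hh_nonneg; lra. }
  assert (Hline : forall t, T1 <= W t -> ln a - (W t - T1) / cb = Z t -> lyP <= V t).
  { intros t Ht He. unfold V. rewrite <- He. apply (lyapunov_line T1 T2 T0); auto. }
  assert (HoP : forall t, T1 <= W t -> V t <= lyP -> orbit Z W t /\ W t <= r /\ Rabs (Z t) <= r /\ Rabs (W t) <= r).
  { intros t h1 h2. destruct (Hsub (Z t) (W t) h1 h2) as [s1 s2].
    pose proof (Rle_abs r0). pose proof (Rle_abs (- T1)) as h'. rewrite Rabs_Ropp in h'.
    assert (Rabs (Z t) <= r) by (unfold r; lra).
    assert (Rabs (W t) <= r) by (apply Rabs_le; unfold r; lra).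
    split; auto. split; auto. unfold r; lra. }
  assert (Hcont : forall t, ex_derive (fun s => W (- s)) t /\ ex_derive (fun s => V (- s)) t /\ ex_derive (fun s => lyP - V (- s)) t /\
     ex_derive (fun s => Z (- s) - (ln a - (W (- s) - T1) / cb)) t).
  { intros t. destruct (Hflow (- t)) as [f1 f2].
    assert (e1 : ex_derive Z (- t)) by (eexists; eauto). assert (e2 : ex_derive W (- t)) by (eexists; eauto).
    pose proof (lyapunov_ex_derive Z W (- t) e1 e2) as e3. fold V in e3.
    split; [|split; [|split]]; auto_derive; auto. }
  (* The three conditions support one another. [V < lyP] keeps the orbit in the box and, by
     [lyapunov_line], off the line [u = U_1]; staying above that line means [Z > ln a] whenever
     [W = T1], where [VT < 0], so that [W] cannot come down to [T1] backwards in time. *)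
  assert (Hback : forall s, 0 <= s -> T1 < W (- s) /\ 0 < Z (- s) - (ln a - (W (- s) - T1) / cb) /\ 0 < lyP - V (- s)).
  { apply real_induction.
    - intros t Ht IH. destruct (Req_dec t 0) as [->|Hne].
      { rewrite Ropp_0, HW0. split; [|split; [|lra]]. lra.
        pose proof (wedge_z T1 Ts Hh1 Hdh' Hsp _ _ (Hwedge 0 ltac:(lra))) as h.
        assert (0 < (Ts - T1) / cb) by (apply Rdiv_lt_0_compat; lra). lra. }
      assert (Ht0 : 0 < t) by lra. destruct (Hcont t) as [cW [_ [cV cl]]].
      assert (b1 : T1 <= W (- t)).
      { apply (ge_at_left (fun s => W (- s))); auto. intros u Hu. left. apply IH; auto. }
      assert (b2 : 0 <= Z (- t) - (ln a - (W (- t) - T1) / cb)).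
      { apply (ge_at_left (fun s => Z (- s) - (ln a - (W (- s) - T1) / cb))); auto. intros u Hu. left. apply IH; auto. }
      assert (b3 : 0 <= lyP - V (- t)).
      { apply (ge_at_left (fun s => lyP - V (- s))); auto. intros u Hu. left. apply IH; auto. }
      assert (Hall : forall u, 0 <= u <= t -> T1 <= W (- u) /\ V (- u) <= lyP).
      { intros u Hu. destruct (Rle_lt_or_eq_dec u t ltac:(lra)) as [h| ->].
        destruct (IH u ltac:(lra)) as [i1 [_ i3]]. lra. lra. }
      assert (Hdu : forall u, 0 <= u <= t -> is_derive (fun s => V (- s)) u (- dV (- u))).
      { intros u Hu. destruct (Hall u Hu) as [i1 i2]. pose proof (HVd _ (proj1 (HoP _ i1 i2))) as h.
        derive_with h. }
      assert (b3' : V (- t) < lyP).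
      { apply Rle_lt_trans with (V (- 0)); [|now rewrite Ropp_0].
        apply (deriv_nonpos_ge (fun s => V (- s)) (fun u => - dV (- u))); auto.
        intros u Hu. specialize (HdV (- u) (proj1 (Hall u Hu))). lra. }
      assert (b2' : 0 < Z (- t) - (ln a - (W (- t) - T1) / cb)).
      { destruct b2 as [|b2]; auto. exfalso. specialize (Hline (- t) ltac:(lra) ltac:(lra)). lra. }
      split; [|split]; [|auto|lra]. destruct b1 as [|b1]; auto. exfalso.
      assert (EW : W (- t) = T1) by lra. destruct (HoP (- t) ltac:(lra) ltac:(lra)) as [[_ oW] _].
      assert (hv : - VT (Z (- t)) (W (- t)) <= 0).
      { apply (min_left_deriv (fun s => W (- s)) 0 t); auto.
        - intros y Hy. rewrite EW. apply Hall. lra.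
        - derive_with oW. }
      rewrite EW in b2', hv. unfold VT in hv. rewrite Hh1 in hv.
      assert (hz : a < exp (Z (- t))).
      { rewrite <- (exp_ln a) by lra. apply exp_increasing. replace (T1 - T1) with 0 in b2' by ring.
        unfold Rdiv in b2'. lra. }
      pose proof hs_eq as E.
      assert (hp : 0 < 1 + cb * hs).
      { apply (Rmult_lt_reg_l a). lra. rewrite <- E. lra. }
      assert (a * (1 + cb * hs) < exp (Z (- t)) * (1 + cb * hs)) by (apply Rmult_lt_compat_r; auto). lra.
    - intros t Ht IH. destruct (IH t ltac:(lra)) as [i1 [i2 i3]]. destruct (Hcont t) as [cW [_ [cV cl]]].
      destruct (gt_at_right _ _ _ cW i1) as [e1 [He1 He1']]. destruct (gt_at_right _ _ _ cl i2) as [e2 [He2 He2']].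
      destruct (gt_at_right _ _ _ cV i3) as [e3 [He3 He3']].
      exists (Rmin e1 (Rmin e2 e3)). split. repeat apply Rmin_glb_lt; auto. intros s Hs.
      Rmin_bounds e1 (Rmin e2 e3).
      Rmin_bounds e2 e3. split; [|split].
      apply He1'; lra. apply He2'; lra. apply He3'; lra. }
  assert (HB' : forall s, 0 <= s -> orbit Z W (- s) /\ T1 < W (- s) <= r /\ Rabs (Z (- s)) <= r /\ Rabs (W (- s)) <= r).
  { intros s Hs. destruct (Hback s Hs) as [b1 [_ b3]]. destruct (HoP (- s) ltac:(lra) ltac:(lra)) as [h1 [h2 h3]].
    split; [|split]; auto. }
  assert (Horb : forall t, orbit Z W t).
  { intros t. destruct (Rle_dec 0 t); auto. replace t with (- - t) by ring. apply HB'. lra. }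
  assert (HWl : forall s t, Rabs (W (- s) - W (- t)) <= B * Rabs (s - t)).
  { apply (deriv_bound_lip (fun s => W (- s)) (fun s => - G (Z (- s)) (W (- s)))).
    - intros s. destruct (Hflow (- s)) as [_ f2]. derive_with f2.
    - intros s. rewrite Rabs_Ropp. apply HGB. }
  assert (HZl : forall s t, Rabs (Z (- s) - Z (- t)) <= B * Rabs (s - t)).
  { apply (deriv_bound_lip (fun s => Z (- s)) (fun s => - F (Z (- s)) (W (- s)))).
    - intros s. destruct (Hflow (- s)) as [f1 _]. derive_with f1.
    - intros s. rewrite Rabs_Ropp. apply HFB. }
  assert (HT2r : T2 < r). { pose proof (Rle_abs T2). unfold r. lra. }
  (* By Barbalat [VT] tends to 0, and solving its definition for [exp Z] gives
     [(cc - VT) / (1 + cb hh W)], which tends to [a]. *)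
  assert (Hvlim : forall Tl, tends_to (fun s => W (- s)) Tl -> hh Tl = hs -> tends_to (fun s => Z (- s)) (ln a)).
  { intros Tl HTl HhTl.
    assert (Hdot : tends_to (fun s => - G (Z (- s)) (W (- s))) 0).
    { apply (barbalat (fun s => W (- s)) _ (L * (2 * B)) Tl); auto.
      - intros s _. destruct (Hflow (- s)) as [_ f2]. derive_with f2.
      - intros s t _ _. replace (- G (Z (- s)) (W (- s)) - - G (Z (- t)) (W (- t)))
          with (- (G (Z (- s)) (W (- s)) - G (Z (- t)) (W (- t)))) by ring.
        rewrite Rabs_Ropp. eapply Rle_trans. apply HG.
        specialize (HWl s t). specialize (HZl s t). rewrite Rmult_assoc. apply Rmult_le_compat_l; lra. }
    assert (Hden : tends_to (fun s => 1 + cb * hh (W (- s))) (cc / a)).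
    { replace (cc / a) with (1 + cb * hh Tl).
      - apply (tends_to_comp (fun T => 1 + cb * hh T)); auto.
        pose proof (is_derive_hh Tl).
        auto_derive. eexists; eauto.
      - rewrite HhTl. rewrite hs_eq. field. lra. }
    assert (Hca : 0 < cc / a) by (apply Rdiv_lt_0_compat; lra).
    assert (Hinv : tends_to (fun s => / (1 + cb * hh (W (- s)))) (a / cc)).
    { replace (a / cc) with (/ (cc / a)) by (field; lra).
      apply (tends_to_comp (fun x => / x)); auto.
      auto_derive. lra. }
    assert (Hprod : tends_to (fun s => (cc + - G (Z (- s)) (W (- s))) * / (1 + cb * hh (W (- s)))) a).
    { replace a with ((cc + 0) * (a / cc)) at 1 by (field; lra).
      apply tends_to_mult; auto.
      apply (tends_to_comp (fun x => cc + x) (fun s => - G (Z (- s)) (W (- s)))); auto.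
      auto_derive. auto. }
    destruct (Hden (cc / a) Hca) as [t0 Ht0].
    apply (tends_to_ext (fun s => ln ((cc + - G (Z (- s)) (W (- s))) * / (1 + cb * hh (W (- s))))) _ _ (Rmax 0 t0)).
    - intros s Hs. Rmax_bounds 0 t0.
      specialize (Ht0 s ltac:(lra)). apply Rabs_def2 in Ht0.
      destruct (HB' s ltac:(lra)) as [_ [_ [h1 h2]]]. destruct (HFG _ _ h1 h2) as [_ ->].
      rewrite <- (ln_exp (Z (- s))) at 2. f_equal. unfold VT. field. lra.
    - apply (tends_to_comp ln); auto. auto_derive. lra. }
  assert (Hdich : tends_to (fun s => W (- s)) T1 \/ tends_to (fun s => W (- s)) T2).
  { set (c := exp (- ((nu * (1 + cg) + 1) * r)) / (n + 1)).
    set (lo := - (cc * exp ((nu * (1 + cg) + 2) * r) / (nu - 1))).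
    apply (lasalle (fun s => V (- s)) (fun s => - dV (- s)) (fun s => W (- s)) (fun T => (hh T - hs) * dulac_int T)
      T1 T2 r B c lo); auto.
    - apply Rdiv_lt_0_compat. apply exp_pos. lra.
    - intros s Hs. pose proof (HVd _ (Horb (- s))) as h. derive_with h.
    - intros s Hs. destruct (HB' s Hs) as [_ [h0 [h1 h2]]]. destruct (exp_box _ _ _ h1 h2) as [h3 _].
      destruct (dulac_int_hh_nonneg (W (- s))) as [h4 _]. lra.
      unfold dV, c. apply Ropp_le_contravar. apply Rmult_le_compat_r; auto.
      apply Rmult_le_compat_r; auto. left. apply Rinv_0_lt_compat. lra.
    - intros s Hs. destruct (HB' s Hs) as [_ [h0 [h1 h2]]]. destruct (exp_box _ _ _ h1 h2) as [_ h3].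
      pose proof (F0_min T1 T2 HT12 Hh1 Hh2 (W (- s)) ltac:(lra)) as h4.
      pose proof (FF2_pos T2 Hh2) as h5.
      unfold V, lyapunov, lo. set (P := exp (nu * _)) in *. assert (HP : 0 < P) by apply exp_pos.
      set (X := exp (- Z (- s))) in *. set (Q := exp (- (cg * W (- s)))) in *.
      set (M := exp ((nu * (1 + cg) + 2) * r)) in *.
      assert (0 <= P * (F0 T2 (W (- s)) / nu)).
      { apply Rmult_le_pos. lra. left. apply Rdiv_lt_0_compat; lra. }
      assert (P * (cc * X * Q / (nu - 1)) <= cc * M / (nu - 1)).
      { replace (P * (cc * X * Q / (nu - 1))) with (cc / (nu - 1) * (P * X * Q)) by (field; lra).
        replace (cc * M / (nu - 1)) with (cc / (nu - 1) * M) by (field; lra).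
        apply Rmult_le_compat_l; auto. left. apply Rdiv_lt_0_compat; lra. }
      lra.
    - intros s Hs. destruct (HB' s Hs) as [_ [h0 _]]. lra.
    - intros x _. apply (ex_derive_continuous (fun T => (hh T - hs) * dulac_int T)).
      pose proof (dulac_int_derive T2 x). pose proof (is_derive_hh x).
      auto_derive. repeat split; eexists; eauto.
    - intros x Hx. apply dulac_int_hh_nonneg. lra.
    - intros x Hx Hx2. apply dulac_int_hh_nonneg; lra. }
  (* Returning to the saddle would make [V] tend to [lyP] in the past, although it is at most
     [V 0 < lyP] there. *)
  assert (HW2 : tends_to (fun s => W (- s)) T2).
  { destruct Hdich as [HW1|]; auto. exfalso.
    pose proof (lyapunov_tends _ _ _ _ (Hvlim T1 HW1 Hh1) HW1) as Hl. fold lyP in Hl.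
    assert (lyP <= V 0); [|lra].
    apply (tends_to_le _ _ _ 0 Hl). intros s Hs.
    change (V (- s) <= V 0). replace (V 0) with (V (- 0)) by (f_equal; ring).
    apply (deriv_nonpos_ge (fun s => V (- s)) (fun u => - dV (- u))); auto.
    - intros u Hu. pose proof (HVd _ (Horb (- u))) as h. derive_with h.
    - intros u Hu. destruct (HB' u ltac:(lra)) as [_ [h0 _]]. specialize (HdV (- u) ltac:(lra)). lra. }
  exists Z, W. split; [|split; [|split; [|split; [|split]]]]; auto.
  - apply (Hvlim T2); auto.
  - intros t. destruct (Rle_dec 0 t) as [Ht|Ht].
    + pose proof (wedge_z T1 Ts Hh1 Hdh' Hsp _ _ (Hwedge t Ht)) as h.
      destruct (Hwedge t Ht) as [hT _].
      assert (h0 : 0 <= (W t - T1) / cb).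
      { apply Rmult_le_pos. lra. left. apply Rinv_0_lt_compat. lra. }
      (* In the wedge equality on the line occurs only at the saddle, which a nonconstant orbit
         never reaches, by uniqueness. *)
      apply Rnot_le_lt. intros Hle.
      assert (EZ : Z t = ln a) by lra.
      assert (EW : W t = T1).
      { assert (h1 : (W t - T1) / cb <= 0) by lra.
        apply (Rmult_le_compat_r cb) in h1; [|lra]. unfold Rdiv in h1.
        rewrite Rmult_assoc, Rinv_l in h1 by lra. lra. }
      assert (Hst : forall x, orbit (fun _ => ln a) (fun _ => T1) x).
      { intros x. pose proof hs_eq as E.
        assert (E1 : VZ (ln a) T1 = 0) by (unfold VZ; rewrite exp_ln, Hh1 by lra; unfold hs; field; lra).
        assert (E2 : VT (ln a) T1 = 0) by (unfold VT; rewrite exp_ln, Hh1 by lra; rewrite E; ring).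
        split; rewrite ?E1, ?E2; apply (is_derive_const (V := R_NormedModule)). }
      destruct (orbit_determined Z W (fun _ => ln a) (fun _ => T1) t 0 Horb Hst EZ EW) as [_ h1].
      lra.
    + destruct (Hback (- t) ltac:(lra)) as [_ [h _]]. rewrite Ropp_involutive in h. lra.
Qed.
End Heteroclinic.

Lemma orbit_shift Z T c : (forall t, orbit Z T t) ->
  forall t, orbit (fun t => Z (c + t)) (fun t => T (c + t)) t.
Proof.
  intros Ho t. destruct (Ho (c + t)) as [h1 h2]. split.
  - derive_with h1.
  - derive_with h2.
Qed.

(** * Uniqueness of the stable orbit on the side [T > T1] *)

Section StableUnique.
Variables T1 Ts : R.
Hypothesis Hdh : forall T, T1 <= T <= Ts -> dh T < 0.
Hypothesis Hsp : 0 < 1 + hh Ts.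

(* In the coordinates [(- z, T)] the system is cooperative where [hh] decreases,
   so the order of two orbits is preserved. *)
Lemma ordered_orbits_apart Z1 W1 Z2 W2 :
  (forall t, 0 <= t -> orbit Z1 W1 t) -> (forall t, 0 <= t -> orbit Z2 W2 t) ->
  (forall t, 0 <= t -> T1 < W1 t < Ts) -> (forall t, 0 <= t -> T1 < W2 t < Ts) ->
  W1 0 = W2 0 -> Z1 0 < Z2 0 -> forall t, 0 <= t -> Z2 0 - Z1 0 <= Z2 t - Z1 t.
Proof.
  intros O1 O2 B1 B2 HW HZ. pose proof cb_bounds as Hcb.
  assert (Hpos : forall T, T1 < T < Ts -> 0 < 1 + hh T /\ 0 < 1 + cb * hh T).
  { intros T HT. pose proof (hh_decr T1 Ts Hdh T Ts ltac:(lra) ltac:(lra)). split; [lra|].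
    destruct (Rle_dec 0 (hh T)); nra. }
  assert (Hd1 : forall t, 0 <= t -> is_derive (fun t => Z2 t - Z1 t) t (VZ (Z2 t) (W2 t) - VZ (Z1 t) (W1 t))).
  { intros t Ht. apply (is_derive_minus (V := R_NormedModule) Z2 Z1). apply O2; auto. apply O1; auto. }
  assert (Hd2 : forall t, 0 <= t -> is_derive (fun t => W1 t - W2 t) t (VT (Z1 t) (W1 t) - VT (Z2 t) (W2 t))).
  { intros t Ht. apply (is_derive_minus (V := R_NormedModule) W1 W2). apply O1; auto. apply O2; auto. }
  assert (Hge : forall t, 0 <= t -> (forall s, 0 <= s <= t -> Z1 s <= Z2 s /\ W2 s <= W1 s) ->
     Z2 0 - Z1 0 <= Z2 t - Z1 t).
  { intros t Ht H. apply (deriv_nonneg_le (fun t => Z2 t - Z1 t) (fun t => VZ (Z2 t) (W2 t) - VZ (Z1 t) (W1 t))); auto.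
    intros; apply Hd1; lra. intros x Hx. destruct (H x Hx) as [h1 h2].
    specialize (B1 x ltac:(lra)). specialize (B2 x ltac:(lra)).
    pose proof (hh_decr T1 Ts Hdh (W2 x) (W1 x) ltac:(lra) ltac:(lra)) as h3.
    destruct (Hpos (W1 x) B1) as [h4 _]. apply exp_le in h1. pose proof (exp_pos (Z1 x)).
    unfold VZ. assert (exp (Z1 x) * (1 + hh (W1 x)) <= exp (Z2 x) * (1 + hh (W2 x))); [|lra].
    apply Rmult_le_compat; lra. }
  assert (key : forall t, 0 <= t -> Z1 t < Z2 t /\ W2 t <= W1 t).
  { apply real_induction.
    - intros t Ht IH. destruct (Req_dec t 0) as [->|Hne]. { split; auto. lra. }
      assert (c1 : 0 <= Z2 t - Z1 t).
      { apply (ge_at_left (fun t => Z2 t - Z1 t)). lra. eexists; apply Hd1; auto. intros u Hu. destruct (IH u Hu). lra. }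
      assert (c2 : 0 <= W1 t - W2 t).
      { apply (ge_at_left (fun t => W1 t - W2 t)). lra. eexists; apply Hd2; auto. intros u Hu. destruct (IH u Hu). lra. }
      assert (Z2 0 - Z1 0 <= Z2 t - Z1 t).
      { apply Hge; auto. intros s Hs. destruct (Rle_lt_or_eq_dec s t ltac:(lra)) as [h| ->].
        destruct (IH s); lra. lra. }
      lra.
    - intros t Ht IH. destruct (IH t ltac:(lra)) as [i1 i2].
      destruct (gt_at_right (fun t => Z2 t - Z1 t) t 0) as [e1 [He1 He1']]. eexists; apply Hd1; auto. lra.
      assert (He2 : exists e, 0 < e /\ forall s, t < s < t + e -> 0 <= W1 s - W2 s).
      { destruct i2 as [i2|i2].
        - destruct (gt_at_right (fun t => W1 t - W2 t) t 0) as [e2 [He2 He2']]. eexists; apply Hd2; auto. lra.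
          exists e2. split; auto. intros s Hs. left. now apply He2'.
        - destruct (deriv_pos_right _ _ _ (Hd2 t Ht)) as [e2 [He2 He2']].
          { unfold VT. rewrite <- i2. destruct (Hpos (W2 t) (B2 t Ht)) as [_ h]. apply exp_increasing in i1.
            assert (exp (Z1 t) * (1 + cb * hh (W2 t)) < exp (Z2 t) * (1 + cb * hh (W2 t))); [|lra].
            apply Rmult_lt_compat_r; auto. }
          exists e2. split; auto. intros s Hs. specialize (He2' s Hs). lra. }
      destruct He2 as [e2 [He2 He2']]. exists (Rmin e1 e2). split. apply Rmin_glb_lt; auto. intros s Hs.
      Rmin_bounds e1 e2.
      specialize (He1' s ltac:(lra)). specialize (He2' s ltac:(lra)). lra. }
  intros t Ht. apply Hge; auto. intros s Hs. destruct (key s); lra.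
Qed.
End StableUnique.

(** Shift times so that both orbits start at the same value of [T]. If their heights differed,
    [ordered_orbits_apart] would keep them apart, although both tend to [ln a]; so they agree at one
    point and hence everywhere. *)
Lemma stable_orbit_unique T1 Tc Za Wa Zb Wb : hh T1 = hs ->
  T1 < Tc -> (forall T, T1 <= T < Tc -> dh T < 0) ->
  (forall t, orbit Za Wa t) -> (forall t, orbit Zb Wb t) ->
  tends_to Za (ln a) -> tends_to Zb (ln a) -> tends_to Wa T1 -> tends_to Wb T1 ->
  (exists t0, forall t, t0 <= t -> T1 < Wa t) -> (exists t0, forall t, t0 <= t -> T1 < Wb t) ->
  exists c, forall t, Zb t = Za (c + t) /\ Wb t = Wa (c + t).
Proof.
  intros Hh1 HTc Hdh Oa Ob La Lb Ma Mb [t1 Pa] [t2 Pb].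
  destruct (near_saddle T1 Tc Hh1 HTc) as [Ts [HTs Hsp]].
  assert (Hdh' : forall T, T1 <= T <= Ts -> dh T < 0) by (intros; apply Hdh; lra).
  destruct (Ma (Ts - T1)) as [t3 Qa]. lra. destruct (Mb (Ts - T1)) as [t4 Qb]. lra.
  set (t5 := Rmax (Rmax t1 t2) (Rmax t3 t4)).
  pose proof (Rmax_l (Rmax t1 t2) (Rmax t3 t4)) as m1. pose proof (Rmax_r (Rmax t1 t2) (Rmax t3 t4)) as m2.
  pose proof (Rmax_l t1 t2) as m3. pose proof (Rmax_r t1 t2) as m4.
  pose proof (Rmax_l t3 t4) as m5. pose proof (Rmax_r t3 t4) as m6. fold t5 in m1, m2.
  assert (Ra : forall t, t5 <= t -> T1 < Wa t < Ts).
  { intros t Ht. specialize (Pa t ltac:(lra)). specialize (Qa t ltac:(lra)). apply Rabs_def2 in Qa. lra. }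
  assert (Rb : forall t, t5 <= t -> T1 < Wb t < Ts).
  { intros t Ht. specialize (Pb t ltac:(lra)). specialize (Qb t ltac:(lra)). apply Rabs_def2 in Qb. lra. }
  (* A value of [T] that both orbits take after time [t5], when they have entered the strip
     [(T1, Ts)] for good. *)
  set (w := Rmin (Wa t5) (Wb t5)).
  assert (Hw : T1 < w) by (apply Rmin_glb_lt; [apply Ra | apply Rb]; lra).
  assert (hit : forall W, (forall t, ex_derive W t) -> tends_to W T1 -> w <= W t5 -> exists t, t5 <= t /\ W t = w).
  { intros W HW HWl Hle. destruct (HWl (w - T1)) as [t6 h]. lra.
    specialize (h (Rmax t5 t6) (Rmax_r _ _)). apply Rabs_def2 in h.
    destruct (IVT_val W t5 (Rmax t5 t6) w) as [x [Hx Hx']]. apply Rmax_l.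
    intros t _. now apply (ex_derive_continuous W). rewrite Rmin_right, (Rmax_left (W t5)); lra.
    exists x. split; auto. lra. }
  destruct (hit Wa) as [ta [Hta Ea]]; auto. intros t; eexists; apply Oa. apply Rmin_l.
  destruct (hit Wb) as [tb [Htb Eb]]; auto. intros t; eexists; apply Ob. apply Rmin_r.
  pose proof (orbit_shift Za Wa ta Oa) as Oa'. pose proof (orbit_shift Zb Wb tb Ob) as Ob'.
  assert (tends_shift : forall f l c, tends_to f l -> tends_to (fun t => f (c + t)) l).
  { intros f l c H e He. destruct (H e He) as [t0 h]. exists (t0 - c). intros t Ht. apply h. lra. }
  assert (Hz : forall Z1 W1 Z2 W2, (forall t, orbit Z1 W1 t) -> (forall t, orbit Z2 W2 t) ->
    (forall t, 0 <= t -> T1 < W1 t < Ts) -> (forall t, 0 <= t -> T1 < W2 t < Ts) -> W1 0 = W2 0 ->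
    tends_to Z1 (ln a) -> tends_to Z2 (ln a) -> Z1 0 < Z2 0 -> False).
  { intros Z1 W1 Z2 W2 O1 O2 B1 B2 E L1 L2 Hlt.
    pose proof (ordered_orbits_apart T1 Ts Hdh' Hsp Z1 W1 Z2 W2 (fun t _ => O1 t) (fun t _ => O2 t) B1 B2 E Hlt) as H.
    pose proof (tends_to_plus _ _ _ _ L1 (tends_to_opp _ _ L2)) as H0.
    pose proof (tends_to_le _ _ (- (Z2 0 - Z1 0)) 0 H0). assert (ln a + - ln a <= - (Z2 0 - Z1 0)); [|lra].
    apply H1. intros t Ht. specialize (H t Ht). lra. }
  assert (EZ : Za ta = Zb tb).
  { destruct (Rtotal_order (Za ta) (Zb tb)) as [Hlt|[He|Hgt]]; auto; exfalso.
    - apply (Hz (fun t => Za (ta + t)) (fun t => Wa (ta + t)) (fun t => Zb (tb + t)) (fun t => Wb (tb + t))); auto.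
      intros; apply Ra; lra. intros; apply Rb; lra. rewrite !Rplus_0_r; congruence. now rewrite !Rplus_0_r.
    - apply (Hz (fun t => Zb (tb + t)) (fun t => Wb (tb + t)) (fun t => Za (ta + t)) (fun t => Wa (ta + t))); auto.
      intros; apply Rb; lra. intros; apply Ra; lra. rewrite !Rplus_0_r; congruence. now rewrite !Rplus_0_r. }
  exists (ta - tb). intros t.
  destruct (orbit_determined _ _ _ _ 0 (t - tb) Ob' Oa') as [h1 h2].
  rewrite !Rplus_0_r; auto. rewrite !Rplus_0_r; congruence.
  replace (tb + (t - tb)) with t in h1, h2 by ring.
  replace (ta + (t - tb)) with (ta - tb + t) in h1, h2 by ring. auto.
Qed.
End System.

(** * From limits in [r] to limits in [t = ln r]; barriers and signs *)

Lemma filterlim_infty_tends (f : R -> R) l :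
  filterlim f (Rbar_locally p_infty) (locally l) <-> tends_to (fun t => f (exp t)) l.
Proof.
  split.
  - intros H e He. destruct (proj1 (filterlim_locally f l) H (mkposreal e He)) as [M HM].
    exists (ln (Rmax 1 (M + 1))). intros t Ht.
    Rmax_bounds 1 (M + 1).
    apply exp_le in Ht. rewrite exp_ln in Ht by lra. apply (HM (exp t)). lra.
  - intros H. apply filterlim_locally. intros e. destruct (H e (cond_pos e)) as [t0 Ht0].
    exists (exp t0). intros x Hx. pose proof (exp_pos t0).
    specialize (Ht0 (ln x)). rewrite exp_ln in Ht0 by lra. apply Ht0.
    rewrite <- (ln_exp t0). apply ln_le. apply exp_pos. lra.
Qed.

Lemma filterlim_zero_tends (f : R -> R) l :
  filterlim f (at_right 0) (locally l) <-> tends_to (fun t => f (exp (- t))) l.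
Proof.
  split.
  - intros H e He. destruct (proj1 (filterlim_locally f l) H (mkposreal e He)) as [d Hd].
    exists (- ln (d / 2)). intros t Ht. pose proof (cond_pos d).
    assert (Hle : exp (- t) <= d / 2).
    { rewrite <- (exp_ln (d / 2)) by lra. apply exp_le. lra. }
    pose proof (exp_pos (- t)). apply (Hd (exp (- t))); auto.
    change (Rabs (exp (- t) - 0) < d). rewrite Rminus_0_r, Rabs_right; lra.
  - intros H. apply filterlim_locally. intros e. destruct (H e (cond_pos e)) as [t0 Ht0].
    exists (mkposreal _ (exp_pos (- t0))). intros x Hx Hx0.
    change (Rabs (x - 0) < exp (- t0)) in Hx. rewrite Rminus_0_r, Rabs_right in Hx by lra.
    specialize (Ht0 (- ln x)). rewrite Ropp_involutive, exp_ln in Ht0 by auto. apply Ht0.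
    apply ln_increasing in Hx; auto. rewrite ln_exp in Hx. lra.
Qed.

(** Zero can only be crossed upwards. The induction carries the weak inequality together with the
    strict one after time [s], because [f s = 0] is allowed. *)
Lemma positive_barrier (f df : R -> R) s : (forall t, s <= t -> is_derive f t (df t)) ->
  (forall t, s <= t -> f t = 0 -> 0 < df t) -> 0 <= f s -> forall t, s < t -> 0 < f t.
Proof.
  intros Hd Hb Hs t Ht.
  assert (Hc : forall x, 0 <= x -> is_derive (fun x => f (s + x)) x (df (s + x))).
  { intros x Hx. specialize (Hd (s + x) ltac:(lra)). derive_with Hd. }
  assert (key : forall x, 0 <= x -> 0 <= f (s + x) /\ (0 < x -> 0 < f (s + x))).
  { apply real_induction.
    - intros x Hx IH. destruct (Req_dec x 0) as [->|Hne].
      { rewrite Rplus_0_r. split; auto. lra. }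
      assert (H : 0 <= f (s + x)).
      { apply (ge_at_left (fun x => f (s + x))). lra. eexists; apply Hc; auto. intros u Hu. now apply IH. }
      assert (Hnz : f (s + x) <> 0).
      { intros E. specialize (Hb (s + x) ltac:(lra) E).
        assert (df (s + x) <= 0); [|lra].
        apply (min_left_deriv (fun x => f (s + x)) 0 x). lra.
        intros y Hy. destruct (Rle_lt_or_eq_dec y x ltac:(lra)) as [h| ->]; [|lra].
        destruct (IH y ltac:(lra)). lra. auto. }
      split; intros; lra.
    - intros x Hx IH. destruct (IH x ltac:(lra)) as [[h|h] _].
      + destruct (gt_at_right (fun x => f (s + x)) x 0) as [e [He He']]; auto. eexists; apply Hc; auto.
        exists e. split; auto. intros y Hy. specialize (He' y Hy). simpl in He'. split; intros; lra.
      + destruct (deriv_pos_right _ _ _ (Hc x Hx)) as [e [He He']]. apply Hb; auto. lra.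
        exists e. split; auto. intros y Hy. specialize (He' y Hy). simpl in He'. split; intros; lra. }
  destruct (key (t - s) ltac:(lra)) as [_ h]. replace (s + (t - s)) with t in h by ring. apply h. lra.
Qed.

Lemma rpow_nonneg x y : 0 <= rpow x y.
Proof. unfold rpow. destruct Rlt_dec. left; apply exp_pos. lra. Qed.

Lemma rpow_split x y : 0 <= x -> rpow x y = x * rpow x (y - 1).
Proof.
  intros Hx. unfold rpow. destruct Rlt_dec as [h|h].
  - unfold Rpower. rewrite <- (exp_ln x) at 2 by auto. rewrite <- exp_plus. f_equal. ring.
  - replace x with 0 by lra. ring.
Qed.

Lemma rpow_le x K y : 0 <= x <= K -> 0 < K -> 0 <= y -> rpow x y <= rpow K y.
Proof.
  intros Hx HK Hy. unfold rpow. destruct (Rlt_dec 0 K); [|lra]. destruct Rlt_dec as [h|h].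
  - unfold Rpower. apply exp_le. apply Rmult_le_compat_l; auto. apply ln_le; lra.
  - left; apply exp_pos.
Qed.

Lemma past_bounded (f : R -> R) ts l : (forall t, continuous f t) -> tends_to (fun t => f (- t)) l ->
  exists K, 0 < K /\ forall t, t <= ts -> Rabs (f t) <= K.
Proof.
  intros Hc Hl. destruct (Hl 1 ltac:(lra)) as [t0 H].
  destruct (continuous_bounded f (Rmin (- t0) ts) ts) as [K [HK HK']]. apply Rmin_r. auto.
  exists (K + Rabs l + 1). pose proof (Rabs_pos l). split. lra. intros t Ht.
  destruct (Rle_dec t (- t0)) as [h|h].
  - specialize (H (- t) ltac:(lra)). rewrite Ropp_involutive in H.
    pose proof (Rabs_triang (f t - l) l). replace (f t - l + l) with (f t) in H1 by ring. lra.
  - specialize (HK' t). pose proof (Rmin_l (- t0) ts). specialize (HK' ltac:(lra)). lra.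
Qed.

(* [v exp (C exp t)] is monotone while [v] has a sign, and its weight stays bounded as [t -> -oo]. *)
Lemma sign_from_past (v dv : R -> R) C ts : 0 <= C -> (forall t, is_derive v t (dv t)) ->
  (forall t, t <= ts -> - (C * exp t * Rabs (v t)) <= dv t) ->
  tends_to (fun t => v (- t)) 0 -> 0 <= v ts.
Proof.
  intros HC Hd Hdv Hl. apply Rnot_lt_le. intros Hneg.
  set (w := fun t => - v t * exp (- (C * exp t))).
  assert (Hw : forall t, is_derive w t ((- dv t + C * exp t * v t) * exp (- (C * exp t)))).
  { intros t. unfold w. derive_with (Hd t). }
  assert (Hw0 : 0 < w ts) by (apply Rmult_lt_0_compat; [lra | apply exp_pos]).
  assert (key : forall x, 0 <= x -> w ts <= w (ts - x)).
  { apply real_induction.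
    - intros x Hx IH. destruct (Req_dec x 0) as [->|Hne]. { rewrite Rminus_0_r. lra. }
      apply (ge_at_left (fun x => w (ts - x))); auto. lra. auto_derive. eexists; apply Hw.
    - intros x Hx IH.
      assert (Hvx : forall y, 0 < w y -> v y < 0).
      { intros y Hy. unfold w in Hy. pose proof (exp_pos (- (C * exp y))). nra. }
      destruct (gt_at_right (fun x => w (ts - x)) x 0) as [e [He He']].
      { auto_derive. eexists; apply Hw. } { specialize (IH x ltac:(lra)). lra. }
      exists e. split; auto. intros s Hs.
      apply Rle_trans with (w (ts - x)). apply IH; lra.
      apply (deriv_nonpos_ge w (fun t => (- dv t + C * exp t * v t) * exp (- (C * exp t)))). lra. auto.
      intros t Ht.
      assert (Hwt : 0 < w t).
      { destruct (Rle_lt_or_eq_dec t (ts - x) ltac:(lra)) as [h| ->].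
        specialize (He' (ts - t)). replace (ts - (ts - t)) with t in He' by ring.
        destruct (Rle_dec s (ts - t)). replace t with (ts - s) in * by lra.
        specialize (He' ltac:(lra)). lra. specialize (He' ltac:(lra)). lra.
        specialize (IH x ltac:(lra)). lra. }
      specialize (Hvx t Hwt). specialize (Hdv t ltac:(lra)). rewrite Rabs_left in Hdv by lra.
      pose proof (exp_pos (- (C * exp t))). nra. }
  destruct (Hl (w ts) Hw0) as [t0 H]. specialize (H (Rmax t0 (- ts)) (Rmax_l _ _)).
  pose proof (Rmax_r t0 (- ts)). specialize (key (ts + Rmax t0 (- ts)) ltac:(lra)).
  replace (ts - (ts + Rmax t0 (- ts))) with (- Rmax t0 (- ts)) in key by ring.
  set (y := - Rmax t0 (- ts)) in *. rewrite Rminus_0_r in H. unfold w at 2 in key.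
  assert (He : exp (- (C * exp y)) <= 1).
  { rewrite <- exp_0. apply exp_le. pose proof (exp_pos y). nra. }
  pose proof (exp_pos (- (C * exp y))).
  assert (- v y <= Rabs (v y)). { rewrite <- Rabs_Ropp. apply Rle_abs. }
  pose proof (Rabs_pos (v y)).
  assert (- v y * exp (- (C * exp y)) <= Rabs (v y) * 1); [|lra].
  apply Rle_trans with (Rabs (v y) * exp (- (C * exp y))). apply Rmult_le_compat_r; lra.
  apply Rmult_le_compat_l; lra.
Qed.

(** The behaviour of [u] controls only the combination [X = Z + T / cb], which tends to its saddle
    value from above. Since [X' = 1 - exp Z / a], this combination detects on which side of [ln a]
    the orbit lies. Once [Z > ln a] and [T > T1] are known for large times, the two nonnegative
    parts of [X - Xs] tend to zero separately. *)
Lemma approach_saddle n a m T1 T2 Z T : 0 < n -> n < a -> T1 < T2 ->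
  hh a m T1 = hs n a -> hh a m T2 = hs n a -> (forall t, orbit n a m Z T t) ->
  (forall t, ln a + T1 / cb a < Z t + T t / cb a) ->
  tends_to (fun t => Z t + T t / cb a) (ln a + T1 / cb a) ->
  tends_to Z (ln a) /\ tends_to T T1 /\ exists t0, forall t, t0 <= t -> T1 < T t.
Proof.
  intros Hn Hna H12 Hh1 Hh2 Ho Hgt Hlim. pose proof (cb_bounds n a Hn Hna) as Hb.
  destruct (hh_shape n a m Hn Hna T1 T2 H12 Hh1 Hh2) as [Tc [_ [_ [Hneg Hpos]]]].
  pose proof (hs_neg n a Hn Hna) as Hhs. pose proof (hs_eq n a Hn Hna) as Hcc.
  assert (Hbs : 0 < 1 + cb a * hs n a) by nra.
  set (b := cb a) in *. set (X := fun t => Z t + T t / b). set (Xs := ln a + T1 / b).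
  assert (HX : forall t, is_derive X t (1 - exp (Z t) / a)).
  { intros t. destruct (Ho t) as [D1 D2]. unfold X. auto_derive. repeat split; eexists; eauto.
    rewrite (Derive_val _ _ _ D1), (Derive_val _ _ _ D2). unfold VZ, VT, cc. fold b.
    assert (E : / b = 1 + / a) by (unfold b, cb; field; lra).
    transitivity (- n + exp (Z t) * (1 + hh a m (T t)) + ((n + 1) - exp (Z t) * (/ b + hh a m (T t)))).
    field; lra. rewrite E. field. lra. }
  assert (Hga : 0 < (T2 - T1) / b) by (apply Rdiv_lt_0_compat; lra).
  destruct (Hlim _ Hga) as [t1 Ht1].
  assert (Hex : forall t, Z t <= ln a -> exp (Z t) <= a).
  { intros t Ht. apply exp_le in Ht. rewrite exp_ln in Ht by lra. exact Ht. }
  (* If [Z <= ln a] at a late time, it stays so: where [Z = ln a], closeness of [X] to [Xs] puts [T]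
     in [(T1, T2)], hence [VZ < 0]. But then [X] is nondecreasing and cannot come down to [Xs]. *)
  assert (HZ : forall t, t1 <= t -> ln a < Z t).
  { intros s Hs. apply Rnot_le_lt. intros Hle.
    assert (Hbar : forall t, s < t -> 0 < ln a - Z t).
    { apply (positive_barrier (fun t => ln a - Z t) (fun t => - VZ n a m (Z t) (T t))); [| |lra].
      - intros t _. destruct (Ho t) as [D _]. derive_with D.
      - intros t Ht E. assert (EZ : Z t = ln a) by lra. specialize (Ht1 t ltac:(lra)). specialize (Hgt t).
        rewrite EZ in *. apply Rabs_def2 in Ht1. unfold VZ. rewrite exp_ln by lra.
        assert (HT : T1 < T t < T2).
        { unfold Rdiv in *. assert (0 < / b) by (apply Rinv_0_lt_compat; lra).
          split; apply (Rmult_lt_reg_r (/ b)); lra. }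
        specialize (Hneg _ HT). unfold hs in Hneg.
        assert (a * (hh a m (T t) - (n / a - 1)) < 0) by nra.
        replace (a * (hh a m (T t) - (n / a - 1))) with (- n + a * (1 + hh a m (T t))) in H by (field; lra). lra. }
    assert (Hinc : forall t, s <= t -> X s <= X t).
    { intros t Ht. apply (deriv_nonneg_le X (fun t => 1 - exp (Z t) / a)); auto.
      intros x Hx. assert (HZx : Z x <= ln a).
      { destruct (Rle_lt_or_eq_dec s x ltac:(lra)) as [h| <-]; auto. specialize (Hbar x h). lra. }
      apply Hex in HZx. assert (exp (Z x) / a <= 1); [|lra].
      apply (Rmult_le_reg_r a). lra. replace (exp (Z x) / a * a) with (exp (Z x)) by (field; lra). lra. }
    assert (- Xs <= - X s).
    { apply (tends_to_le (fun t => - X t) _ _ s). apply tends_to_opp. exact Hlim.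
      intros t Ht. specialize (Hinc t Ht). lra. }
    specialize (Hgt s). fold (X s) Xs in Hgt. lra. }
  (* If [T <= T1] at a late time, [T] remains below [T1] and [Z] is nondecreasing, so [exp Z] stays
     away from [a] and [X] falls below [Xs] in finite time. *)
  assert (HT : forall t, t1 <= t -> T1 < T t).
  { intros s Hs. apply Rnot_le_lt. intros Hle.
    assert (Hez : forall t, t1 <= t -> a < exp (Z t)).
    { intros t Ht. rewrite <- (exp_ln a) at 1 by lra. apply exp_increasing. auto. }
    assert (Hbar : forall t, s < t -> 0 < T1 - T t).
    { apply (positive_barrier (fun t => T1 - T t) (fun t => - VT n a m (Z t) (T t))); [| |lra].
      - intros t _. destruct (Ho t) as [_ D]. derive_with D.
      - intros t Ht E. assert (ET : T t = T1) by lra. rewrite ET. unfold VT. rewrite Hh1, Hcc. fold b.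
        specialize (Hez t ltac:(lra)).
        assert (a * (1 + b * hs n a) < exp (Z t) * (1 + b * hs n a)) by (apply Rmult_lt_compat_r; auto). lra. }
    assert (HZinc : forall t, s <= t -> Z s <= Z t).
    { intros t Ht. apply (deriv_nonneg_le Z (fun t => VZ n a m (Z t) (T t))); auto. intros; apply Ho.
      intros x Hx. assert (HTx : hs n a <= hh a m (T x)).
      { destruct (Rle_lt_or_eq_dec s x ltac:(lra)) as [h| <-].
        - left. apply Hpos. left. specialize (Hbar x h). lra.
        - destruct Hle as [h|h]. left. apply Hpos. auto. rewrite h. lra. }
      specialize (Hez x ltac:(lra)). unfold VZ.
      assert (a * (1 + hs n a) <= exp (Z x) * (1 + hh a m (T x))) by (apply Rmult_le_compat; lra).
      assert (a * (1 + hs n a) = n) by (unfold hs; field; lra). lra. }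
    set (k := exp (Z s) / a - 1).
    assert (Hk : 0 < k).
    { unfold k. specialize (Hez s Hs). assert (1 < exp (Z s) / a); [|lra].
      apply (Rmult_lt_reg_r a). lra. replace (exp (Z s) / a * a) with (exp (Z s)) by (field; lra). lra. }
    assert (Hdec : forall t, s <= t -> X t + k * t <= X s + k * s).
    { intros t Ht. apply (deriv_nonpos_ge (fun t => X t + k * t) (fun t => 1 - exp (Z t) / a + k)); auto.
      - intros x _. specialize (HX x). derive_with HX.
      - intros x Hx. specialize (HZinc x ltac:(lra)). apply exp_le in HZinc. unfold k.
        assert (exp (Z s) / a <= exp (Z x) / a); [|lra]. apply Rmult_le_compat_r; auto.
        left. apply Rinv_0_lt_compat. lra. }
    set (t := s + (X s - Xs) / k). assert (HXs : Xs < X s) by apply Hgt.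
    assert (0 < (X s - Xs) / k) by (apply Rdiv_lt_0_compat; lra).
    specialize (Hdec t ltac:(unfold t; lra)).
    replace (k * t) with (k * s + (X s - Xs)) in Hdec by (unfold t; field; lra).
    specialize (Hgt t). fold (X t) Xs in Hgt. lra. }
  assert (Hsplit : forall t, X t - Xs = (Z t - ln a) + (T t - T1) / b).
  { intros t. unfold X, Xs. field. lra. }
  split; [|split].
  - intros e He. destruct (Hlim e He) as [t2 Ht2]. exists (Rmax t1 t2). intros t Ht.
    Rmax_bounds t1 t2. specialize (Ht2 t ltac:(lra)).
    fold (X t) Xs in Ht2. rewrite Hsplit in Ht2. specialize (HZ t ltac:(lra)). specialize (HT t ltac:(lra)).
    assert (0 < (T t - T1) / b) by (apply Rdiv_lt_0_compat; lra).
    rewrite Rabs_right in * by lra. lra.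
  - intros e He. destruct (Hlim (e / b)) as [t2 Ht2]. apply Rdiv_lt_0_compat; lra. exists (Rmax t1 t2). intros t Ht.
    Rmax_bounds t1 t2. specialize (Ht2 t ltac:(lra)).
    fold (X t) Xs in Ht2. rewrite Hsplit in Ht2. specialize (HZ t ltac:(lra)). specialize (HT t ltac:(lra)).
    assert (0 < (T t - T1) / b) by (apply Rdiv_lt_0_compat; lra).
    rewrite Rabs_right in Ht2 by lra. rewrite Rabs_right by lra.
    apply (Rmult_lt_reg_r (/ b)). apply Rinv_0_lt_compat; lra. unfold Rdiv in *. lra.
  - exists t1. auto.
Qed.

(** * Translation between (E) and the autonomous system *)

Section Emden.
Variables (N : nat) (p M : R).
Hypothesis HN : (3 <= N)%nat.
Hypothesis Hp1 : 1 < p.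
Hypothesis Hp2 : p < INR N / (INR N - 2).

Local Notation n := (INR N - 2).
Local Notation a := (2 / (p - 1)).
Local Notation m := (- M).

Lemma dim_pos : 1 <= n.
Proof. apply le_INR in HN. simpl in HN. lra. Qed.

Lemma alpha_gt : n < a.
Proof.
  pose proof dim_pos as H. apply (Rmult_lt_compat_r n) in Hp2; [|lra].
  replace (INR N / n * n) with (INR N) in Hp2 by (field; lra).
  apply (Rmult_lt_reg_r (p - 1)). lra. replace (a * (p - 1)) with 2 by (field; lra). lra.
Qed.

Lemma cb_p : cb a = 2 / (p + 1).
Proof. unfold cb. field. lra. Qed.

Lemma ce_p : ce a = p + 1.
Proof. unfold ce. field. lra. Qed.

Lemma rpow_exp x y : 0 < x -> rpow x y = exp (y * ln x).
Proof. intros Hx. unfold rpow. destruct Rlt_dec; [reflexivity | lra]. Qed.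

(** The minimizer of [(C0 + C1 exp (ce T)) exp (- T)], hence the only possible zero of [dulac] when
    [Mbar <= M]. *)
Definition T_crit := ln ((1 + n / a ^ 2) / p) / (p + 1).

(** The right-hand side is the minimum reached at [T_crit], divided by [C2]: the largest [m] for
    which [dulac] is nonnegative. *)
Lemma Mbar_eq : - Mbar N p = (p + 1) * (C1 n a / C2 n a) * exp (p * T_crit).
Proof.
  pose proof dim_pos as Hn. pose proof alpha_gt as Hna.
  set (W := n * (p - 1) ^ 2 + 4).
  assert (HW : 0 < W). { unfold W. pose proof (pow2_ge_0 (p - 1)). nra. }
  assert (Hlt : n * (p - 1) < 2).
  { apply (Rmult_lt_compat_r (p - 1)) in Hna; [|lra]. replace (a * (p - 1)) with 2 in Hna by (field; lra). lra. }
  unfold Mbar, T_crit. fold W. rewrite !rpow_exp by lra.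
  replace ((1 + n / a ^ 2) / p) with (W / (4 * p)) by (unfold W; field; lra).
  rewrite ln_div by lra.
  replace (p * ((ln W - ln (4 * p)) / (p + 1))) with
    (ln W + (- (p / (p + 1) * ln (4 * p)) + - (1 / (p + 1) * ln W))) by (field; lra).
  rewrite !exp_plus, !exp_Ropp, exp_ln by auto.
  pose proof (exp_pos (p / (p + 1) * ln (4 * p))). pose proof (exp_pos (1 / (p + 1) * ln W)).
  assert (HC : C1 n a / C2 n a = (n + 4 - n * p) / W).
  { assert (D : 0 < n * (p - 1) * (p + 1)) by (repeat apply Rmult_lt_0_compat; lra).
    assert (E1 : C1 n a = 2 * (n + 4 - n * p) / (n * (p - 1) * (p + 1))) by (unfold C1; field; lra).
    assert (E2 : C2 n a = 2 * W / (n * (p - 1) * (p + 1))).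
    { unfold C2. rewrite E1, cb_p. unfold W. field. lra. }
    rewrite E1, E2. field. lra. }
  rewrite HC. field. lra.
Qed.

Lemma C12_pos : 0 < C1 n a /\ 0 < C2 n a.
Proof.
  pose proof dim_pos. pose proof alpha_gt. pose proof (C1_pos n a ltac:(lra) ltac:(lra)).
  pose proof (cb_bounds n a ltac:(lra) ltac:(lra)). unfold C2. lra.
Qed.

(* With [s = T - T_crit] and [C0 = p C1 exp ((p + 1) T_crit)] this is
   [p + exp ((p + 1) s) >= (p + 1) exp s]. *)
Lemma dulac_pos T : Mbar N p <= M -> 0 <= dulac n a m T /\ (T <> T_crit -> 0 < dulac n a m T).
Proof.
  intros HM. pose proof dim_pos as Hn. pose proof alpha_gt as Hna. destruct C12_pos as [H1 H2].
  assert (Ha : 0 < a) by lra.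
  set (s := T - T_crit). set (k := exp ((p + 1) * T_crit)).
  assert (Hk : k = (1 + n / a ^ 2) / p).
  { unfold k, T_crit. replace ((p + 1) * (ln ((1 + n / a ^ 2) / p) / (p + 1))) with (ln ((1 + n / a ^ 2) / p)) by (field; lra).
    apply exp_ln. apply Rdiv_lt_0_compat; [|lra]. assert (0 < n / a ^ 2). apply Rdiv_lt_0_compat. lra. apply pow_lt; auto. lra. }
  assert (HC0 : C0 n a = p * C1 n a * k) by (unfold C0; rewrite Hk; field; lra).
  assert (HT : exp (ce a * T) = k * exp ((p + 1) * s)).
  { rewrite ce_p. unfold k. rewrite <- exp_plus. f_equal. unfold s. ring. }
  assert (HT' : k * exp s = exp (p * T_crit) * exp T).
  { unfold k. rewrite <- !exp_plus. f_equal. unfold s. ring. }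
  assert (HmM : m * C2 n a <= (p + 1) * C1 n a * exp (p * T_crit)).
  { assert (m <= - Mbar N p) by lra. rewrite Mbar_eq in H.
    apply (Rmult_le_compat_r (C2 n a)) in H; [|lra].
    eapply Rle_trans. apply H. right. field. lra. }
  assert (Hb : 0 <= p + exp ((p + 1) * s) - (p + 1) * exp s /\ (s <> 0 -> 0 < p + exp ((p + 1) * s) - (p + 1) * exp s)).
  { assert (E : exp ((p + 1) * s) = exp (p * s) * exp s) by (rewrite <- exp_plus; f_equal; ring).
    pose proof (exp_pos s) as He.
    assert (E' : exp s * exp (- s) = 1) by (rewrite <- exp_plus, <- exp_0; f_equal; ring).
    destruct (Req_dec s 0) as [Hs|Hs].
    - rewrite Hs, !Rmult_0_r, exp_0. split; intros; lra.
    - pose proof (exp_ineq1 (p * s)) as h1. pose proof (exp_ineq1 (- s)) as h2.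
      assert (h1' : 1 + p * s < exp (p * s)) by (apply h1; nra).
      assert (h2' : 1 + - s < exp (- s)) by (apply h2; lra).
      assert (0 < p * (exp s * (exp (- s) - (1 + - s)))).
      { repeat apply Rmult_lt_0_compat; lra. }
      assert (0 < exp s * (exp (p * s) - (1 + p * s))) by (apply Rmult_lt_0_compat; lra).
      rewrite E. split; intros; nra. }
  assert (Hkey : C1 n a * k * (p + exp ((p + 1) * s) - (p + 1) * exp s) <= dulac n a m T).
  { unfold dulac. rewrite HC0, HT.
    assert (m * C2 n a * exp T <= (p + 1) * C1 n a * (k * exp s)).
    { rewrite HT'. rewrite <- Rmult_assoc. apply Rmult_le_compat_r; auto. left; apply exp_pos. }
    lra. }
  assert (Hck : 0 < C1 n a * k) by (apply Rmult_lt_0_compat; auto; apply exp_pos).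
  destruct Hb as [b1 b2]. split.
  - eapply Rle_trans. 2: apply Hkey. apply Rmult_le_pos; lra.
  - intros HTc. eapply Rlt_le_trans. 2: apply Hkey. apply Rmult_lt_0_compat; auto. apply b2. unfold s. lra.
Qed.

(** The value of [T = ln u - cb ln (- u_r)] on the profile [X r^(- a)], where it is constant because
    [cb (1 + 1 / a) = 1]. *)
Definition T_of X := cb a * (ln X / a - ln a).

Lemma T_of_root X : 0 < X -> Xeq N p M X -> hh a m (T_of X) = hs n a.
Proof.
  intros HX HE. pose proof dim_pos as Hn. pose proof alpha_gt as Hna.
  assert (Ha : 0 < a) by lra. unfold Xeq in HE. rewrite !rpow_exp in HE by auto.
  unfold hh, hs.
  assert (E1 : exp (ce a * T_of X) = exp ((p - 1) * ln X) / a ^ 2).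
  { unfold T_of. replace (ce a * (cb a * (ln X / a - ln a))) with ((p - 1) * ln X + - (ln a + ln a)).
    rewrite exp_plus, exp_Ropp, exp_plus, exp_ln by auto. field. lra.
    rewrite ce_p, cb_p. field. lra. }
  assert (E2 : exp (T_of X) = exp (2 * p / (p + 1) * ln a) * exp ((p - 1) / (p + 1) * ln X) / a ^ 2).
  { replace (T_of X) with (2 * p / (p + 1) * ln a + (p - 1) / (p + 1) * ln X + - (ln a + ln a)).
    rewrite !exp_plus, exp_Ropp, exp_plus, exp_ln by auto. field. lra.
    unfold T_of. rewrite cb_p. field. lra. }
  rewrite E1, E2. unfold Kc in HE.
  assert (HE' : exp ((p - 1) * ln X) + M * exp (2 * p / (p + 1) * ln a) * exp ((p - 1) / (p + 1) * ln X)
     = 2 * ((n * p - INR N) / (p - 1)) / (p - 1)) by lra.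
  replace (exp ((p - 1) * ln X) / a ^ 2 - m * (exp (2 * p / (p + 1) * ln a) * exp ((p - 1) / (p + 1) * ln X) / a ^ 2))
    with ((exp ((p - 1) * ln X) + M * exp (2 * p / (p + 1) * ln a) * exp ((p - 1) / (p + 1) * ln X)) / a ^ 2)
    by (field; lra).
  rewrite HE'. field. lra.
Qed.

Lemma T_of_lt X Y : 0 < X < Y -> T_of X < T_of Y.
Proof.
  intros H. pose proof dim_pos as Hn. pose proof alpha_gt as Hna.
  unfold T_of. apply Rmult_lt_compat_l. apply (cb_bounds n a); lra.
  apply Rplus_lt_compat_r. apply Rmult_lt_compat_r. apply Rinv_0_lt_compat. lra. apply ln_increasing; lra.
Qed.

Lemma Uprof_exp X t : 0 < X -> Uprof p X (exp t) = exp (a * (ln a + T_of X / cb a - t)).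
Proof.
  intros HX. pose proof dim_pos as Hn. pose proof alpha_gt as Hna.
  pose proof (cb_bounds n a ltac:(lra) Hna) as Hb. unfold Uprof, Rpower. rewrite ln_exp.
  rewrite <- (exp_ln X) at 1 by auto. rewrite <- exp_plus. f_equal. unfold T_of.
  set (b := cb a) in *. clearbody b. field. lra.
Qed.

Definition Zof (u u1 : R -> R) t := t + ln (- u1 (exp t)) - ln (u (exp t)).
Definition Tof (u u1 : R -> R) t := ln (u (exp t)) - cb a * ln (- u1 (exp t)).

Lemma cb_alpha : cb a * (1 + / a) = 1.
Proof. pose proof dim_pos. pose proof alpha_gt. unfold cb. field. lra. Qed.

Lemma u_of_ZT u u1 t : 0 < u (exp t) ->
  u (exp t) = exp (a * (Zof u u1 t + Tof u u1 t / cb a - t)).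
Proof.
  intros Hu. pose proof dim_pos as Hn. pose proof alpha_gt as Hna.
  pose proof (cb_bounds n a ltac:(lra) Hna) as Hb.
  rewrite <- (exp_ln (u (exp t))) at 1 by auto. f_equal. unfold Zof, Tof.
  assert (E : / cb a = 1 + / a).
  { apply (Rmult_eq_reg_l (cb a)); [|lra]. rewrite cb_alpha. field. lra. }
  unfold Rdiv at 2. rewrite E. unfold cb at 1.
  replace (a / (1 + a)) with (/ (1 + / a)) by (field; lra).
  assert (0 < 1 + / a). { assert (0 < / a) by (apply Rinv_0_lt_compat; lra). lra. }
  field. lra.
Qed.

(** The key identity is that [exp Z hh T] is [r] times the right-hand side of (E) divided by
    [- u_r]. Substituting it into the logarithmic derivatives of [u] and [- u_r] gives both
    equations. *)
Lemma pde_orbit (u u1 u2 : R -> R) (t : R) :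
  is_derive u (exp t) (u1 (exp t)) -> is_derive u1 (exp t) (u2 (exp t)) ->
  - u2 (exp t) - (INR N - 1) / exp t * u1 (exp t) = rhsE p M (u (exp t)) (u1 (exp t)) ->
  0 < u (exp t) -> u1 (exp t) < 0 -> orbit n a m (Zof u u1) (Tof u u1) t.
Proof.
  intros D1 D2 E Hu Hu1. pose proof dim_pos as Hn. pose proof alpha_gt as Hna.
  pose proof (exp_pos t) as Hr. unfold rhsE in E. rewrite Rabs_right, Rabs_left in E by lra.
  rewrite !rpow_exp in E by lra.
  assert (EZ : exp (Zof u u1 t) = exp t * (- u1 (exp t)) / u (exp t)).
  { unfold Zof, Rminus. rewrite !exp_plus, exp_Ropp, !exp_ln by lra. reflexivity. }
  set (r := exp t) in *. set (U := u r) in *. set (V := - u1 r) in *.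
  assert (HV : 0 < V) by (unfold V; lra).
  assert (Eh1 : exp (Zof u u1 t) * exp (ce a * Tof u u1 t) = r * (exp ((p - 1) * ln U) * U) / V).
  { rewrite ce_p. unfold Zof, Tof. fold r U V. rewrite cb_p, <- exp_plus.
    replace (t + ln V - ln U + (p + 1) * (ln U - 2 / (p + 1) * ln V))
      with (t + ((p - 1) * ln U + ln U) + - ln V) by (field; lra).
    rewrite !exp_plus, exp_Ropp, !exp_ln by auto. reflexivity. }
  assert (Eh2 : exp (Zof u u1 t) * exp (Tof u u1 t) = r * exp (2 * p / (p + 1) * ln V) / V).
  { unfold Zof, Tof. fold r U V. rewrite cb_p, <- exp_plus.
    replace (t + ln V - ln U + (ln U - 2 / (p + 1) * ln V))
      with (t + 2 * p / (p + 1) * ln V + - ln V) by (field; lra).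
    rewrite !exp_plus, exp_Ropp, !exp_ln by auto. reflexivity. }
  assert (Eh : exp (Zof u u1 t) * hh a m (Tof u u1 t) = r * (- u2 r - (INR N - 1) / r * u1 r) / V).
  { unfold hh. rewrite E. rewrite Rmult_minus_distr_l, Eh1.
    replace (exp (Zof u u1 t) * (m * exp (Tof u u1 t))) with (m * (exp (Zof u u1 t) * exp (Tof u u1 t))) by ring.
    rewrite Eh2. field. lra. }
  assert (Eu1 : u1 r = - V) by (unfold V; ring).
  assert (DZ : is_derive (Zof u u1) t (1 + - u2 r * r / V - u1 r * r / U)).
  { unfold Zof. auto_derive. repeat split; try (eexists; eauto); fold r; fold U; auto.
    fold r. rewrite (Derive_val _ _ _ D1), (Derive_val _ _ _ D2). fold r U V.
    field. unfold V in HV; lra. }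
  split.
  - replace (VZ n a m (Zof u u1 t) (Tof u u1 t)) with (1 + - u2 r * r / V - u1 r * r / U); auto.
    unfold VZ. rewrite Rmult_plus_distr_l, Eh, EZ, Eu1. field. lra.
  - replace (VT n a m (Zof u u1 t) (Tof u u1 t)) with (u1 r * r / U - cb a * (- u2 r * r / V)).
    + unfold Tof. auto_derive. repeat split; try (eexists; eauto); fold r; fold U; auto.
      fold r. rewrite (Derive_val _ _ _ D1), (Derive_val _ _ _ D2). fold r U V. field. unfold V in HV; lra.
    + unfold VT. replace (exp (Zof u u1 t) * (1 + cb a * hh a m (Tof u u1 t)))
        with (exp (Zof u u1 t) + cb a * (exp (Zof u u1 t) * hh a m (Tof u u1 t))) by ring.
      rewrite Eh, EZ, Eu1. unfold cc. field. lra.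
Qed.

Lemma orbit_pde Z T : (forall t, orbit n a m Z T t) ->
  solves_E_on_pos N p M (fun r => exp (a * (Z (ln r) + T (ln r) / cb a - ln r))).
Proof.
  intros Ho. pose proof dim_pos as Hn. pose proof alpha_gt as Hna.
  pose proof (cb_bounds n a ltac:(lra) Hna) as Hb. pose proof cb_alpha as Hba.
  set (u := fun r => exp (a * (Z (ln r) + T (ln r) / cb a - ln r))).
  set (u1 := fun r => - (exp (Z (ln r)) * u r / r)).
  set (u2 := fun r => exp (Z (ln r)) * u r / r ^ 2 * (n + 1 - exp (Z (ln r)) * hh a m (T (ln r)))).
  exists u1, u2. intros r Hr. destruct (Ho (ln r)) as [HZ HT].
  assert (Einv : / cb a = 1 + / a).
  { apply (Rmult_eq_reg_l (cb a)); [|lra]. rewrite Hba. field. lra. }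
  assert (D1 : is_derive u r (u1 r)).
  { unfold u. auto_derive. repeat split; auto; eexists; eauto.
    rewrite (Derive_val _ _ _ HZ), (Derive_val _ _ _ HT). unfold u1, u, VZ, VT, cc.
    set (W := exp (a * _)). set (h := hh a m (T (ln r))). set (X := exp (Z (ln r))).
    replace (exp _) with W by (unfold W; do 2 f_equal; ring).
    transitivity (a * ((- n + X * (1 + h)) + ((n + 1) - X * (/ cb a + h)) - 1) * W / r).
    - field. lra.
    - rewrite Einv. field. lra. }
  assert (D2 : is_derive u1 r (u2 r)).
  { unfold u1. auto_derive. repeat split; try (eexists; eauto); lra.
    rewrite (Derive_val _ _ _ HZ), (Derive_val _ _ _ D1). unfold u2, VZ.
    set (h := hh a m (T (ln r))). set (X := exp (Z (ln r))).
    unfold u1. fold X. field. lra. }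
  split; [|split; [|split]]; auto.
  - apply (ex_derive_continuous u2). unfold u2. pose proof (is_derive_hh a m (T (ln r))) as Hh.
    assert (r * (r * 1) <> 0) by (apply Rmult_integral_contrapositive; split; lra).
    auto_derive. repeat split; try (eexists; eauto); auto; lra.
  - unfold rhsE, u1, u2. set (W := u r). assert (HW : 0 < W) by apply exp_pos.
    set (X := exp (Z (ln r))). assert (HX : 0 < X) by apply exp_pos.
    assert (HV : 0 < X * W / r) by (apply Rdiv_lt_0_compat; auto; apply Rmult_lt_0_compat; auto).
    rewrite Rabs_Ropp, !Rabs_right by lra. rewrite !rpow_exp by auto.
    assert (EW : ln W = a * (Z (ln r) + T (ln r) / cb a - ln r)) by (unfold W, u; apply ln_exp).
    assert (E1 : exp ((p - 1) * ln W) = X ^ 2 * exp (ce a * T (ln r)) / r ^ 2).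
    { rewrite EW. replace ((p - 1) * (a * (Z (ln r) + T (ln r) / cb a - ln r))) with
        (Z (ln r) + Z (ln r) + ce a * T (ln r) + - (ln r + ln r)).
      rewrite !exp_plus, exp_Ropp, exp_plus, exp_ln by auto. fold X. field. lra.
      rewrite ce_p, cb_p. field. lra. }
    assert (E2 : exp (2 * p / (p + 1) * ln (X * W / r)) = X ^ 2 * W * exp (T (ln r)) / r ^ 2).
    { rewrite ln_div, ln_mult, EW by (auto; apply Rmult_lt_0_compat; auto).
      replace (ln X) with (Z (ln r)) by (unfold X; now rewrite ln_exp).
      replace (2 * p / (p + 1) * (Z (ln r) + a * (Z (ln r) + T (ln r) / cb a - ln r) - ln r)) with
        (Z (ln r) + Z (ln r) + a * (Z (ln r) + T (ln r) / cb a - ln r) + T (ln r) + - (ln r + ln r)).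
      rewrite !exp_plus, exp_Ropp, exp_plus, exp_ln by auto. fold X. change (exp (a * (Z (ln r) + T (ln r) / cb a - ln r))) with W.
      field. lra. rewrite cb_p. field. lra. }
    rewrite E1, E2. unfold hh. field. lra.
Qed.

(** * The flux [- r^(N-1) u_r] and the nonexistence of ground states *)

Definition flux (u1 : R -> R) t := - (exp ((n + 1) * t) * u1 (exp t)).

Lemma flux_derive (u u1 u2 : R -> R) t : is_derive u1 (exp t) (u2 (exp t)) ->
  - u2 (exp t) - (INR N - 1) / exp t * u1 (exp t) = rhsE p M (u (exp t)) (u1 (exp t)) ->
  is_derive (flux u1) t (exp ((n + 1) * t) * exp t * rhsE p M (u (exp t)) (u1 (exp t))).
Proof.
  intros D E. unfold flux. auto_derive. eexists; eauto. rewrite (Derive_val _ _ _ D), <- E.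
  pose proof (exp_pos t). field. lra.
Qed.

(** The exponent [2 p / (p + 1)] exceeds 1, so for bounded [u_r] the gradient term is at most linear
    in [|u_r|]. This provides the differential inequality of [sign_from_past] for the flux. *)
Lemma rhsE_lower u ur K : 0 <= u -> M <= 0 -> 0 < K -> Rabs ur <= K ->
  - (m * rpow K (2 * p / (p + 1) - 1) * Rabs ur) <= rhsE p M u ur.
Proof.
  intros Hu HM HK Hur. unfold rhsE. pose proof (rpow_nonneg (Rabs u) (p - 1)).
  rewrite (rpow_split (Rabs ur)) by apply Rabs_pos. pose proof (Rabs_pos ur) as h.
  assert (Hq : 0 <= 2 * p / (p + 1) - 1).
  { replace (2 * p / (p + 1) - 1) with ((p - 1) / (p + 1)) by (field; lra).
    left. apply Rdiv_lt_0_compat; lra. }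
  pose proof (rpow_le (Rabs ur) K (2 * p / (p + 1) - 1) ltac:(lra) HK Hq) as h1.
  assert (0 <= rpow (Rabs u) (p - 1) * u) by (apply Rmult_le_pos; lra).
  pose proof (rpow_nonneg (Rabs ur) (2 * p / (p + 1) - 1)).
  assert (m * (Rabs ur * rpow (Rabs ur) (2 * p / (p + 1) - 1)) <= m * (Rabs ur * rpow K (2 * p / (p + 1) - 1))).
  { apply Rmult_le_compat_l. lra. apply Rmult_le_compat_l; lra. }
  lra.
Qed.

Lemma rhsE_zero u : 0 < u -> 0 < rhsE p M u 0.
Proof.
  intros Hu. unfold rhsE. rewrite Rabs_R0, (Rabs_right u) by lra. unfold rpow at 2.
  destruct (Rlt_dec 0 0); [lra|]. unfold rpow. destruct Rlt_dec; [|lra].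
  pose proof (exp_pos ((p - 1) * ln u)). unfold Rpower.
  assert (0 < exp ((p - 1) * ln u) * u) by (apply Rmult_lt_0_compat; auto). lra.
Qed.

Lemma no_ground_state u : Mbar N p <= M <= 0 -> ~ ground_state N p M u.
Proof.
  intros HM [[u1 [u2 [Hode [Lu [Lu1 [Lu2 Hu10]]]]]] [Hu0 [rx [Hrx Hurx]]]].
  pose proof dim_pos as Hn. pose proof alpha_gt as Hna.
  pose proof (cb_bounds n a ltac:(lra) Hna) as Hcb.
  apply filterlim_zero_tends in Lu. apply filterlim_zero_tends in Lu1. apply filterlim_zero_tends in Lu2.
  rewrite Hu10 in Lu1.
  assert (Hcd : forall (f df : R -> R) (t : R), is_derive f (exp t) (df (exp t)) -> continuous (fun t => f (exp t)) t).
  { intros f df t D. apply (ex_derive_continuous (fun t => f (exp t))). auto_derive. eexists; eauto. }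
  assert (Hc1 : forall t, continuous (fun t => u1 (exp t)) t).
  { intros t. apply (Hcd u1 u2). apply Hode, exp_pos. }
  set (v := flux u1). set (dv := fun t => exp ((n + 1) * t) * exp t * rhsE p M (u (exp t)) (u1 (exp t))).
  assert (Hv : forall t, is_derive v t (dv t)).
  { intros t. destruct (Hode (exp t) (exp_pos t)) as [_ [D [_ E]]]. now apply (flux_derive u u1 u2). }
  assert (Hv0 : tends_to (fun t => v (- t)) 0).
  { intros e He. destruct (Lu1 e He) as [t0 H]. exists (Rmax 0 t0). intros t Ht.
    Rmax_bounds 0 t0. specialize (H t ltac:(lra)).
    rewrite Rminus_0_r in *. unfold v, flux. rewrite Rabs_Ropp, Rabs_mult, (Rabs_right (exp _)) by (left; apply exp_pos).
    assert (exp ((n + 1) * - t) <= 1). { assert (0 <= (n + 1) * t) by (apply Rmult_le_pos; lra).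
      apply Rle_trans with (exp 0); [apply exp_le | rewrite exp_0]; lra. }
    pose proof (Rabs_pos (u1 (exp (- t)))).
    apply Rle_lt_trans with (1 * Rabs (u1 (exp (- t)))). apply Rmult_le_compat_r; lra. lra. }
  assert (Hcoef : forall ts, exists C, 0 <= C /\ forall t, t <= ts -> - (C * exp t * Rabs (v t)) <= dv t).
  { intros ts. destruct (past_bounded (fun t => u1 (exp t)) ts 0 Hc1 Lu1) as [K [HK HK']].
    exists (m * rpow K (2 * p / (p + 1) - 1)). split.
    { apply Rmult_le_pos. lra. apply rpow_nonneg. }
    intros t Ht. pose proof (rhsE_lower (u (exp t)) (u1 (exp t)) K (Hu0 _ (Rlt_le _ _ (exp_pos t))) ltac:(lra) HK (HK' t Ht)) as H.
    unfold v, flux, dv. rewrite Rabs_Ropp, Rabs_mult, (Rabs_right (exp ((n + 1) * t))) by (left; apply exp_pos).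
    pose proof (Rmult_lt_0_compat _ _ (exp_pos ((n + 1) * t)) (exp_pos t)) as H0.
    apply (Rmult_le_compat_l _ _ _ (Rlt_le _ _ H0)) in H. lra. }
  (* The flux vanishes at [r = 0] and satisfies a linear lower differential inequality, so it cannot
     become negative. *)
  assert (Hvp : forall t, 0 <= v t).
  { intros t. destruct (Hcoef t) as [C [HC HC']]. apply (sign_from_past v dv C t); auto. }
  assert (Hu1n : forall r, 0 < r -> u1 r <= 0).
  { intros r Hr. specialize (Hvp (ln r)). unfold v, flux in Hvp. rewrite exp_ln in Hvp by auto.
    pose proof (exp_pos ((n + 1) * ln r)). nra. }
  assert (Hmono : forall r s, 0 < r <= s -> u s <= u r).
  { intros r s Hrs. apply (deriv_nonpos_ge u u1). lra. intros x Hx. apply Hode. lra. intros x Hx. apply Hu1n. lra. }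
  assert (Hpos : exists t0, forall t, t <= t0 -> 0 < u (exp t)).
  { assert (Hux : 0 < u rx). { specialize (Hu0 rx Hrx). lra. }
    destruct Hrx as [Hrx| <-].
    - exists (ln rx). intros t Ht. apply Rlt_le_trans with (u rx); auto. apply Hmono. split. apply exp_pos.
      apply exp_le in Ht. now rewrite exp_ln in Ht.
    - destruct (Lu (u 0) Hux) as [t0 H]. exists (- t0). intros t Ht. specialize (H (- t) ltac:(lra)).
      rewrite Ropp_involutive in H. apply Rabs_def2 in H. lra. }
  destruct Hpos as [tp Htp].
  (* A zero of the flux at [ts] would propagate to the whole past by the same inequality,
     contradicting the positive derivative of the flux where [u > 0] and [u_r = 0]. *)
  assert (Hvpos : forall t, 0 < v t).
  { intros ts. destruct (Hvp ts) as [|E]; auto. exfalso. symmetry in E.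
    destruct (Hcoef ts) as [C [HC HC']].
    assert (Hz : forall t, t <= ts -> v t = 0).
    { intros t Ht. specialize (Hvp t) as h.
      assert (H : v t * exp (C * exp t) <= v ts * exp (C * exp ts)).
      { apply (deriv_nonneg_le (fun t => v t * exp (C * exp t)) (fun t => (dv t + C * exp t * v t) * exp (C * exp t))); auto.
        - intros x _. specialize (Hv x). derive_with Hv.
        - intros x Hx. specialize (HC' x ltac:(lra)). specialize (Hvp x). rewrite Rabs_right in HC' by lra.
          apply Rmult_le_pos. lra. left; apply exp_pos. }
      rewrite E in H. pose proof (exp_pos (C * exp t)). nra. }
    set (t := Rmin tp ts). Rmin_bounds tp ts. fold t in H, H0.
    assert (Hu1t : u1 (exp t) = 0).
    { specialize (Hz t H0). unfold v, flux in Hz. pose proof (exp_pos ((n + 1) * t)). nra. }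
    assert (dv t <= 0).
    { apply (min_left_deriv v (t - 1) t); auto. lra. intros y Hy. rewrite !Hz by lra. lra. }
    assert (0 < dv t); [|lra]. unfold dv. rewrite Hu1t.
    apply Rmult_lt_0_compat. apply Rmult_lt_0_compat; apply exp_pos. apply rhsE_zero. now apply Htp. }
  assert (Hu1 : forall r, 0 < r -> u1 r < 0).
  { intros r Hr. specialize (Hvpos (ln r)). unfold v, flux in Hvpos. rewrite exp_ln in Hvpos by auto.
    pose proof (exp_pos ((n + 1) * ln r)). nra. }
  assert (Hup : forall r, 0 < r -> 0 < u r).
  { intros r Hr. destruct (Hu0 r ltac:(lra)) as [|E]; auto. exfalso.
    destruct (deriv_MVT u u1 r (r + 1)) as [c [Hc Hc']]. lra. intros x Hx. apply Hode. lra.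
    specialize (Hu1 c ltac:(lra)). specialize (Hu0 (r + 1) ltac:(lra)). nra. }
  set (Z := Zof u u1). set (T := Tof u u1).
  assert (Ho : forall t, orbit n a m Z T t).
  { intros t. pose proof (exp_pos t) as Hr. destruct (Hode (exp t) Hr) as [D1 [D2 [_ E]]].
    apply (pde_orbit u u1 u2 t); auto. }
  assert (Hnu : n + 2 < nu n a) by (apply nu_gt; lra).
  (* Otherwise [VT >= - dl] throughout, so [T] grows at most like [- dl t] as [t] tends to minus
     infinity. But [|u_r| <= K r] near 0 makes it grow at least like [- cb t], and [dl < cb] because
     [n + 1 < nu - 1]. *)
  assert (Hstart : exists t0, 0 < pohozaev n a m (Z t0) (T t0)).
  { apply NNPP. intros Hno. set (dl := cc n a / (nu n a - 1)).
    assert (HT' : forall t, - dl <= VT n a m (Z t) (T t)).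
    { intros t. apply Rnot_lt_le. intros Hlt. apply Hno. exists t. apply pohozaev_pos_of_VT; auto. lra. }
    assert (Hdl : dl < cb a).
    { unfold dl, cc. apply (Rmult_lt_reg_r (nu n a - 1)). lra.
      replace (cb a * (n + 1) / (nu n a - 1) * (nu n a - 1)) with (cb a * (n + 1)) by (field; lra).
      apply Rmult_lt_compat_l; lra. }
    assert (HTb : forall t, t <= 0 -> T t + dl * t <= T 0 + dl * 0).
    { intros t Ht. apply (deriv_nonneg_le (fun t => T t + dl * t) (fun t => VT n a m (Z t) (T t) + dl)); auto.
      - intros x _. destruct (Ho x) as [_ D]. derive_with D.
      - intros x _. specialize (HT' x). lra. }
    destruct (Lu2 1 ltac:(lra)) as [tb Htb]. set (K := Rabs (u2 0) + 1).
    assert (HK : 0 < K) by (unfold K; pose proof (Rabs_pos (u2 0)); lra).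
    (* [u_r] vanishes at 0 and [u_rr] is bounded by [K] nearby; the mean value theorem is applied
       from a radius so small that its [u_r] is less than the supposed excess. *)
    assert (Hlin : forall t, t <= - tb -> - u1 (exp t) <= K * exp t).
    { intros t Ht. pose proof (exp_pos t) as Hr. apply Rnot_lt_le. intros Hlt.
      destruct (Lu1 (- u1 (exp t) - K * exp t)) as [tc Htc]. lra.
      specialize (Htc (Rmax tc (- t)) (Rmax_l _ _)). pose proof (Rmax_r tc (- t)) as hm.
      set (r := exp (- Rmax tc (- t))) in *.
      assert (Hrt : r <= exp t) by (apply exp_le; lra). assert (Hr0 : 0 < r) by apply exp_pos.
      destruct (deriv_MVT u1 u2 r (exp t) Hrt) as [c [Hc Hc']]. intros x Hx. apply Hode. lra.
      assert (Hc2 : Rabs (u2 c) <= K).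
      { specialize (Htb (- ln c)). rewrite Ropp_involutive, exp_ln in Htb by lra.
        assert (ln c <= - tb). { apply Rle_trans with t; auto. rewrite <- (ln_exp t). apply ln_le; lra. }
        specialize (Htb ltac:(lra)). pose proof (Rabs_triang (u2 c - u2 0) (u2 0)) as h.
        replace (u2 c - u2 0 + u2 0) with (u2 c) in h by ring. unfold K. lra. }
      apply Rabs_le_between in Hc2. rewrite Rminus_0_r in Htc. apply Rabs_def2 in Htc.
      assert (- (u2 c * (exp t - r)) <= K * exp t); [|lra].
      apply Rle_trans with (K * (exp t - r)). nra. nra. }
    set (A := (ln (u (exp 0)) - T 0) - cb a * ln K).
    assert (Hall : forall t, t <= Rmin 0 (- tb) -> A <= (cb a - dl) * t).
    { intros t Ht. Rmin_bounds 0 (- tb). pose proof (exp_pos t) as Hr.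
      specialize (HTb t ltac:(lra)). specialize (Hlin t ltac:(lra)). specialize (Hu1 _ Hr).
      assert (Hu00 : ln (u (exp 0)) <= ln (u (exp t))).
      { apply ln_le. apply Hup, exp_pos. apply Hmono. split; auto. apply exp_le. lra. }
      apply ln_le in Hlin; [|lra]. rewrite ln_mult, ln_exp in Hlin by auto.
      assert (ET : T t = ln (u (exp t)) - cb a * ln (- u1 (exp t))) by reflexivity.
      assert (cb a * ln (- u1 (exp t)) <= cb a * (ln K + t)) by (apply Rmult_le_compat_l; lra).
      unfold A. lra. }
    set (t := Rmin (Rmin 0 (- tb)) ((A - 1) / (cb a - dl))).
    specialize (Hall t (Rmin_l _ _)).
    assert ((cb a - dl) * t <= A - 1); [|lra].
    apply Rle_trans with ((cb a - dl) * ((A - 1) / (cb a - dl))). apply Rmult_le_compat_l. lra. apply Rmin_r.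
    right. field. lra. }
  destruct Hstart as [t0 Ht0].
  apply (no_descending_orbit n a m ltac:(lra) Hna (fun t => Z (t0 + t)) (fun t => T (t0 + t))).
  - lra.
  - intros s. now apply (dulac_pos s).
  - intros t _. now apply (orbit_shift n a m Z T t0 Ho).
  - now rewrite !Rplus_0_r.
Qed.

(** * Existence and uniqueness of the singular solution *)

Section Profiles.
Variables X1 X2 : R.
Hypothesis HM : Mbar N p <= M.
Hypothesis HX : 0 < X1 < X2.
Hypothesis HE1 : Xeq N p M X1.
Hypothesis HE2 : Xeq N p M X2.

Local Notation T1 := (T_of X1).
Local Notation T2 := (T_of X2).

Lemma root_facts : 0 < n /\ n < a /\ T1 < T2 /\ hh a m T1 = hs n a /\ hh a m T2 = hs n a.
Proof.
  pose proof dim_pos. pose proof alpha_gt.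
  split; [lra | split; [lra | split; [|split]]].
  - apply T_of_lt; auto.
  - apply T_of_root; auto. lra.
  - apply T_of_root; auto. lra.
Qed.

Lemma profile_ratio X t y : 0 < X ->
  exp (a * y) / Uprof p X (exp t) = exp (a * (y - (ln a + T_of X / cb a - t))).
Proof.
  intros HX0. rewrite Uprof_exp by auto.
  unfold Rdiv at 1. rewrite <- exp_Ropp, <- exp_plus. f_equal. ring.
Qed.

Lemma good_orbit u : good_singular N p M X1 X2 u -> exists Z T,
  (forall t, orbit n a m Z T t) /\ (forall t, u (exp t) = exp (a * (Z t + T t / cb a - t))) /\
  tends_to Z (ln a) /\ tends_to T T1 /\ exists t0, forall t, t0 <= t -> T1 < T t.
Proof.
  intros [Hu [[[u1 [u2 Hode]] _] [H0 [Hinf Hgt]]]].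
  destruct root_facts as [Hn [Hna [H12 [Hh1 Hh2]]]].
  apply filterlim_zero_tends in H0. apply filterlim_infty_tends in Hinf.
  (* If [u_r] were nonnegative at [rs], the barrier for the flux would make it nonnegative on
     [(0, rs)], and [u] would be bounded near 0, against [u ~ U_2]. *)
  assert (Hu1 : forall r, 0 < r -> u1 r < 0).
  { intros rs Hrs. apply Rnot_le_lt. intros Hle.
    assert (Hall : forall r, 0 < r < rs -> 0 <= u1 r).
    { intros r Hr. apply Rnot_lt_le. intros Hlt.
      assert (Hfd : forall t, is_derive (flux u1) t (exp ((n + 1) * t) * exp t * rhsE p M (u (exp t)) (u1 (exp t)))).
      { intros t. destruct (Hode (exp t) (exp_pos t)) as [_ [D [_ E]]]. now apply (flux_derive u u1 u2). }
      assert (0 < flux u1 (ln rs)).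
      { apply (positive_barrier (flux u1) _ (ln r) (fun t _ => Hfd t)).
        - intros t _ E. assert (E0 : u1 (exp t) = 0).
          { unfold flux in E. pose proof (exp_pos ((n + 1) * t)). nra. }
          rewrite E0. apply Rmult_lt_0_compat. apply Rmult_lt_0_compat; apply exp_pos.
          apply (rhsE_zero). apply Hu, exp_pos.
        - unfold flux. rewrite exp_ln by lra. pose proof (exp_pos ((n + 1) * ln r)). nra.
        - apply ln_increasing; lra. }
      unfold flux in H. rewrite exp_ln in H by lra. pose proof (exp_pos ((n + 1) * ln rs)). nra. }
    assert (Hbd : forall r, 0 < r <= rs -> u r <= u rs).
    { intros r Hr. apply (deriv_nonneg_le u u1). lra. intros x Hx. apply Hode. lra.
      intros x Hx. destruct (Rle_lt_or_eq_dec x rs ltac:(lra)) as [h| ->]; auto. apply Hall. lra. }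
    destruct (H0 (1 / 2) ltac:(lra)) as [t0 Ht0].
    set (y := ln (2 * (u rs + 1) / X2)).
    assert (Hy : 0 < 2 * (u rs + 1) / X2).
    { apply Rdiv_lt_0_compat; [|lra]. specialize (Hu rs Hrs). lra. }
    set (t := Rmax (Rmax t0 (- ln rs)) (y / a)).
    pose proof (Rmax_l (Rmax t0 (- ln rs)) (y / a)) as q1. pose proof (Rmax_r (Rmax t0 (- ln rs)) (y / a)) as q2.
    pose proof (Rmax_l t0 (- ln rs)) as q3. pose proof (Rmax_r t0 (- ln rs)) as q4. fold t in q1, q2.
    specialize (Ht0 t ltac:(lra)). apply Rabs_def2 in Ht0. destruct Ht0 as [_ Ht0].
    assert (HU : Uprof p X2 (exp (- t)) = X2 * exp (a * t)).
    { unfold Uprof, Rpower. rewrite ln_exp. do 2 f_equal. ring. }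
    assert (HUp : 0 < Uprof p X2 (exp (- t))) by (rewrite HU; apply Rmult_lt_0_compat; [lra | apply exp_pos]).
    assert (Hbig : 2 * (u rs + 1) <= Uprof p X2 (exp (- t))).
    { rewrite HU. replace (2 * (u rs + 1)) with (X2 * exp y) by (unfold y; rewrite exp_ln by auto; field; lra).
      apply Rmult_le_compat_l. lra. apply exp_le. apply (Rmult_le_compat_l a) in q2; [|lra].
      replace (a * (y / a)) with y in q2 by (field; lra). exact q2. }
    assert (Hsm : u (exp (- t)) <= u rs).
    { apply Hbd. split. apply exp_pos. rewrite <- (exp_ln rs) by auto. apply exp_le. lra. }
    assert (Hhalf : 1 / 2 * Uprof p X2 (exp (- t)) < u (exp (- t))).
    { replace (u (exp (- t))) with (u (exp (- t)) / Uprof p X2 (exp (- t)) * Uprof p X2 (exp (- t))) by (field; lra).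
      apply Rmult_lt_compat_r; lra. }
    lra. }
  exists (Zof u u1), (Tof u u1).
  assert (Ho : forall t, orbit n a m (Zof u u1) (Tof u u1) t).
  { intros t. pose proof (exp_pos t) as Hr. destruct (Hode (exp t) Hr) as [D1 [D2 [_ E]]].
    apply (pde_orbit u u1 u2 t); auto. }
  assert (Heu : forall t, u (exp t) = exp (a * (Zof u u1 t + Tof u u1 t / cb a - t))).
  { intros t. apply u_of_ZT. apply Hu, exp_pos. }
  split; auto. split; auto.
  apply (approach_saddle n a m T1 T2); auto.
  - intros t. specialize (Hgt (exp t) (exp_pos t)). rewrite Heu, Uprof_exp in Hgt by lra.
    apply exp_lt_inv in Hgt. apply Rmult_lt_reg_l in Hgt; lra.
  (* The logarithm of [u / U_1] divided by [a] is exactly the distance of [Z + T / cb] from its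
     saddle value. *)
  - set (f := fun t => u (exp t) / Uprof p X1 (exp t)).
    apply (tends_to_ext (fun t => (ln (f t)) / a + (ln a + T1 / cb a)) _ _ 0).
    + intros t _. unfold f. rewrite Heu, profile_ratio, ln_exp by lra. field. split. pose proof (cb_bounds n a Hn Hna). lra. lra.
    + set (c := ln a + T1 / cb a). assert (Ec : ln 1 / a + c = c) by (rewrite ln_1; unfold Rdiv; ring).
      cut (tends_to (fun t => ln (f t) / a + c) (ln 1 / a + c)). { now rewrite Ec. }
      apply (tends_to_comp (fun x => ln x / a + c)); auto.
      auto_derive. lra.
Qed.

Lemma good_singular_unique u v : good_singular N p M X1 X2 u -> good_singular N p M X1 X2 v ->
  exists k, 0 < k /\ forall r, 0 < r -> v r = Rpower k a * u (k * r).
Proof.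
  intros Hu Hv. destruct root_facts as [Hn [Hna [H12 [Hh1 Hh2]]]].
  destruct (good_orbit u Hu) as [Za [Ta [Oa [Ea [La [Ma Pa]]]]]].
  destruct (good_orbit v Hv) as [Zb [Tb [Ob [Eb [Lb [Mb Pb]]]]]].
  destruct (hh_shape n a m Hn Hna T1 T2 H12 Hh1 Hh2) as [Tc [HTc [Hdh _]]].
  destruct (stable_orbit_unique n a m Hn Hna T1 Tc Za Ta Zb Tb Hh1 (proj1 HTc) Hdh Oa Ob La Lb Ma Mb Pa Pb)
    as [c Hc].
  exists (exp c). split. apply exp_pos. intros r Hr. unfold Rpower. rewrite ln_exp.
  rewrite <- (exp_ln r) by auto. rewrite <- exp_plus, Eb, Ea, <- exp_plus. f_equal.
  destruct (Hc (ln r)) as [-> ->]. ring.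
Qed.

Lemma good_singular_exists : exists u, good_singular N p M X1 X2 u.
Proof.
  destruct root_facts as [Hn [Hna [H12 [Hh1 Hh2]]]]. pose proof (cb_bounds n a Hn Hna) as Hb.
  destruct (heteroclinic_exists n a m Hn Hna T1 T2 T_crit H12 Hh1 Hh2) as
    [Z [T [Ho [LZ [LT [LZ' [LT' Hline]]]]]]].
  { intros s. now apply (dulac_pos s). }
  { intros s. now apply (dulac_pos s). }
  set (u := fun r => exp (a * (Z (ln r) + T (ln r) / cb a - ln r))).
  assert (Hlim : forall Zl Tl f g, tends_to f Zl -> tends_to g Tl ->
    tends_to (fun t => f t + g t / cb a) (Zl + Tl / cb a)).
  { intros Zl Tl f g Hf Hg. apply tends_to_plus; auto.
    apply (tends_to_comp (fun x => x / cb a)); auto.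
    auto_derive. lra. }
  assert (Hratio : forall X f g, 0 < X -> tends_to f (ln a) -> tends_to g (T_of X) ->
    tends_to (fun t => exp (a * (f t + g t / cb a - (ln a + T_of X / cb a)))) 1).
  { intros X f g HX0 Hf Hg.
    set (c := ln a + T_of X / cb a).
    assert (Ec : exp (a * (c - c)) = 1) by (rewrite Rminus_diag, Rmult_0_r; apply exp_0).
    cut (tends_to (fun t => exp (a * (f t + g t / cb a - c))) (exp (a * (c - c)))). { now rewrite Ec. }
    apply (tends_to_comp (fun x => exp (a * (x - c))) (fun t => f t + g t / cb a)). now apply Hlim.
    auto_derive. auto. }
  exists u. split; [|split; [|split; [|split]]].
  - intros r _. apply exp_pos.
  - split. { exact (orbit_pde Z T Ho). }
    (* A regular extension would be bounded near 0, whereas [ln u (exp (- t)) = a (Z + T / cb + t)],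
       with [Z] and [T] taken at [- t] and convergent, is unbounded. *)
    intros [w [[w1 [w2 [_ [Lw _]]]] Hw]]. apply filterlim_zero_tends in Lw.
    destruct (Lw 1 ltac:(lra)) as [t1 Ht1].
    destruct (Hlim _ _ _ _ LZ' LT' 1 ltac:(lra)) as [t2 Ht2].
    set (c := ln a + T2 / cb a) in *.
    assert (Hcw : 0 < Rabs (w 0) + 1) by (pose proof (Rabs_pos (w 0)); lra).
    set (t := Rmax (Rmax t1 t2) (ln (Rabs (w 0) + 1) / a - c + 1)).
    pose proof (Rmax_l (Rmax t1 t2) (ln (Rabs (w 0) + 1) / a - c + 1)) as q1.
    pose proof (Rmax_r (Rmax t1 t2) (ln (Rabs (w 0) + 1) / a - c + 1)) as q2.
    Rmax_bounds t1 t2. fold t in q1, q2.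
    specialize (Ht1 t ltac:(lra)). specialize (Ht2 t ltac:(lra)).
    rewrite Hw in Ht1 by apply exp_pos. unfold u in Ht1. rewrite ln_exp in Ht1.
    apply Rabs_def2 in Ht2. apply Rabs_def2 in Ht1. destruct Ht1 as [Ht1 _]. destruct Ht2 as [_ Ht2].
    assert (Hge : Rabs (w 0) + 1 <= exp (a * (Z (- t) + T (- t) / cb a - - t))).
    { rewrite <- (exp_ln (Rabs (w 0) + 1)) by auto. apply exp_le.
      apply (Rmult_le_reg_r (/ a)). apply Rinv_0_lt_compat; lra.
      replace (a * (Z (- t) + T (- t) / cb a - - t) * / a) with (Z (- t) + T (- t) / cb a - - t) by (field; lra).
      unfold Rdiv in *. lra. }
    pose proof (Rle_abs (w 0)). lra.
  - apply filterlim_zero_tends.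
    apply (tends_to_ext (fun t => exp (a * (Z (- t) + T (- t) / cb a - (ln a + T2 / cb a)))) _ _ 0).
    + intros t _. unfold u. rewrite ln_exp, profile_ratio by lra. f_equal. ring.
    + apply (Hratio X2 (fun t => Z (- t)) (fun t => T (- t))); auto. lra.
  - apply filterlim_infty_tends.
    apply (tends_to_ext (fun t => exp (a * (Z t + T t / cb a - (ln a + T1 / cb a)))) _ _ 0).
    + intros t _. unfold u. rewrite ln_exp, profile_ratio by lra. f_equal. ring.
    + apply Hratio; auto. lra.
  - intros r Hr. rewrite <- (exp_ln r) at 2 by auto. rewrite Uprof_exp by lra.
    unfold u. apply exp_increasing. apply Rmult_lt_compat_l. lra.
    specialize (Hline (ln r)).
    assert ((T (ln r) - T1) / cb a = T (ln r) / cb a - T1 / cb a) by (field; lra). lra.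
Qed.
End Profiles.
End Emden.

Theorem theorem4p15 (N : nat) (p : R) :
  (3 <= N)%nat -> 1 < p -> p < INR N / (INR N - 2) ->
  (forall M, Mbar N p <= M <= 0 -> ~ exists u, ground_state N p M u) /\
  (forall M X1 X2, Mbar N p <= M < - mu_star N p ->
     0 < X1 < X2 -> Xeq N p M X1 -> Xeq N p M X2 ->
     (exists u, good_singular N p M X1 X2 u) /\
     (forall u v, good_singular N p M X1 X2 u -> good_singular N p M X1 X2 v ->
        exists k, 0 < k /\ forall r, 0 < r ->
          v r = Rpower k (2 / (p - 1)) * u (k * r))).
Proof.
  intros HN Hp1 Hp2. split.
  - intros M HM [u Hu]. exact (no_ground_state N p M HN Hp1 Hp2 u HM Hu).
  - intros M X1 X2 [HM _] HX HE1 HE2. split.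
    + exact (good_singular_exists N p M HN Hp1 Hp2 X1 X2 HM HX HE1 HE2).
    + intros u v. exact (good_singular_unique N p M HN Hp1 Hp2 X1 X2 HX HE1 HE2 u v).
Qed.
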